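(* Let $\|\cdot\|$ be a norm on $\mathbb{R}^d$ with dual norm $\|\cdot\|_*$ and let $\mathcal{B},\mathcal{B}_*$ be the closed unit balls of $\|\cdot\|$ and $\|\cdot\|_*$ respectively. Let $X\in\mathbb{R}^d$ be a zero-mean random vector with covariance matrix $\Sigma\succ0$ such that for some constants $\eta_1,\eta_2\ge 0$, for every $p\ge 1$ and $u\in\mathbb{R}^d$, $$\mathbb{E}\left(|\langle u,X\rangle|^{2p}\right)\le p!\,\left(\eta_1\|u\|_\Sigma\right)^{2p}+(2p)!\,\left(\eta_2\|u\|_*\right)^{2p}.$$ For parameters $\rho_0\ge0$ and $\kappa_0>0$ let $$f_0(x)=\inf_{y\in\mathbb{R}^d}\ \frac{\kappa_0}{2}\|x-y\|_{\Sigma^{-1/2}}^2+\rho_0\|y\| .$$ With $G\sim\mathrm{Normal}(0,I)$ a standard Gaussian vector in $\mathbb{R}^d$, let $$\underline{\lambda}_\Sigma(\kappa_0,\rho_0)=\inf_{x\in\partial\mathcal{B}}\mathbb{E}\left(\left(\left|\langle\nabla f_0(\Sigma^{1/2}G),x\rangle\right|-1\right)_+\right),\qquad T_{\ge}(s)=1-T_{<}(s)=\mathbb{P}\left(\|G\|_*\ge s\right),$$ $$\begin{aligned}\Omega_\Sigma(p,\kappa_0,\rho_0)=\ &\eta_1\sqrt{p}\,\min\Bigg\{\rho_0\|\Sigma\|_\square^{1/2},\ \inf_{\tau\in(0,1]}\Bigg[T_{\ge}^{1/(2p)}\left(\frac{\rho_0}{\tau\kappa_0}\right)\rho_0\|\Sigma\|_\square^{1/2}\\&+T_{<}^{1/(4p)}\left(\frac{\rho_0}{\tau\kappa_0}\right)\kappa_0\left((1-\tau)\|\Sigma\|_{\mathrm{op}}^{1/4}\sqrt{\operatorname{tr}(\Sigma^{1/2})}+\tau\sqrt{\operatorname{tr}\Sigma}+\sqrt{2p}\sqrt{\|\Sigma\|_{\mathrm{op}}}\right)\Bigg]\Bigg\}+2\eta_2\,p\,\rho_0,\end{aligned}$$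 $$\bar\nu_\Sigma(\kappa_0,\rho_0)=\min\left\{\frac{\rho_0}{\underline{\lambda}_\Sigma(\kappa_0,\rho_0)},\ \frac{\kappa_0^2\left(T_{\ge}(\rho_0/\kappa_0)\left(\|\Sigma^{-1}\|_{\mathrm{op}}\|\Sigma\|_{\mathrm{op}}-1\right)+1\right)\operatorname{rad}^2(\mathcal{B})}{\underline{\lambda}_\Sigma^2(\kappa_0,\rho_0)}+1\right\},$$ where $\|M\|_\square=\sup_{u\in\mathcal{B}_*}u^\top M u$ for symmetric $M\in\mathbb{R}^{d\times d}$ and $\operatorname{rad}(\mathcal{B})=\sup_{x\in\mathcal{B}}\|x\|_2$. Then, for any $t\ge0$, with probability at least $1-e^{-t}$, $$\|X\|\le\inf\left\{e^{t/(2p)}\,\Omega_\Sigma(p,\kappa_0,\rho_0)\,\bar\nu_\Sigma^{1/(2p)}(\kappa_0,\rho_0)\ :\ p\ge1,\ \rho_0\ge0,\ \kappa_0>0\right\}.$$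
   Context: $(z)_+=\max\{z,0\}$. For a positive semidefinite matrix $M$, $\|u\|_M=\sqrt{u^\top M u}$. For real $p$, $p!$ means $\Gamma(p+1)$. $\|\cdot\|_{\mathrm{op}}$ is the operator (spectral) norm, $\|\cdot\|_2$ the Euclidean norm, $\partial\mathcal{B}$ the boundary of $\mathcal{B}$. The function $f_0$ is convex and differentiable, being a Moreau-type envelope. Powers such as $T_{\ge}^{1/(2p)}(s)$ mean $(T_{\ge}(s))^{1/(2p)}$. Convention: $a/0=+\infty$ for every $a\ge0$ (so $\bar\nu_\Sigma=+\infty$ when $\underline{\lambda}_\Sigma=0$), and $0\cdot\infty=+\infty$. *)

(* Defs.v *)
From HB Require Import structures.
From mathcomp Require Export all_boot all_order all_algebra.
From mathcomp Require Export all_classical all_reals all_analysis.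

Set Implicit Arguments.
Unset Strict Implicit.
Unset Printing Implicit Defensive.

Import Order.TTheory GRing.Theory Num.Theory.
Import numFieldNormedType.Exports.

Local Open Scope classical_set_scope.
Local Open Scope ring_scope.

Section LinearAlgebra.
Context {R : realType} {d : nat}.
Implicit Types (u v x : 'cV[R]_d) (M : 'M[R]_d).

Definition dotv u v : R := (u^T *m v) 0 0.

Definition norm2 u : R := Num.sqrt (dotv u u).

Definition qform M u : R := (u^T *m M *m u) 0 0.

Definition psdmx M : Prop := M^T = M /\ forall u, 0 <= qform M u.

Definition pdmx M : Prop := M^T = M /\ forall u, u != 0 -> 0 < qform M u.

Definition normM M u : R := Num.sqrt (qform M u).

(* The unique positive semidefinite square root of a positive semidefinite
   matrix (0 by default when there is none). *)
Definition sqrtmx M : 'M[R]_d := xget 0 [set S | psdmx S /\ S *m S = M].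

Definition opnorm M : R := sup [set norm2 (M *m x) | x in [set x | norm2 x <= 1]].

End LinearAlgebra.

Section Norms.
Context {R : realType} {d : nat}.
Implicit Types (N : 'cV[R]_d -> R) (A : set 'cV[R]_d).

Definition is_norm N : Prop :=
  [/\ forall x y, N (x + y) <= N x + N y,
      forall (a : R) x, N (a *: x) = `|a| * N x
    & forall x, N x = 0 -> x = 0].

Definition unit_ball N : set 'cV[R]_d := [set x | N x <= 1].

Definition dual_norm N u : R := sup [set dotv u x | x in unit_ball N].

(* Closure and interior are taken in the library's topology on 'cV[R]_d, which
   is the topology of every norm on R^d. *)
Definition boundary A : set 'cV[R]_d := closure A `\` interior A.

Definition square_norm N (M : 'M[R]_d) : R :=
  sup [set qform M u | u in unit_ball (dual_norm N)].

Definition rad A : R := sup [set norm2 x | x in A].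

End Norms.

Definition Gamma {R : realType} (z : R) : R :=
  \int[lebesgue_measure]_(x in `]0, +oo[) (x `^ (z - 1) * expR (- x)).

Definition rfact {R : realType} (p : R) : R := Gamma (p + 1).

(* The gradient of a differentiable function: the vector of its partial
   derivatives. *)
Definition grad {R : realType} {d : nat} (f : 'cV[R]_d -> R) (x : 'cV[R]_d) :
  'cV[R]_d := \col_i 'D_(delta_mx i 0) f x.

(* A random vector is given by its coordinates, so that Borel measurability is
   measurability of each coordinate. *)
Definition rvec {R : realType} {d : nat} {disp : measure_display}
    {T : measurableType disp} {P : probability T R}
    (X : 'I_d -> {RV P >-> R}) (w : T) : 'cV[R]_d :=
  \col_i X i w.

(* Normal(0, I) is the d-fold product of the one-dimensional Normal(0, 1); a
   probability on R^d is determined by its values on measurable boxes. *)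
Definition std_gaussian {R : realType} {d : nat} {disp : measure_display}
    {T : measurableType disp} {P : probability T R}
    (G : 'I_d -> {RV P >-> R}) : Prop :=
  forall A : 'I_d -> set R, (forall i, measurable (A i)) ->
    P [set w | forall i, A i (G i w)] =
    (\prod_(i < d) normal_prob 0 1 (A i))%E.

(* The conventions a / 0 = +oo for all a >= 0 (including a = 0) and
   0 * +oo = +oo; the operations of \bar R give 0 in these two cases. *)
Definition div_infty {R : realType} (a b : \bar R) : \bar R :=
  if b == 0%E then +oo%E else (a / b)%E.

Definition mul_infty {R : realType} (a b : \bar R) : \bar R :=
  if (a == 0%E) && (b == +oo%E) || (a == +oo%E) && (b == 0%E) then +oo%E
  else (a * b)%E.

Section Bound.
Context {R : realType} {d : nat} {disp : measure_display}
  {T : measurableType disp} {P : probability T R}.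
Variables (N : 'cV[R]_d -> R) (Sigma : 'M[R]_d) (G : 'I_d -> {RV P >-> R}).
Implicit Types (p kappa rho eta s t tau : R).

Definition f0 kappa0 rho0 (x : 'cV[R]_d) : R :=
  inf [set kappa0 / 2 * normM (invmx (sqrtmx Sigma)) (x - y) ^+ 2 + rho0 * N y
      | y in [set: 'cV[R]_d]].

Definition lambda_inf kappa0 rho0 : \bar R :=
  ereal_inf [set ('E_P[fun w => Num.max
       (`|dotv (grad (f0 kappa0 rho0) (sqrtmx Sigma *m rvec G w)) x| - 1)%R
       0%R])%E
     | x in boundary (unit_ball N)].

Definition T_ge s : R := fine (P [set w | s <= dual_norm N (rvec G w)]).

Definition T_lt s : R := 1 - T_ge s.

Definition Omega_Sigma eta1 eta2 p kappa0 rho0 : R :=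
  eta1 * Num.sqrt p *
  Num.min (rho0 * Num.sqrt (square_norm N Sigma))
    (inf [set T_ge (rho0 / (tau * kappa0)) `^ (1 / (2 * p))
                * rho0 * Num.sqrt (square_norm N Sigma)
              + T_lt (rho0 / (tau * kappa0)) `^ (1 / (4 * p)) * kappa0
                * ((1 - tau) * opnorm Sigma `^ (1 / 4)
                     * Num.sqrt (\tr (sqrtmx Sigma))
                   + tau * Num.sqrt (\tr Sigma)
                   + Num.sqrt (2 * p) * Num.sqrt (opnorm Sigma))
         | tau in `]0, 1] ])
  + 2 * eta2 * p * rho0.

Definition nu_bar kappa0 rho0 : \bar R :=
  Order.min
    (div_infty rho0%:E (lambda_inf kappa0 rho0))
    (div_infty
       (kappa0 ^+ 2
        * (T_ge (rho0 / kappa0) * (opnorm (invmx Sigma) * opnorm Sigma - 1) + 1)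
        * rad (unit_ball N) ^+ 2)%:E
       (lambda_inf kappa0 rho0 ^+ 2) + 1)%E.

Definition tail_bound eta1 eta2 t p kappa0 rho0 : \bar R :=
  mul_infty (expR (t / (2 * p)) * Omega_Sigma eta1 eta2 p kappa0 rho0)%:E
            (nu_bar kappa0 rho0 `^ (1 / (2 * p)))%E.

End Bound.

(* Main.v *)
(* Let F(g) be the gradient of f_0 at Sigma^(1/2) g.  For fixed p, rho_0, kappa_0
   the random variable Z = E_G |<F(G), X>|^(2p) controls ||X||:

   - ||X||^(2p) <= nu_bar Z, because P(|<F(G), x>| >= 1) >= 1 / nu_bar whenever
     ||x|| = 1.  With W = (|<F(G), x>| - 1)_+ this follows from
     W <= rho_0 1_(|<F(G), x>| >= 1), or from the Paley-Zygmund argument and a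
     bound on Var W.  F is Lipschitz everywhere, with the better constant kappa_0
     where ||g||_* < rho_0 / kappa_0 since there F(g) = kappa_0 g; the variance
     is then bounded by a Gaussian Poincare inequality whose constant is local.
     That inequality is obtained without differentiation by expanding to second
     order Maurey's inequality E e^u E e^v <= 1, valid when
     u(x) + v(y) <= |x - y|^2 / 4 for all x, y.

   - E Z <= Omega^(2p): exchange the expectations and apply the moment hypothesis
     with u = F(G).  Since ||F(G)||_* <= rho_0, only E ||F(G)||_Sigma^(2p) matters.
     On ||G||_* < rho_0 / (tau kappa_0), F(G) is compared with
     F(tau G) = kappa_0 tau G, and what remains are moments of Gaussian quadratic
     forms, computed recursively by Stein's identity.

   Markov's inequality gives the tail bound for each choice of parameters. *)

Require Import Defs.
From mathcomp Require Import complex measurable_realfun.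
From mathcomp Require Import ring lra.

Set Implicit Arguments.
Unset Strict Implicit.
Unset Printing Implicit Defensive.

Import Order.TTheory GRing.Theory Num.Theory.
Import numFieldNormedType.Exports.

Local Open Scope classical_set_scope.
Local Open Scope ring_scope.

(** * Linear algebra *)

Section DotProduct.
Context {R : realType} {d : nat}.
Implicit Types (u v x y : 'cV[R]_d) (A B : 'M[R]_d).

(** [F] is only Lipschitz, so the variance bound must come from an argument that never
    differentiates it. In Maurey's inequality take v = - e h and for u the inf-convolution of e h
    with |.|^2 / 4: then u >= e h - e^2 l, with l the square of a local Lipschitz constant, while E
    e^(e h) E e^(- e h) exceeds 1 by e^2 Var h at leading order. Hence Var h <= E l, and the two
    values of l, weighted by [T_ge] and its complement, give the factor T (cond - 1) + 1 of
    [nu_bar].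

    [Omega_Sigma] records the inequalities used: sqrt p and 2 p come from Gamma(q + 1) <= q^q at q =
    p and q = 2 p; the exponent 1/(4p) of [T_lt] from Cauchy-Schwarz near the origin, which raises
    the moment to order 4 p and so puts sqrt(2 p) in the bracket; the fourth root of [opnorm Sigma]
    from passing between the norm of Sigma and that of its square root, the one in which [F] is
    kappa_0-Lipschitz.

    The infimum over the parameters need not be attained, so its tail event is approximated by
    levels decreasing to it. *)

Lemma dotvE u v : dotv u v = \sum_i u i 0 * v i 0.
Proof. by rewrite /dotv mxE; apply: eq_bigr => i _; rewrite !mxE. Qed.

Lemma dotvC u v : dotv u v = dotv v u.
Proof. by rewrite !dotvE; apply: eq_bigr => i _; rewrite mulrC. Qed.

Lemma dotvDr u v x : dotv u (v + x) = dotv u v + dotv u x.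
Proof. by rewrite /dotv mulmxDr mxE. Qed.

Lemma dotvZr u (a : R) v : dotv u (a *: v) = a * dotv u v.
Proof. by rewrite /dotv -scalemxAr mxE. Qed.

Lemma dotvDl u v x : dotv (u + v) x = dotv u x + dotv v x.
Proof. by rewrite dotvC dotvDr !(dotvC x). Qed.

Lemma dotvZl u (a : R) v : dotv (a *: u) v = a * dotv u v.
Proof. by rewrite dotvC dotvZr dotvC. Qed.

Lemma dotvNr u v : dotv u (- v) = - dotv u v.
Proof. by rewrite -scaleN1r dotvZr mulN1r. Qed.

Lemma dotvNl u v : dotv (- u) v = - dotv u v.
Proof. by rewrite dotvC dotvNr dotvC. Qed.

Lemma dotvBl u v x : dotv (u - v) x = dotv u x - dotv v x.
Proof. by rewrite dotvDl dotvNl. Qed.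

Lemma dotv0r u : dotv u 0 = 0.
Proof. by rewrite -(scale0r 0) dotvZr mul0r. Qed.

Lemma dotv0l u : dotv 0 u = 0.
Proof. by rewrite dotvC dotv0r. Qed.

Lemma dotv_delta i u : dotv (delta_mx i 0) u = u i 0.
Proof.
rewrite dotvE (bigD1 i)//= big1 ?addr0; first by rewrite mxE !eqxx mul1r.
by move=> j ji; rewrite mxE (negPf ji) mul0r.
Qed.

Lemma dotvv_ge0 u : 0 <= dotv u u.
Proof. by rewrite dotvE; apply: sumr_ge0 => i _; rewrite -expr2 sqr_ge0. Qed.

Lemma sqr_coord_le u i : u i 0 ^+ 2 <= dotv u u.
Proof.
rewrite dotvE (bigD1 i)//= -expr2 lerDl.
by apply: sumr_ge0 => j _; rewrite -expr2 sqr_ge0.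
Qed.

Lemma dotvv_eq0 u : dotv u u = 0 -> u = 0.
Proof.
move=> u0; apply/matrixP => i j; rewrite (ord1 j) mxE.
apply/eqP; rewrite -sqrf_eq0 eq_le sqr_ge0 andbT -u0.
exact: sqr_coord_le.
Qed.

Lemma dotv_mull A u v : dotv (A *m u) v = dotv u (A^T *m v).
Proof. by rewrite /dotv trmx_mul mulmxA. Qed.

Lemma qformE A u : qform A u = dotv u (A *m u).
Proof. by rewrite /qform /dotv mulmxA. Qed.

Lemma qform_delta A i : qform A (delta_mx i 0) = A i i.
Proof. by rewrite qformE dotv_delta -colE mxE. Qed.

Lemma qform1 u : qform 1%:M u = dotv u u.
Proof. by rewrite qformE mul1mx. Qed.

Lemma psdmx1 : psdmx (1%:M : 'M[R]_d).
Proof. by split; [rewrite trmx1 | move=> u; rewrite qform1 dotvv_ge0]. Qed.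

Lemma normM1 u : normM 1%:M u = norm2 u.
Proof. by rewrite /normM qform1. Qed.

Lemma sym_dotvC A u v : A^T = A -> dotv u (A *m v) = dotv v (A *m u).
Proof. by move=> sA; rewrite dotvC dotv_mull sA. Qed.

Lemma qformD A u v : A^T = A ->
  qform A (u + v) = qform A u + 2 * dotv u (A *m v) + qform A v.
Proof.
move=> sA; rewrite !qformE mulmxDr dotvDl !dotvDr (sym_dotvC v u sA); ring.
Qed.

Lemma qformZ A (a : R) u : qform A (a *: u) = a ^+ 2 * qform A u.
Proof. by rewrite !qformE -scalemxAr dotvZr dotvZl mulrA expr2. Qed.

Lemma qformN A u : qform A (- u) = qform A u.
Proof. by rewrite -scaleN1r qformZ sqrrN expr1n mul1r. Qed.

Lemma qform0 A : qform A 0 = 0.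
Proof. by rewrite qformE dotv0l. Qed.

(** Common source of the Cauchy-Schwarz inequalities for semidefinite forms and for expectations.
    The main case evaluates the polynomial at its minimiser - b / c. *)
Lemma quadratic_ge0_disc (a b c : R) : 0 <= c ->
  (forall t, 0 <= a + 2 * t * b + t ^+ 2 * c) -> b ^+ 2 <= a * c.
Proof.
move=> c0 H; have [cE|cN] := eqVneq c 0.
  have a0 : 0 <= a by have := H 0; rewrite !(mulr0, mul0r, addr0) expr0n/= mul0r addr0.
  have [->|bN] := eqVneq b 0; first by rewrite expr0n/= mulr_ge0.
  (* With [c = 0] the polynomial is affine in [t]; here it would equal -1. *)
  have := H (- (a + 1) / (2 * b)); rewrite cE mulr0 addr0.
  have -> : a + 2 * (- (a + 1) / (2 * b)) * b = -1 by field.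
  by rewrite ler0N1.
have cp : 0 < c by rewrite lt_def cN c0.
have := H (- b / c).
have -> : a + 2 * (- b / c) * b + (- b / c) ^+ 2 * c = (a * c - b ^+ 2) / c.
  by field.
by rewrite pmulr_lge0 ?invr_gt0// subr_ge0.
Qed.

Lemma psd_CS2 A u v : psdmx A ->
  dotv u (A *m v) ^+ 2 <= qform A u * qform A v.
Proof.
move=> [sA pA]; apply: quadratic_ge0_disc => // t.
have := pA (u + t *: v); rewrite qformD// qformZ -scalemxAr dotvZr.
by rewrite mulrA.
Qed.

Lemma psd_CS A u v : psdmx A -> dotv u (A *m v) <= normM A u * normM A v.
Proof.
move=> pA; rewrite /normM -sqrtrM; last by case: pA.
apply: le_trans (ler_norm _) _; rewrite -sqrtr_sqr ler_sqrt ?psd_CS2//.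
by case: pA => _ pA; rewrite mulr_ge0.
Qed.

Lemma normM_ge0 A u : 0 <= normM A u.
Proof. exact: sqrtr_ge0. Qed.

Lemma normM_sqr A u : psdmx A -> normM A u ^+ 2 = qform A u.
Proof. by case=> _ pA; rewrite /normM sqr_sqrtr. Qed.

Lemma normM_triangle A u v : psdmx A -> normM A (u + v) <= normM A u + normM A v.
Proof.
move=> pA; rewrite -ler_sqr ?nnegrE ?addr_ge0 ?normM_ge0// normM_sqr//.
rewrite qformD; last by case: pA.
rewrite sqrrD !normM_sqr// lerD2r lerD2l -[leRHS]mulr_natl ler_pM2l//.
exact: psd_CS.
Qed.

Lemma normMZ A (a : R) u : normM A (a *: u) = `|a| * normM A u.
Proof. by rewrite /normM qformZ sqrtrM ?sqr_ge0// sqrtr_sqr. Qed.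

Lemma norm2_ge0 u : 0 <= norm2 u.
Proof. exact: sqrtr_ge0. Qed.

Lemma norm2_sqr u : norm2 u ^+ 2 = dotv u u.
Proof. by rewrite /norm2 sqr_sqrtr// dotvv_ge0. Qed.

Lemma norm2D u v : norm2 (u + v) <= norm2 u + norm2 v.
Proof. by rewrite -!normM1; exact/normM_triangle/psdmx1. Qed.

Lemma norm2Z (a : R) u : norm2 (a *: u) = `|a| * norm2 u.
Proof. by rewrite -!normM1 normMZ. Qed.

Lemma norm2N u : norm2 (- u) = norm2 u.
Proof. by rewrite -scaleN1r norm2Z normrN1 mul1r. Qed.

Lemma norm20 : norm2 (0 : 'cV[R]_d) = 0.
Proof. by rewrite /norm2 dotv0l sqrtr0. Qed.

Lemma norm2_eq0 u : norm2 u = 0 -> u = 0.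
Proof. by move=> u0; apply: dotvv_eq0; rewrite -norm2_sqr u0 expr0n. Qed.

Lemma norm2_gt0 u : u != 0 -> 0 < norm2 u.
Proof.
move=> u0; rewrite lt_def norm2_ge0 andbT; apply: contra_neq u0.
exact: norm2_eq0.
Qed.

Lemma dotv_CS u v : dotv u v <= norm2 u * norm2 v.
Proof. by rewrite -!normM1 -{1}[v]mul1mx; exact/psd_CS/psdmx1. Qed.

Lemma normr_dotv_CS u v : `|dotv u v| <= norm2 u * norm2 v.
Proof.
rewrite ler_norml dotv_CS andbT lerNl -dotvNl.
by rewrite -[norm2 u]norm2N dotv_CS.
Qed.

Lemma coord_le_norm2 u i : `|u i 0| <= norm2 u.
Proof.
by rewrite -ler_sqr ?nnegrE ?norm2_ge0// real_normK ?num_real// norm2_sqr sqr_coord_le.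
Qed.

Lemma norm2_le_sum u : norm2 u <= \sum_i `|u i 0|.
Proof.
have s0 : 0 <= \sum_i `|u i 0| by apply: sumr_ge0.
rewrite -ler_sqr ?nnegrE ?norm2_ge0// norm2_sqr dotvE.
rewrite expr2 mulr_suml; apply: ler_sum => i _.
rewrite -expr2 -real_normK ?num_real// expr2 ler_wpM2l//.
by rewrite (bigD1 i)//= lerDl sumr_ge0.
Qed.

Lemma psd_of_pd A : pdmx A -> psdmx A.
Proof.
move=> [sA pA]; split=> // u; have [->|u0] := eqVneq u 0; last exact/ltW/pA.
by rewrite qform0.
Qed.

Lemma pd_unitmx A : pdmx A -> A \in unitmx.
Proof.
move=> [sA pA]; rewrite unitmxE unitfE; apply/det0P => -[v v0 vA].
have := pA v^T; rewrite -(inj_eq trmx_inj) trmxK trmx0 => /(_ v0).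
by rewrite /qform trmxK vA mul0mx mxE ltxx.
Qed.

Definition opset A := [set norm2 (A *m x) | x in [set x | norm2 x <= 1]].

Lemma opset_has_sup A : has_sup (opset A).
Proof.
split; first by exists 0, 0 => /=; rewrite ?mulmx0 norm20.
exists (\sum_i norm2 (row i A)^T) => _ /= [x x1 <-].
apply: le_trans (norm2_le_sum _) _; apply: ler_sum => i _.
have -> : (A *m x) i 0 = dotv (row i A)^T x.
  by rewrite /dotv trmxK -row_mul [RHS]mxE.
apply: le_trans (normr_dotv_CS _ _) _.
by rewrite ler_piMr ?norm2_ge0.
Qed.

Lemma opnorm_ge0 A : 0 <= opnorm A.
Proof.
apply: sup_upper_bound; first exact: opset_has_sup.
by exists 0 => /=; rewrite ?mulmx0 norm20.
Qed.

Lemma norm2_mulmx_le A x : norm2 (A *m x) <= opnorm A * norm2 x.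
Proof.
have [->|x0] := eqVneq x 0; first by rewrite mulmx0 norm20 mulr0.
have xp := norm2_gt0 x0; rewrite -ler_pdivrMr//.
apply: sup_upper_bound; first exact: opset_has_sup.
exists ((norm2 x)^-1 *: x) => /=.
  by rewrite norm2Z ger0_norm ?invr_ge0 ?norm2_ge0// mulVf ?gt_eqF.
by rewrite -scalemxAr norm2Z ger0_norm ?invr_ge0 ?norm2_ge0// mulrC.
Qed.

Lemma opnorm_le A (c : R) : 0 <= c ->
  (forall x, norm2 (A *m x) <= c * norm2 x) -> opnorm A <= c.
Proof.
move=> c0 H; apply: ge_sup; first by case: (opset_has_sup A).
move=> _ [x /= x1 <-]; apply: le_trans (H x) _.
by rewrite ler_piMr.
Qed.

Lemma qform_le A u : qform A u <= opnorm A * dotv u u.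
Proof.
rewrite qformE; apply: le_trans (dotv_CS _ _) _.
rewrite -norm2_sqr mulrC expr2 mulrA ler_wpM2r ?norm2_ge0//.
exact: norm2_mulmx_le.
Qed.

(** No square root of [A] is involved: for w = A u, Cauchy-Schwarz for the form of [A] gives |w|^4 =
    <w, A u>^2 <= <w, A w> <u, A u>, and <w, A w> is at most the operator norm times |w|^2. *)
Lemma psd_mulmx_sqr_le A u : psdmx A ->
  dotv (A *m u) (A *m u) <= opnorm A * qform A u.
Proof.
move=> pA; have [pA1 pA2] := pA; set w := A *m u.
have [w0|w0] := eqVneq (dotv w w) 0.
  by rewrite w0 mulr_ge0// opnorm_ge0.
have wp : 0 < dotv w w by rewrite lt_def w0 dotvv_ge0.
rewrite -(ler_pM2l wp) -expr2.
apply: le_trans (psd_CS2 w u pA) _.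
by rewrite mulrA ler_wpM2r// mulrC qform_le.
Qed.

(** |A x|^2 = <x, A A x>. This converts norms of the square root of [Sigma] into norms of
    [Sigma]. *)
Lemma opnorm_sqr_sym A : A^T = A -> opnorm A ^+ 2 <= opnorm (A *m A).
Proof.
move=> sA; rewrite -[leRHS]sqr_sqrtr ?opnorm_ge0//.
rewrite ler_sqr ?nnegrE ?opnorm_ge0 ?sqrtr_ge0//.
apply: opnorm_le => [|x]; first exact: sqrtr_ge0.
rewrite -ler_sqr ?nnegrE ?mulr_ge0 ?norm2_ge0 ?sqrtr_ge0//.
rewrite exprMn !norm2_sqr sqr_sqrtr ?opnorm_ge0//.
by rewrite dotv_mull sA mulmxA -qformE qform_le.
Qed.

End DotProduct.

Lemma opnorm_inv_ge1 {R : realType} {d : nat} (A : 'M[R]_d) : (0 < d)%N ->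
  A \in unitmx -> 1 <= opnorm (invmx A) * opnorm A.
Proof.
move=> d0 uA; pose x : 'cV[R]_d := const_mx 1.
have x0 : x != 0.
  apply/eqP => /matrixP/(_ (Ordinal d0) 0); rewrite !mxE => /eqP.
  by rewrite oner_eq0.
have := norm2_mulmx_le (invmx A) (A *m x); rewrite mulKmx// => H.
have := le_trans H (ler_wpM2l (opnorm_ge0 _) (norm2_mulmx_le A x)).
by rewrite mulrA ler_pMl ?norm2_gt0.
Qed.

(** * Norms *)

Section Topology.
Context {R : realType}.

Lemma coord_le_mx_norm m n (A : 'M[R]_(m, n)) i j : `|A i j| <= `|A|.
Proof.
rewrite [leRHS]/Num.norm /= mx_normrE.
by apply/bigmax_geP; right; exists (i, j).
Qed.

Lemma lipschitz_continuous m n (f : 'M[R]_(m, n) -> R) (K : R) :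
  (forall x y, `|f x - f y| <= K * `|x - y|) -> continuous f.
Proof.
move=> H x B /nbhs_ballP[e /= e0 He].
have K0 : 0 < `|K| + 1 by rewrite ltr_wpDl.
apply/nbhs_ballP; exists (e / (`|K| + 1)) => /= [|y]; first by rewrite divr_gt0.
rewrite -ball_normE /= ltr_pdivlMr// mulrC => yx.
apply: He; rewrite -ball_normE /=.
apply: le_lt_trans (H x y) _; apply: le_lt_trans yx.
by rewrite ler_wpM2r// (le_trans (ler_norm _))// lerDl.
Qed.

Lemma norm2_trmx_le_mx_norm d (u : 'rV[R]_d) : norm2 u^T <= d%:R * `|u|.
Proof.
apply: le_trans (norm2_le_sum _) _.
apply: (@le_trans _ _ (\sum_(i < d) `|u|)).
  by apply: ler_sum => i _; rewrite mxE; exact: coord_le_mx_norm.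
by rewrite sumr_const card_ord mulr_natl.
Qed.

Lemma norm2_dist d (x y : 'cV[R]_d) : `|norm2 x - norm2 y| <= norm2 (x - y).
Proof.
have H (a b : 'cV[R]_d) : norm2 a <= norm2 (a - b) + norm2 b
  by rewrite -{1}(subrK b a) norm2D.
have := H y x; have := H x y; rewrite -(norm2N (y - x)) opprB ler_norml.
by move=> ? ?; apply/andP; split; lra.
Qed.

Lemma trmx_norm2_continuous d (f : 'cV[R]_d -> R) (K : R) :
  (forall x y, `|f x - f y| <= K * norm2 (x - y)) ->
  continuous (fun v : 'rV[R]_d => f v^T).
Proof.
move=> Lf; have K0 : 0 <= Num.max K 0 by rewrite le_max lexx orbT.
apply: (@lipschitz_continuous _ _ _ (Num.max K 0 * d%:R)) => x y.
apply: le_trans (Lf _ _) _; rewrite -linearB /= -mulrA.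
apply: (@le_trans _ _ (Num.max K 0 * norm2 (x - y)^T)).
  by rewrite ler_wpM2r ?norm2_ge0// le_max lexx.
by rewrite ler_wpM2l// norm2_trmx_le_mx_norm.
Qed.

(* [bounded_closed_compact] is only available for row vectors, hence the
   transpositions. *)
Lemma min_on_norm2 d (f : 'cV[R]_d -> R) (A : set 'cV[R]_d) (r : R) :
  continuous (fun v : 'rV[R]_d => f v^T) ->
  A !=set0 -> closed (trmx @^-1` A) -> (forall x, A x -> norm2 x <= r) ->
  exists2 x, A x & forall y, A y -> f x <= f y.
Proof.
move=> cg [x0 Ax0] cA bA.
have cpt : compact (trmx @^-1` A : set 'rV[R]_d).
  apply: bounded_closed_compact => //.
  exists r; split; first exact: num_real.
  move=> M rM v /= Av; rewrite /Num.norm /= mx_normrE.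
  apply/bigmax_leP; split=> [|[i j] _] /=.
    exact: le_trans (le_trans (norm2_ge0 _) (bA _ Av)) (ltW rM).
  have := coord_le_norm2 v^T j; rewrite mxE (ord1 i) => H.
  exact: le_trans (le_trans H (bA _ Av)) (ltW rM).
have [||c] := @EVT_min_rV R d (fun v => f v^T) (trmx @^-1` A) _ cpt.
- by exists x0^T; rewrite /= trmxK.
- exact: continuous_subspaceT.
- rewrite inE => cA' cmin; exists c^T => // y Ay.
  have := cmin y^T; rewrite inE /= trmxK; exact.
Qed.

Lemma closed_norm2_le d (r : R) :
  closed (trmx @^-1` [set x : 'cV[R]_d | norm2 x <= r] : set 'rV[R]_d).
Proof.
have cg : continuous (fun v : 'rV[R]_d => norm2 v^T).
  by apply: (@trmx_norm2_continuous d norm2 1) => x y; rewrite mul1r norm2_dist.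
rewrite (_ : _ @^-1` _ = (fun v : 'rV[R]_d => norm2 v^T) @^-1` [set x | x <= r])//.
by apply: closed_comp => // x _; exact: cg.
Qed.

Lemma closed_norm2_eq d (r : R) :
  closed (trmx @^-1` [set x : 'cV[R]_d | norm2 x = r] : set 'rV[R]_d).
Proof.
have cg : continuous (fun v : 'rV[R]_d => norm2 v^T).
  by apply: (@trmx_norm2_continuous d norm2 1) => x y; rewrite mul1r norm2_dist.
rewrite (_ : _ @^-1` _ = (fun v : 'rV[R]_d => norm2 v^T) @^-1` [set x | x = r])//.
by apply: closed_comp => // x _; exact: cg.
Qed.

End Topology.

Section NormTheory.
Context {R : realType} {d : nat} (N : 'cV[R]_d -> R) (hN : is_norm N).
Implicit Types u v x y : 'cV[R]_d.

Lemma is_normD x y : N (x + y) <= N x + N y.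
Proof. by case: hN. Qed.

Lemma is_normZ (a : R) x : N (a *: x) = `|a| * N x.
Proof. by case: hN. Qed.

Lemma is_norm0 : N 0 = 0.
Proof. by rewrite -(scale0r 0) is_normZ normr0 mul0r. Qed.

Lemma is_normN x : N (- x) = N x.
Proof. by rewrite -scaleN1r is_normZ normrN1 mul1r. Qed.

Lemma is_norm_ge0 x : 0 <= N x.
Proof.
have := is_normD x (- x); rewrite subrr is_norm0 is_normN.
by rewrite -mulr2n pmulrn_lge0.
Qed.

Lemma is_norm_gt0 x : x != 0 -> 0 < N x.
Proof.
move=> x0; rewrite lt_def is_norm_ge0 andbT; apply: contra_neq x0.
by case: hN => _ _; apply.
Qed.

Lemma is_norm_dist x y : `|N x - N y| <= N (x - y).
Proof.
have H a b : N a <= N (a - b) + N b by rewrite -{1}(subrK b a) is_normD.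
have := H y x; have := H x y; rewrite -(is_normN (y - x)) opprB ler_norml.
by move=> ? ?; apply/andP; split; lra.
Qed.

Lemma is_norm_sum (I : Type) (s : seq I) (F : I -> 'cV[R]_d) :
  N (\sum_(i <- s) F i) <= \sum_(i <- s) N (F i).
Proof.
elim: s => [|a s IH]; first by rewrite !big_nil is_norm0.
by rewrite !big_cons (le_trans (is_normD _ _))// lerD2l.
Qed.

Lemma cV_sum_delta x : x = \sum_i x i 0 *: delta_mx i 0.
Proof.
apply/matrixP => i j; rewrite (ord1 j) summxE (bigD1 i)//= !mxE !eqxx mulr1.
by rewrite big1 ?addr0// => k ki; rewrite !mxE eq_sym (negbTE ki) mulr0.
Qed.

Lemma is_norm_le_norm2 : exists2 C : R, 0 <= C & forall x, N x <= C * norm2 x.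
Proof.
exists (\sum_i N (delta_mx i 0)) => [|x].
  by apply: sumr_ge0 => i _; exact: is_norm_ge0.
rewrite {1}(cV_sum_delta x); apply: le_trans (is_norm_sum _ _) _.
rewrite mulr_suml; apply: ler_sum => i _; rewrite is_normZ mulrC.
by rewrite ler_wpM2l ?is_norm_ge0 ?coord_le_norm2.
Qed.

(** By compactness [N] attains its minimum on the Euclidean unit sphere, and definiteness makes it
    positive; homogeneity does the rest. *)
Lemma norm2_le_is_norm : exists2 C : R, 0 < C & forall x, norm2 x <= C * N x.
Proof.
have [K K0 HK] := is_norm_le_norm2.
pose A : set 'cV[R]_d := [set x | norm2 x = 1].
have [A0|/set0P A0] := eqVneq A set0.
  (* An empty sphere leaves only the zero vector. *)
  exists 1 => // x; have [->|x0] := eqVneq x 0; first by rewrite norm20 is_norm0 mulr0.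
  have : A ((norm2 x)^-1 *: x).
    rewrite /A /= norm2Z ger0_norm ?invr_ge0 ?norm2_ge0// mulVf ?gt_eqF//.
    exact: norm2_gt0.
  by rewrite A0.
have [|||x Ax Hx] := @min_on_norm2 R d N A 1 _ A0.
- apply: (@trmx_norm2_continuous _ _ _ K) => x y.
  exact: le_trans (is_norm_dist x y) (HK _).
- exact: closed_norm2_eq.
- by move=> x ->.
have x0 : x != 0.
  by apply/eqP => xE; move: Ax; rewrite xE /A /= norm20 => /esym/eqP; rewrite oner_eq0.
have Nx := is_norm_gt0 x0.
exists (N x)^-1; first by rewrite invr_gt0.
move=> y; have [->|y0] := eqVneq y 0; first by rewrite norm20 is_norm0 mulr0.
have yp := norm2_gt0 y0.
rewrite ler_pdivlMl// mulrC -ler_pdivlMl// .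
rewrite -[X in X * N y]ger0_norm ?invr_ge0 ?norm2_ge0// -is_normZ; apply: Hx.
by rewrite /A /= norm2Z ger0_norm ?invr_ge0 ?norm2_ge0// mulVf ?gt_eqF.
Qed.

Lemma dual_has_sup u : has_sup [set dotv u x | x in unit_ball N].
Proof.
split; first by exists 0, 0; rewrite /unit_ball/= ?is_norm0 ?dotv0r.
have [C C0 HC] := norm2_le_is_norm.
exists (norm2 u * C) => _ [x /= Nx <-].
apply: le_trans (dotv_CS _ _) _; rewrite ler_wpM2l ?norm2_ge0//.
by apply: le_trans (HC x) _; rewrite ler_piMr// ltW.
Qed.

Lemma dual_norm_ge0 u : 0 <= dual_norm N u.
Proof.
apply: sup_upper_bound; first exact: dual_has_sup.
by exists 0; rewrite /unit_ball/= ?is_norm0 ?dotv0r.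
Qed.

Lemma dotv_le_dual u x : dotv u x <= dual_norm N u * N x.
Proof.
have [->|x0] := eqVneq x 0; first by rewrite dotv0r is_norm0 mulr0.
have xp := is_norm_gt0 x0; rewrite -ler_pdivrMr//.
apply: sup_upper_bound; first exact: dual_has_sup.
exists ((N x)^-1 *: x); last by rewrite dotvZr mulrC.
by rewrite /unit_ball/= is_normZ ger0_norm ?invr_ge0 ?is_norm_ge0// mulVf ?gt_eqF.
Qed.

Lemma normr_dotv_le_dual u x : `|dotv u x| <= dual_norm N u * N x.
Proof.
rewrite ler_norml dotv_le_dual andbT lerNl -dotvNr.
by rewrite -[N x]is_normN dotv_le_dual.
Qed.

Lemma dual_norm_le u (c : R) : 0 <= c -> (forall x, dotv u x <= c * N x) ->
  dual_norm N u <= c.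
Proof.
move=> c0 H; apply: ge_sup; first by case: (dual_has_sup u).
move=> _ [x /= x1 <-]; apply: le_trans (H x) _.
by rewrite ler_piMr.
Qed.

Lemma dual_normZ (a : R) u : 0 <= a -> dual_norm N (a *: u) = a * dual_norm N u.
Proof.
rewrite le_eqVlt => /predU1P[<-|a0].
  rewrite scale0r mul0r; apply/eqP; rewrite eq_le dual_norm_ge0 andbT.
  by apply: dual_norm_le => // x; rewrite dotv0l mul0r.
apply/eqP; rewrite eq_le; apply/andP; split.
  apply: dual_norm_le => [|x]; first by rewrite mulr_ge0 ?dual_norm_ge0// ltW.
  by rewrite dotvZl -mulrA ler_pM2l// dotv_le_dual.
rewrite -ler_pdivlMl//; apply: dual_norm_le => [|x].
  by rewrite mulr_ge0 ?dual_norm_ge0// invr_ge0 ltW.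
by rewrite -mulrA ler_pdivlMl// -dotvZl dotv_le_dual.
Qed.

Lemma dual_normD u v : dual_norm N (u + v) <= dual_norm N u + dual_norm N v.
Proof.
apply: dual_norm_le => [|x]; first by rewrite addr_ge0 ?dual_norm_ge0.
by rewrite dotvDl mulrDl lerD ?dotv_le_dual.
Qed.

(** One-sided, in the form of the hypothesis [delta_lip] of the Poincare inequality, where the dual
    norm plays the role of [delta]. *)
Lemma dual_norm_lipschitz : exists2 C : R, 0 < C &
  forall u v, dual_norm N u <= dual_norm N v + C * norm2 (u - v).
Proof.
have [C C0 HC] := norm2_le_is_norm; exists C => // u v.
rewrite -{1}(subrK v u) addrC; apply: le_trans (dual_normD _ _) _.
rewrite lerD2l; apply: dual_norm_le => [|x].
  by rewrite mulr_ge0 ?norm2_ge0// ltW.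
apply: le_trans (dotv_CS _ _) _.
by rewrite [C * _]mulrC -mulrA ler_wpM2l ?norm2_ge0.
Qed.

(** Pair [u] with itself: |u|^2 is at most its dual norm times N u, and N u <= C |u|. *)
Lemma norm2_le_dual : exists2 C : R, 0 <= C & forall u, norm2 u <= C * dual_norm N u.
Proof.
have [C C0 HC] := is_norm_le_norm2; exists C => // u.
have [->|u0] := eqVneq u 0; first by rewrite norm20 mulr_ge0 ?dual_norm_ge0.
have up := norm2_gt0 u0; rewrite -(ler_pM2r up) -expr2 norm2_sqr.
apply: le_trans (dotv_le_dual u u) _; rewrite [leRHS]mulrAC [leRHS]mulrC.
by rewrite ler_wpM2l ?dual_norm_ge0.
Qed.

Lemma dual_norm_eq0 u : dual_norm N u = 0 -> u = 0.
Proof.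
have [C _ HC] := norm2_le_dual => u0; apply: norm2_eq0; apply/eqP.
by rewrite eq_le norm2_ge0 andbT (le_trans (HC u))// u0 mulr0.
Qed.

Lemma square_norm_has_sup (M : 'M[R]_d) :
  has_sup [set qform M u | u in unit_ball (dual_norm N)].
Proof.
split.
  exists 0, 0; rewrite ?qform0// /unit_ball/=.
  by rewrite -(scale0r 0) dual_normZ// mul0r.
have [C C0 HC] := norm2_le_dual.
exists (opnorm M * C ^+ 2) => _ [u /= u1 <-].
apply: le_trans (qform_le _ _) _; rewrite ler_wpM2l ?opnorm_ge0//.
rewrite -norm2_sqr ler_sqr ?nnegrE ?norm2_ge0//.
by apply: le_trans (HC u) _; rewrite ler_piMr.
Qed.

Lemma square_norm_ge0 (M : 'M[R]_d) : 0 <= square_norm N M.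
Proof.
apply: sup_upper_bound; first exact: square_norm_has_sup.
exists 0; rewrite ?qform0// /unit_ball/=.
by rewrite -(scale0r 0) dual_normZ// mul0r.
Qed.

Lemma qform_le_square_norm (M : 'M[R]_d) u :
  qform M u <= square_norm N M * dual_norm N u ^+ 2.
Proof.
have [->|u0] := eqVneq u 0.
  by rewrite qform0 mulr_ge0 ?square_norm_ge0 ?sqr_ge0.
have up : 0 < dual_norm N u.
  rewrite lt_def dual_norm_ge0 andbT; apply: contra_neq u0; exact: dual_norm_eq0.
rewrite -ler_pdivrMr ?exprn_gt0//; apply: sup_upper_bound;
  first exact: square_norm_has_sup.
exists ((dual_norm N u)^-1 *: u).
  by rewrite /unit_ball/= dual_normZ ?invr_ge0 ?dual_norm_ge0// mulVf ?gt_eqF.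
by rewrite qformZ exprVn mulrC.
Qed.

Lemma norm2_le_rad x : N x <= 1 -> norm2 x <= rad (unit_ball N).
Proof.
move=> Nx; apply: sup_upper_bound; last by exists x.
split; first by exists (norm2 x), x.
have [C C0 HC] := norm2_le_is_norm; exists C => _ [y /= Ny <-].
by apply: le_trans (HC y) _; rewrite ler_piMr// ltW.
Qed.

(** Stretching [x] by any factor above 1 leaves the ball. Through this inclusion [lambda_inf] bounds
    the expectation at every normalised vector. *)
Lemma boundary_unit_ball x : N x = 1 -> boundary (unit_ball N) x.
Proof.
move=> Nx; split; first by apply: subset_closure; rewrite /unit_ball/= Nx.
rewrite /interior /= => /nbhs_ballP[e /= e0 He].
have xN0 : 0 < `|x|.
  rewrite normr_gt0; apply/eqP => x0; move: Nx; rewrite x0 is_norm0 => /esym/eqP.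
  by rewrite oner_eq0.
pose a := e / 2 / `|x|.
have a0 : 0 < a by rewrite !divr_gt0.
have /He : ball x e ((1 + a) *: x).
  rewrite -ball_normE /= scalerDl scale1r opprD addNKr normrN normrZ gtr0_norm//.
  by rewrite /a divfK ?gt_eqF// ltr_pdivrMr// ltr_pMr// ltr1n.
rewrite /unit_ball /= is_normZ Nx mulr1 gtr0_norm ?addr_gt0//.
by rewrite gerDl leNgt a0.
Qed.

End NormTheory.

(** * Matrix square root *)

Section SquareRoot.
Context {R : realType}.

(** Newton's scheme: the correction for a new node is a multiple of the polynomial [w] that vanishes
    at the old ones. *)
Lemma poly_interpolation (s : seq R) (f : R -> R) : uniq s ->
  exists p : {poly R}, forall a, a \in s -> p.[a] = f a.
Proof.
elim: s => [|b s IH]; first by exists 0.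
move=> /= /andP[bs /IH[p Hp]].
pose w := \prod_(c <- s) ('X - c%:P).
have wb : w.[b] != 0.
  by rewrite -/(root w b) root_prod_XsubC.
exists (p + ((f b - p.[b]) / w.[b])%:P * w) => a; rewrite inE => /predU1P[->|aS].
  by rewrite hornerD hornerM hornerC divfK// addrC subrK.
rewrite hornerD hornerM hornerC Hp//.
have /rootP -> : root w a by rewrite root_prod_XsubC.
by rewrite mulr0 addr0.
Qed.

(** Write the eigenvector as a + i b and z = al + i be. Expanding <a, A b> = <b, A a> leaves be
    (|a|^2 + |b|^2) = 0, so be = 0 and whichever of a, b is nonzero is a real eigenvector. *)
Lemma sym_eigen_real n (A : 'M[R]_n) (z : R[i]) : A^T = A ->
  eigenvalue (map_mx (real_complex R) A) z ->
  exists2 a : R, z = a%:C%C & exists2 u : 'cV[R]_n, u != 0 & A *m u = a *: u.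
Proof.
move=> sA /eigenvalueP[v vA v0].
case: z vA => al be vA.
pose a : 'cV[R]_n := \col_i complex.Re (v 0 i).
pose b : 'cV[R]_n := \col_i complex.Im (v 0 i).
have vE i : v 0 i = (a i 0 +i* b i 0)%C.
  by rewrite !mxE; case: (v 0 i).
have key : A *m a = al *: a - be *: b /\ A *m b = al *: b + be *: a.
  suff H j : (A *m a) j 0 = al * a j 0 - be * b j 0 /\
             (A *m b) j 0 = al * b j 0 + be * a j 0.
    by split; apply/matrixP => j k; rewrite (ord1 k); have [H1 H2] := H j;
       rewrite ?H1 ?H2 ![in RHS]mxE; rewrite ?[a j 0]mxE ?[b j 0]mxE.
  have : \sum_k v 0 k * map_mx (real_complex R) A k j = (al +i* be)%C * v 0 j.
    by have := congr1 (fun M : 'rV_n => M 0 j) vA; rewrite !mxE.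
  have -> : \sum_k v 0 k * map_mx (real_complex R) A k j =
     ((A *m a) j 0 +i* (A *m b) j 0)%C.
    rewrite !mxE.
    have sC : forall (I : Type) (r : seq I) (F G : I -> R),
       \sum_(i <- r) (F i +i* G i)%C =
       ((\sum_(i <- r) F i) +i* (\sum_(i <- r) G i))%C :> R[i].
      move=> I r F G; elim: r => [|x r IH]; first by rewrite !big_nil.
      by rewrite !big_cons IH.
    rewrite -sC; apply: eq_bigr => k _.
    rewrite vE !mxE -[in A j k]sA mxE.
    apply/eqP; rewrite eq_complex /=; apply/andP.
    by split; apply/eqP; rewrite ?mulr0 ?subr0 ?addr0 ?add0r mulrC.
  rewrite vE => /eqP; rewrite eq_complex /= => /andP[/eqP -> /eqP ->].
  by split=> //; rewrite addrC.
have [Ha Hb] := key.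
have be0 : be * (dotv a a + dotv b b) = 0.
  have := sym_dotvC a b sA; rewrite Ha Hb !(dotvDr, dotvNr, dotvZr) (dotvC b a).
  by by move=> E; lra.
have ab0 : dotv a a + dotv b b != 0.
  apply/eqP => /eqP; rewrite paddr_eq0 ?dotvv_ge0// => /andP[/eqP/dotvv_eq0 a0
    /eqP/dotvv_eq0 b0].
  move/negP: v0; apply; apply/eqP/matrixP => i j; rewrite (ord1 i) vE a0 b0.
  by rewrite !mxE.
move/eqP: be0; rewrite mulf_eq0 (negbTE ab0) orbF => /eqP be0.
exists al; first by rewrite be0.
move: Ha Hb; rewrite be0 !scale0r subr0 addr0 => Ha Hb.
have [a0|a0] := eqVneq a 0; last by exists a.
exists b => //; apply/eqP => b0; move: ab0.
by rewrite a0 b0 dotv0l addr0 eqxx.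
Qed.

(** The polynomial splits over the complex numbers; its roots are eigenvalues, hence real, and
    nonnegative because <u, A u> = a |u|^2 at a real eigenvector. *)
Lemma psd_char_poly_split n (A : 'M[R]_n) : psdmx A ->
  exists2 s : seq R, char_poly A = \prod_(a <- s) ('X - a%:P)
    & forall a, a \in s -> 0 <= a.
Proof.
move=> [sA pA]; pose B := map_mx (real_complex R) A.
have [r rE] := closed_field_poly_normal (char_poly B).
rewrite (monicP (char_poly_monic B)) scale1r in rE.
have rr z : z \in r -> exists2 a : R, z = a%:C%C & 0 <= a.
  move=> zr; have : eigenvalue B z.
    by rewrite eigenvalue_root_char rE root_prod_XsubC.
  move=> /(sym_eigen_real sA)[a -> [u u0 Au]]; exists a => //.
  have := pA u; rewrite qformE Au dotvZr pmulr_lge0// lt_def dotvv_ge0 andbT.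
  by apply: contra_neq u0; exact: dotvv_eq0.
exists [seq complex.Re z | z <- r]; last first.
  by move=> a /mapP[z /rr[b -> b0] ->].
apply: (@map_poly_inj _ _ (real_complex R)).
rewrite map_char_poly -/B rE rmorph_prod big_map; apply: eq_big_seq => z /rr[a -> _].
by rewrite /= rmorphB /= map_polyX map_polyC.
Qed.

(** The exponent is a power of 2 so that the induction can pass to N^2, which is again symmetric;
    and N^2 = 0 forces N = 0 since |N e_j|^2 = <e_j, N^2 e_j>. *)
Lemma sym_nilp0 n (N : 'M[R]_n.+1) k : N^T = N -> N ^+ (2 ^ k) = 0 -> N = 0.
Proof.
elim: k N => [|k IH] N sN; first by rewrite expn0 expr1.
rewrite expnS exprM => /IH; rewrite expr2 trmx_mul sN => /(_ erefl) NN.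
apply/matrixP => i j.
have : dotv (N *m delta_mx j 0) (N *m delta_mx j 0) = 0.
  by rewrite dotv_mull sN mulmxA -[N *m N]/(N * N) NN mul0mx dotv0r.
move=> /dotvv_eq0/matrixP/(_ i 0); rewrite -colE !mxE; exact.
Qed.

Lemma trmx_horner_sym n (A : 'M[R]_n.+1) p : A^T = A ->
  (horner_mx A p)^T = horner_mx A p.
Proof.
move=> sA; elim/poly_ind: p => [|p c IH]; first by rewrite rmorph0 trmx0.
rewrite rmorphD rmorphM /= horner_mx_X horner_mx_C linearD /= tr_scalar_mx.
congr (_ + _); rewrite -[_ * A]/(_ *m A) trmx_mul sA IH.
transitivity (horner_mx A ('X * p)); first by rewrite rmorphM /= horner_mx_X.
by rewrite mulrC rmorphM /= horner_mx_X.
Qed.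

(** Functional calculus without diagonalisation. Let [p] interpolate the fourth root on the
    eigenvalues. Then q = p^4 - X vanishes at all of them, so q(A) is nilpotent by Cayley-Hamilton,
    and zero because it is symmetric. With T = p(A) this reads T^4 = A. Fourth roots are used so
    that the square root T T is the square of a symmetric matrix, hence positive semidefinite. *)
Lemma psd_sqrt_exists n (A : 'M[R]_n) : (0 < n)%N -> psdmx A ->
  exists S : 'M[R]_n, psdmx S /\ S *m S = A.
Proof.
case: n A => [//|n] A _ pA; have [sA _] := pA.
have [s sE s0] := psd_char_poly_split pA.
have [p Hp] := @poly_interpolation (undup s)
  (fun a => Num.sqrt (Num.sqrt a)) (undup_uniq s).
pose q := p ^+ 4 - 'X.
have q0 a : a \in s -> root q a.
  move=> aS; rewrite /root hornerD hornerN hornerX horner_exp Hp ?mem_undup//.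
  by rewrite (exprM _ 2 2) !sqr_sqrtr ?sqrtr_ge0 ?subrr// s0.
(* One factor [q] for each linear factor; the exponent is then enlarged to the power of 2 that
   [sym_nilp0] expects. *)
have cq : char_poly A %| q ^+ (2 ^ size s)%N.
  apply: (@dvdp_trans _ (q ^+ size s)); last first.
    by rewrite dvdp_exp2l// ltnW// ltn_expl.
  rewrite sE; elim: {sE s0 Hp} s q0 => [|a s IH] q0.
    by rewrite big_nil expr0.
  rewrite big_cons exprS dvdp_mul//.
    by rewrite dvdp_XsubCl q0// mem_head.
  by apply: IH => b bs; rewrite q0// inE bs orbT.
have Nq : horner_mx A q = 0.
  apply: (@sym_nilp0 _ _ (size s)); first exact: trmx_horner_sym.
  rewrite -rmorphXn /=; case/dvdpP: cq => w ->.
  by rewrite rmorphM /= Cayley_Hamilton mulr0.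
pose T := horner_mx A p.
have sT : T^T = T by exact: trmx_horner_sym.
exists (T *m T); split.
  split=> [|u]; first by rewrite trmx_mul sT.
  by rewrite qformE -mulmxA -{1}sT -dotv_mull dotvv_ge0.
rewrite -mulmxA; change (T * (T * (T * T)) = A).
apply/eqP; rewrite -subr_eq0 -{1}[A]horner_mx_X /T -!rmorphM -rmorphB /=.
have -> : p * (p * (p * p)) - 'X = q by rewrite /q !exprS expr0 mulr1.
by rewrite Nq.

Qed.

Lemma sqrtmx_spec n (A : 'M[R]_n) : (0 < n)%N -> psdmx A ->
  psdmx (sqrtmx A) /\ sqrtmx A *m sqrtmx A = A.
Proof.
move=> n0 pA; have [S HS] := psd_sqrt_exists n0 pA.
exact: (@xgetPex _ 0 [set S | psdmx S /\ S *m S = A] (ex_intro _ S HS)).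
Qed.

Lemma sqrtmx_pd n (A : 'M[R]_n) : (0 < n)%N -> pdmx A ->
  [/\ psdmx (sqrtmx A), sqrtmx A *m sqrtmx A = A & sqrtmx A \in unitmx].
Proof.
move=> n0 pA; have [pS SS] := sqrtmx_spec n0 (psd_of_pd pA).
split=> //; have := pd_unitmx pA.
by rewrite -{1}SS unitmx_mul => /andP[].
Qed.

End SquareRoot.

(** * The Moreau envelope *)

Section PositiveDefiniteNorm.
Context {R : realType} {d : nat}.
Implicit Types (u v : 'cV[R]_d) (A : 'M[R]_d).

Lemma psd_unit_pd A : psdmx A -> A \in unitmx -> pdmx A.
Proof.
move=> pA uA; have [sA pA'] := pA; split=> // u u0; rewrite lt_def pA' andbT.
apply: contra_neq u0 => q0; have := psd_mulmx_sqr_le u pA.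
rewrite q0 mulr0 => H; have : A *m u = 0.
  by apply: dotvv_eq0; apply/eqP; rewrite eq_le H dotvv_ge0.
by move=> /(congr1 (mulmx (invmx A))); rewrite mulKmx// mulmx0.
Qed.

Lemma pd_invmx A : pdmx A -> pdmx (invmx A).
Proof.
move=> pA; have uA := pd_unitmx pA; have [sA pA'] := pA.
have sI : (invmx A)^T = invmx A by rewrite trmx_inv sA.
split=> // u u0; rewrite -[u](mulKVmx uA) qformE mulKmx// dotv_mull sA -qformE.
apply: pA'; apply: contra_neq u0 => /(congr1 (mulmx A)).
by rewrite mulKVmx// mulmx0.
Qed.

Lemma pd_normM_is_norm A : pdmx A -> is_norm (normM A).
Proof.
move=> pA; have psA := psd_of_pd pA; split.
- by move=> x y; exact: normM_triangle.
- by move=> a x; exact: normMZ.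
- move=> x /(congr1 (fun z => z ^+ 2)); rewrite normM_sqr// expr0n /= => q0.
  apply/eqP; apply: contraT => x0; case: pA => _ /(_ x x0).
  by rewrite q0 ltxx.
Qed.

End PositiveDefiniteNorm.

(** Replaces a limit s -> 0 when a first-order condition is extracted from minimality along a
    segment. *)
Lemma le_of_small_perturbation {R : realType} (a b c : R) :
  (forall s, 0 < s -> s <= 1 -> a <= s * b + c) -> a <= c.
Proof.
move=> H; rewrite -subr_le0 leNgt; apply/negP => ac.
pose s := Num.min 1 ((a - c) / (2 * (`|b| + 1))).
have b0 : 0 < `|b| + 1 by rewrite ltr_wpDl.
have s0 : 0 < s by rewrite lt_min ltr01 divr_gt0// mulr_gt0.
have s1 : s <= 1 by rewrite ge_min lexx.
have := H s s0 s1.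
have : s * b <= (a - c) / 2.
  apply: (@le_trans _ _ (s * (`|b| + 1))).
    by rewrite ler_wpM2l ?ltW// (le_lt_trans (ler_norm _))// ltrDl.
  rewrite -ler_pdivlMr// -mulrA -invfM.
  by rewrite ge_min lexx orbT.
lra.
Qed.

Section Envelope.
Context {R : realType} {d : nat} (hd : (0 < d)%N).
Context (N : 'cV[R]_d -> R) (hN : is_norm N) (Sigma : 'M[R]_d)
  (hSigma : pdmx Sigma) (kappa rho : R) (hk : 0 < kappa) (hr : 0 <= rho).
Implicit Types u v x y g : 'cV[R]_d.

Let S := sqrtmx Sigma.
Let M := invmx S.
Local Notation f := (f0 N Sigma kappa rho).

Let S_pd : pdmx S.
Proof.
by have [pS _ uS] := sqrtmx_pd hd hSigma; exact: psd_unit_pd.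
Qed.

Let M_pd : pdmx M. Proof. exact: pd_invmx. Qed.
Let M_psd : psdmx M. Proof. exact: psd_of_pd. Qed.

Definition env_obj x y : R := kappa / 2 * qform M (x - y) + rho * N y.

Definition is_prox x y := forall z, env_obj x y <= env_obj x z.

(** The objective is coercive: a point [z] outside the ball of radius [r] has kappa / 2 times its
    quadratic term above the value [q0] at 0. A minimiser over that compact ball is therefore
    global. *)
Lemma prox_exists x : exists y, is_prox x y.
Proof.
have [C C0 HC] := norm2_le_is_norm (pd_normM_is_norm M_pd).
have [K K0 HK] := is_norm_le_norm2 (pd_normM_is_norm M_pd).
have [K' K'0 HK'] := is_norm_le_norm2 hN.
pose q0 := env_obj x 0.
have k2 : 0 < kappa / 2 by rewrite divr_gt0.
pose r := norm2 x + C * Num.sqrt (q0 / (kappa / 2)).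
pose A : set 'cV[R]_d := [set y | norm2 y <= r].
have q00 : 0 <= q0.
  apply: addr_ge0; apply: mulr_ge0 => //; last exact: is_norm_ge0.
    exact: ltW.
  exact: (M_psd).2.
have A0 : A 0.
  by rewrite /A /= norm20 addr_ge0 ?norm2_ge0// mulr_ge0 ?sqrtr_ge0// ltW.
have [||||y Ay Hy] := @min_on_norm2 R d (env_obj x) A r.
- have c1 : continuous (fun v : 'rV[R]_d => normM M (x - v^T)).
    apply: (@trmx_norm2_continuous _ _ (fun v => normM M (x - v)) K) => v w.
    apply: le_trans (is_norm_dist (pd_normM_is_norm M_pd) _ _) _.
    apply: le_trans (HK _) _.
    by rewrite opprB addrC addrA subrK -[norm2 (v - w)]norm2N opprB.
  have c2 : continuous (fun v : 'rV[R]_d => N v^T).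
    apply: (@trmx_norm2_continuous _ _ N K') => v w.
    exact: le_trans (is_norm_dist hN _ _) (HK' _).
  rewrite /env_obj.
  have -> : (fun v : 'rV[R]_d => kappa / 2 * qform M (x - v^T) + rho * N v^T) =
            (fun v : 'rV[R]_d => kappa / 2 * (normM M (x - v^T) * normM M (x - v^T))
               + rho * N v^T).
    by apply/funext => v; rewrite -expr2 normM_sqr.
  move=> v.
  exact: (cvgD (cvgM (cvg_cst _) (cvgM (c1 v) (c1 v))) (cvgM (cvg_cst _) (c2 v))).
- by exists 0.
- exact: closed_norm2_le.
- by [].
exists y => z; have [zA|zA] := leP (norm2 z) r; first exact: Hy.
apply: le_trans (Hy 0 A0) _; rewrite -/q0 leNgt; apply/negP => zq.
suff : norm2 z <= r by rewrite leNgt zA.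
rewrite -(subrK x z) addrC; apply: le_trans (norm2D _ _) _.
rewrite lerD2l -norm2N opprB; apply: le_trans (HC _) _.
rewrite ler_pM2l// ler_sqrt; last by rewrite divr_ge0 // ltW.
rewrite ler_pdivlMr// mulrC (le_trans _ (ltW zq))// lerDl.
by rewrite mulr_ge0 ?is_norm_ge0.
Qed.

Definition prox x : 'cV[R]_d := projT1 (cid (prox_exists x)).

Lemma proxP x : is_prox x (prox x).
Proof. by rewrite /prox; case: cid. Qed.

Lemma is_prox_f0 x y : is_prox x y -> f x = env_obj x y.
Proof.
move=> Hy; apply/eqP; rewrite eq_le; apply/andP; split.
  apply: ge_inf; last by exists y; rewrite //= normM_sqr.
  by exists (env_obj x y) => _ [z _ <-]; rewrite normM_sqr//; exact: Hy.
apply: lb_le_inf; first by exists (kappa / 2 * normM M (x - y) ^+ 2 + rho * N y), y.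
by move=> _ [z _ <-]; rewrite normM_sqr//; exact: Hy.
Qed.

Lemma f0_le x y : f x <= env_obj x y.
Proof. by rewrite (is_prox_f0 (@proxP x)); exact: proxP. Qed.

(** The derivative of [env_obj] in its first argument with the minimiser held fixed, as in the
    envelope theorem; [grad_f0] identifies it with the gradient. *)
Definition env_grad x : 'cV[R]_d := kappa *: (M *m (x - prox x)).

(** The minimiser at [x] competes at [x + v]. *)
Lemma f0_upper x v : f (x + v) <= f x + dotv (env_grad x) v + kappa / 2 * qform M v.
Proof.
apply: le_trans (f0_le _ (prox x)) _.
rewrite (is_prox_f0 (@proxP x)) /env_obj addrAC [x - _ + v]addrC -addrA.
rewrite (_ : v + (x - prox x) = (x - prox x) + v) 1?addrC//.
rewrite qformD; last by case: M_psd.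
rewrite /env_grad dotvZl dotv_mull (M_psd).1; lra.
Qed.

(** The mean of the minimisers at x + v and x - v competes at [x]. This midpoint convexity turns the
    upper bound at - v into a lower bound at v, and the two bounds squeeze the difference quotients
    in [grad_f0]. *)
Lemma f0_midpoint x v : 2 * f x <= f (x + v) + f (x - v).
Proof.
pose y1 := prox (x + v); pose y2 := prox (x - v).
rewrite (is_prox_f0 (@proxP (x + v))) (is_prox_f0 (@proxP (x - v))) -/y1 -/y2.
have := f0_le x (2^-1 *: (y1 + y2)).
rewrite /env_obj is_normZ// ger0_norm ?invr_ge0//.
have -> : x - 2^-1 *: (y1 + y2) = 2^-1 *: ((x + v - y1) + (x - v - y2)).
  rewrite (_ : _ + (x - v - y2) = 2 *: x - (y1 + y2)).
    by rewrite scalerBr scalerA mulVf// scale1r.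
  by apply/matrixP => i j; rewrite !mxE; ring.
rewrite qformZ.
have := is_normD hN y1 y2.
move: (x + v - y1) (x - v - y2) => a1 a2.
have sM := (M_psd).1; have := (M_psd).2 (a1 - a2).
rewrite !qformD// qformN mulmxN dotvNr.
set a := qform M a1; set b := qform M a2; set c := dotv _ _.
move=> H1 H2 H3.
have H4 : rho * N (y1 + y2) <= rho * (N y1 + N y2) by rewrite ler_wpM2l.
have H5 : kappa * (a + 2 * c + b) <= kappa * (2 * a + 2 * b).
  by rewrite ler_pM2l//; lra.
lra.
Qed.

Lemma f0_lower x v : f x + dotv (env_grad x) v - kappa / 2 * qform M v <= f (x + v).
Proof.
have := f0_midpoint x v; have := f0_upper x (- v).
rewrite dotvNr qformN; lra.
Qed.

Lemma grad_f0 x : grad f x = env_grad x.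
Proof.
apply/matrixP => i j; rewrite (ord1 j) mxE.
set e := delta_mx i 0.
have -> : env_grad x i 0 = dotv (env_grad x) e.
  rewrite dotvE (bigD1 i)//= [e i 0]mxE !eqxx mulr1 big1 ?addr0// => k ki.
  by rewrite [e k 0]mxE (negbTE ki) mulr0.
apply: cvg_lim => //; apply/cvgrPdist_le => eps eps0.
pose K := kappa / 2 * qform M e.
have K0 : 0 <= K.
  by rewrite /K mulr_ge0 ?divr_ge0 ?(ltW hk)//; exact: (M_psd).2.
have K1 : 0 < K + 1 by rewrite ltr_wpDl.
near=> h.
have h0 : h != 0 by near: h; exact: nbhs_dnbhs_neq.
have hE : `|h| <= eps / (K + 1).
  near: h; apply: dnbhs0_le; exact: divr_gt0.
rewrite /= [_ + x]addrC /GRing.scale /=.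
have -> : dotv (env_grad x) e - h^-1 * (f (x + h *: e) - f x) =
          h^-1 * (h * dotv (env_grad x) e - (f (x + h *: e) - f x)).
  by rewrite [RHS]mulrBr mulKf.
rewrite normrM normfV ler_pdivrMl ?normr_gt0//.
have := f0_upper x (h *: e); have := f0_lower x (h *: e).
rewrite dotvZr qformZ => H1 H2.
apply: (@le_trans _ _ (h ^+ 2 * K)).
  by rewrite ler_norml /K; apply/andP; split; lra.
rewrite -real_normK ?num_real// expr2 -mulrA ler_wpM2l//.
apply: (@le_trans _ _ (`|h| * (K + 1))); first by rewrite ler_wpM2l// lerDl.
by rewrite -ler_pdivlMr.
Unshelve. all: by end_near. Qed.

(** [env_grad x] is a subgradient of rho N at [prox x]: move from the minimiser a fraction [s] of
    the way to [z], divide by [s] and let it tend to 0. *)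
Lemma env_grad_subgrad x z :
  dotv (env_grad x) (z - prox x) <= rho * (N z - N (prox x)).
Proof.
set y := prox x; set w := z - y.
apply: (@le_of_small_perturbation _ _ (kappa / 2 * qform M w)) => s s0 s1.
have := @proxP x (y + s *: w); rewrite /env_obj -/y opprD addrA.
rewrite (qformD _ (- (s *: w)) (M_psd).1) qformN qformZ mulmxN dotvNr
  -scalemxAr dotvZr => H.
have H1 : N (y + s *: w) <= (1 - s) * N y + s * N z.
  have -> : y + s *: w = (1 - s) *: y + s *: z.
    by rewrite /w; apply/matrixP => i j; rewrite !mxE; ring.
  apply: le_trans (is_normD hN _ _) _; rewrite !is_normZ//.
  by rewrite (ger0_norm (ltW s0)) ger0_norm// subr_ge0.
have H2 : rho * N (y + s *: w) <= rho * ((1 - s) * N y + s * N z).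
  by rewrite ler_wpM2l.
rewrite /env_grad -/y dotvZl dotv_mull (M_psd).1.
rewrite -(ler_pM2l s0); lra.
Qed.

Lemma dual_grad_le x : dual_norm N (grad f x) <= rho.
Proof.
rewrite grad_f0; apply: dual_norm_le => // v.
have := env_grad_subgrad x (prox x + v); rewrite addrAC subrr add0r => H.
apply: le_trans H _; rewrite ler_wpM2l// lerBlDl; exact: is_normD.
Qed.

Definition gradS g := grad f (S *m g).

(** Duality gives kappa <g, z> <= rho N z, so 0 minimises. [prox] being a chosen minimiser, it must
    still be shown to be 0: equality of the two objective values and the subgradient inequality
    towards 0 leave a nonpositive quadratic form. *)
Lemma gradS_small g : dual_norm N (kappa *: g) <= rho -> gradS g = kappa *: g.
Proof.
move=> Hg; have [_ _ uS] := sqrtmx_pd hd hSigma.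
have MSg : M *m (S *m g) = g by rewrite mulKmx.
have MSd v : dotv (S *m g) (M *m v) = dotv g v.
  by have := dotv_mull M (S *m g) v; rewrite (M_psd).1 MSg.
have H0 : is_prox (S *m g) 0.
  move=> z; rewrite /env_obj subr0 is_norm0// mulr0 addr0.
  rewrite qformD; last by case: M_psd.
  rewrite qformN mulmxN dotvNr MSd.
  have := dotv_le_dual hN (kappa *: g) z; rewrite dotvZl => H.
  have := ler_wpM2r (is_norm_ge0 hN z) Hg.
  have := mulr_ge0 (ltW hk) ((M_psd).2 z).
  lra.
have p0 : prox (S *m g) = 0.
  have := env_grad_subgrad (S *m g) 0; rewrite sub0r is_norm0// sub0r.
  have := @proxP (S *m g) 0; have := H0 (prox (S *m g)).
  set y := prox _; rewrite /env_obj subr0 is_norm0// mulr0 addr0 /env_grad -/y.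
  rewrite mulmxBr MSg dotvZl dotvBl !dotvNr qformD ?qformN ?mulmxN; last by case: M_psd.
  rewrite !dotvNr MSd [dotv (M *m y) y]dotvC -qformE => H1 H2 H3.
  have q0 : qform M y = 0.
    apply/eqP; rewrite eq_le (M_psd).2 andbT -(pmulr_rle0 _ hk).
    lra.
  apply/eqP; apply: contraT => y0; case: M_pd => _ /(_ y y0).
  by rewrite q0 ltxx.
by rewrite /gradS grad_f0 /env_grad p0 subr0 MSg.
Qed.

(** With a = S (g - g') and b the difference of the minimisers, the claim reduces to comparing the
    form of [M] at a - b and at a. Monotonicity of subgradients says <M (a - b), b> >= 0, so
    expanding the form at (a - b) + b only adds nonnegative terms. *)
Lemma gradS_nonexp g g' :
  qform S (gradS g - gradS g') <= kappa ^+ 2 * qform S (g - g').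
Proof.
have [_ _ uS] := sqrtmx_pd hd hSigma; have sM := (M_psd).1.
pose y := prox (S *m g); pose y' := prox (S *m g').
pose a := S *m (g - g'); pose b := y - y'.
have E : gradS g - gradS g' = kappa *: (M *m (a - b)).
  rewrite /gradS !grad_f0 /env_grad -scalerBr -mulmxBr; congr (_ *: (_ *m _)).
  rewrite /a /b mulmxBr -/y -/y'.
  by apply/matrixP => i j; rewrite !mxE; ring.
have mono : 0 <= dotv (M *m (a - b)) b.
  have := env_grad_subgrad (S *m g) y'; have := env_grad_subgrad (S *m g') y.
  rewrite -/y -/y' => H1 H2.
  have : dotv (gradS g - gradS g') (y' - y) <= 0.
    by rewrite /gradS !grad_f0 dotvBl -[dotv _ (y' - y) in X in _ - X]opprK
      -dotvNr opprB; lra.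
  by rewrite E dotvZl pmulr_rle0// -(opprB y y') -/b dotvNr oppr_le0.
rewrite E qformZ ler_pM2l ?exprn_gt0// qformE mulKVmx//.
rewrite dotvC -qformE.
have -> : qform S (g - g') = qform M a.
  by rewrite !qformE /a mulKmx// dotvC.
have := qformD (a - b) b sM; rewrite subrK.
move: mono; rewrite dotv_mull sM => mono ->.
have := (M_psd).2 b; lra.
Qed.

End Envelope.

(** * Measurability and laws of random vectors *)

Section CoordinateMeasurability.
Context {R : realType} {d : nat}.
Implicit Types (h : 'cV[R]_d -> R).

(* ['cV[R]_d] carries no sigma-algebra in the library: measurability of [h] is
   tested on all vectors of measurable functions. *)
Definition coord_measurable h : Prop :=
  forall disp (T : measurableType disp) (Y : 'I_d -> T -> R),
    (forall i, measurable_fun [set: T] (Y i)) ->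
    measurable_fun [set: T] (fun w => h (\col_i Y i w)).

Lemma coord_measurable_coord (i : 'I_d) : coord_measurable (fun v => v i 0).
Proof.
move=> disp T Y mY; rewrite (_ : (fun _ => _) = Y i)//.
by apply/funext => w; rewrite mxE.
Qed.

Lemma coord_measurable_cst (c : R) : coord_measurable (fun=> c).
Proof. by move=> disp T Y mY; exact: measurable_cst. Qed.

Lemma coord_measurableD h k : coord_measurable h -> coord_measurable k ->
  coord_measurable (fun v => h v + k v).
Proof.
by move=> mh mk disp T Y mY; apply: measurable_funD; [exact: mh|exact: mk].
Qed.

Lemma coord_measurableM h k : coord_measurable h -> coord_measurable k ->
  coord_measurable (fun v => h v * k v).
Proof.
by move=> mh mk disp T Y mY; apply: measurable_funM; [exact: mh|exact: mk].
Qed.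

Lemma coord_measurable_comp h (f : R -> R) : measurable_fun [set: R] f ->
  coord_measurable h -> coord_measurable (fun v => f (h v)).
Proof.
move=> mf mh disp T Y mY.
exact: (measurableT_comp mf (mh _ _ _ mY)).
Qed.

Lemma coord_measurable_sum (I : Type) (s : seq I) (F : I -> 'cV[R]_d -> R) :
  (forall i, coord_measurable (F i)) ->
  coord_measurable (fun v => \sum_(i <- s) F i v).
Proof.
move=> mF; elim: s => [|a s IH] disp T Y mY.
  by under eq_fun do rewrite big_nil; exact: measurable_cst.
under eq_fun do rewrite big_cons.
by apply: measurable_funD; [exact: mF|exact: IH].
Qed.

Lemma coord_measurable_dotv (F : 'cV[R]_d -> 'cV[R]_d) (x : 'cV[R]_d) :
  (forall i, coord_measurable (fun v => F v i 0)) ->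
  coord_measurable (fun v => dotv (F v) x).
Proof.
move=> mF; under [X in coord_measurable X]eq_fun do rewrite dotvE.
apply: (@coord_measurable_sum _ _ (fun i v => F v i 0 * x i 0)) => i.
by apply: coord_measurableM; [exact: mF|exact: coord_measurable_cst].
Qed.

Lemma coord_measurable_norm2 (q : 'cV[R]_d) : coord_measurable (fun v => norm2 (v - q)).
Proof.
move=> disp T Y mY; rewrite /norm2.
have ms : measurable_fun [set: R] (@Num.sqrt R).
  by apply: continuous_measurable_fun; exact: sqrt_continuous.
apply: (measurableT_comp ms).
under eq_fun do rewrite dotvE.
have : coord_measurable (fun v : 'cV[R]_d => \sum_i (v i 0 - q i 0) * (v i 0 - q i 0)).
  apply: (@coord_measurable_sum _ _ (fun i (v : 'cV[R]_d) =>
    (v i 0 - q i 0) * (v i 0 - q i 0))) => i.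
  have H : coord_measurable (fun v => v i 0 - q i 0).
    apply: coord_measurableD; first exact: coord_measurable_coord.
    exact: coord_measurable_cst.
  exact: coord_measurableM.
move=> /(_ _ _ _ mY); apply: eq_measurable_fun => w _ /=.
by apply: eq_bigr => i _; rewrite !mxE.
Qed.

Lemma rat_dense_norm2 (g : 'cV[R]_d) (e : R) : 0 < e ->
  exists q : 'cV[rat]_d, norm2 (g - map_mx ratr q) < e.
Proof.
move=> e0; have de : 0 < e / (d%:R + 1) by rewrite divr_gt0// ltr_wpDl.
have H i : exists r : rat, `|g i 0 - ratr r| < e / (d%:R + 1).
  have : g i 0 < g i 0 + e / (d%:R + 1) by rewrite ltrDl.
  move=> /rat_in_itvoo[r]; rewrite in_itv/= => /andP[r1 r2]; exists r.
  by rewrite distrC gtr0_norm ?subr_gt0// ltrBlDl.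
pose q : 'cV[rat]_d := \col_i projT1 (cid (H i)).
exists q; apply: le_lt_trans (norm2_le_sum _) _.
apply: (@le_lt_trans _ _ (\sum_(i < d) e / (d%:R + 1))).
  apply: ler_sum => i _; rewrite !mxE; case: cid => r /= /ltW.
  exact.
rewrite sumr_const card_ord -[X in X < _]mulr_natl mulrA ltr_pdivrMr ?ltr_wpDl//.
by rewrite mulrC ltr_pM2l// ltrDl.
Qed.

(** [h] is the infimum of the cones h(q) + K |g - q| over rational vectors q, a countable infimum of
    measurable functions. *)
Lemma lipschitz_coord_measurable h (K : R) : 0 <= K ->
  (forall x y, `|h x - h y| <= K * norm2 (x - y)) -> coord_measurable h.
Proof.
move=> K0 Lh disp T Y mY.
pose q (n : nat) : 'cV[R]_d := map_mx ratr (odflt 0 (unpickle n : option 'cV[rat]_d)).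
pose u (n : nat) (g : 'cV[R]_d) := h (q n) + K * norm2 (g - q n).
have hu n g : h g <= u n g.
  by have := le_trans (ler_norm _) (Lh g (q n)); rewrite lerBlDl.
have -> : (fun w => h (\col_i Y i w)) =
    (fun w => infs (fun n => u n (\col_i Y i w)) 0%N).
  apply/funext => w; set g := \col_i Y i w.
  have lb : has_lbound (range (u ^~ g)) by exists (h g) => _ [n _ <-].
  have sE : sdrop (u ^~ g) 0%N = range (u ^~ g).
    by apply/seteqP; split => _ [n _ <-]; exists n.
  rewrite /infs /= sE; apply/eqP; rewrite eq_le; apply/andP; split.
    apply: lb_le_inf; first by exists (u 0%N g), 0%N.
    by move=> _ [n _ <-].
  apply/ler_addgt0Pl => e e0.
  (* The cone at q overshoots h(g) by at most 2 K |g - q|. *)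
  have e1 : 0 < e / (2 * K + 1) by rewrite divr_gt0// ltr_wpDl// mulr_ge0.
  have [r Hr] := rat_dense_norm2 g e1.
  have qr : q (pickle r) = map_mx ratr r by rewrite /q pickleK.
  apply: (@le_trans _ _ (u (pickle r) g)); first by apply: ge_inf => //;
    exists (pickle r).
  rewrite /u qr; have := Lh (map_mx ratr r) g.
  rewrite -[norm2 (_ - g)]norm2N opprB => /(le_trans (ler_norm _)) H1.
  have : K * norm2 (g - map_mx ratr r) * 2 <= e.
    apply: (@le_trans _ _ (K * (e / (2 * K + 1)) * 2)).
      by rewrite ler_wpM2r// ler_wpM2l// ltW.
    rewrite mulrA mulrAC ler_pdivrMr; last by rewrite ltr_wpDl// mulr_ge0.
    by have := ltW e0; lra.
  lra.
apply: measurable_fun_infs => [w _|n].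
  by exists (h (\col_i Y i w)) => _ [n _ <-].
apply: measurable_funD; first exact: measurable_cst.
apply: measurable_funM; first exact: measurable_cst.
exact: coord_measurable_norm2.
Qed.

End CoordinateMeasurability.

Lemma pushforward_measure_exists d1 d2 (T1 : measurableType d1)
    (T2 : measurableType d2) (R : realType) (mu : {measure set T1 -> \bar R})
    (f : T1 -> T2) : measurable_fun [set: T1] f ->
  exists m : {measure set T2 -> \bar R}, forall A, m A = mu (f @^-1` A).
Proof. by move=> mf; unshelve eexists (pushforward mu f); first exact: mf. Qed.

Section BoxLaw.
Context {R : realType} {d : nat}.

Definition box (A : 'I_d -> set R) : set 'cV[R]_d := [set v | forall i, A i (v i 0)].

Definition boxes : set (set 'cV[R]_d) :=
  [set box A | A in [set A : 'I_d -> set R | forall i, measurable (A i)]].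

(** Column vectors with the sigma-algebra generated by boxes, a type on which pushforward laws can
    be compared as measures. *)
Definition boxspace := g_sigma_algebraType boxes.

Lemma measurable_boxspace disp (T : measurableType disp) (Y : 'I_d -> T -> R) :
  (forall i, measurable_fun [set: T] (Y i)) ->
  measurable_fun [set: T] (fun w => (\col_i Y i w) : boxspace).
Proof.
move=> mY; apply: (@measurability _ _ T boxspace setT _ boxes erefl).
move=> _ [_ [A mA <-] <-].
rewrite (_ : _ `&` _ = \bigcap_(i in [set: 'I_d]) (Y i @^-1` A i)).
  apply: fin_bigcap_measurable => // i _.
  by rewrite -[X in measurable X]setTI; exact: mY.
by apply/seteqP; split=> w /= => [[_ H] i _|H];
  [have := H i|split=> // i; have := H i I]; rewrite mxE.
Qed.

Lemma measurable_boxspace_coord (i : 'I_d) :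
  measurable_fun [set: boxspace] (fun v => v i 0 : R).
Proof.
move=> _ B mB; rewrite setTI; apply: sub_sigma_algebra.
exists (fun j => if j == i then B else setT); first by move=> j; case: ifP.
apply/seteqP; split=> v /= => [/(_ i)|Bv j]; first by rewrite eqxx.
by case: eqP => [->|].
Qed.

Section SameLaw.
Context d1 d2 (T1 : measurableType d1) (T2 : measurableType d2).
Context (mu1 : {measure set T1 -> \bar R}) (mu2 : {measure set T2 -> \bar R}).
Context (Y1 : 'I_d -> T1 -> R) (Y2 : 'I_d -> T2 -> R).
Context (mY1 : forall i, measurable_fun [set: T1] (Y1 i))
  (mY2 : forall i, measurable_fun [set: T2] (Y2 i))
  (mu1T : (mu1 setT < +oo)%E)
  (Hbox : forall A : 'I_d -> set R, (forall i, measurable (A i)) ->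
    mu1 [set w | forall i, A i (Y1 i w)] = mu2 [set w | forall i, A i (Y2 i w)]).

Let V1 w : boxspace := \col_i Y1 i w.
Let V2 w : boxspace := \col_i Y2 i w.

(** Boxes are stable under intersection and include the whole space, which has finite mass, so the
    two pushforwards agree by uniqueness of measures. *)
Lemma same_law (B : set boxspace) : measurable B ->
  mu1 (V1 @^-1` B) = mu2 (V2 @^-1` B).
Proof.
have mV1 := measurable_boxspace mY1; have mV2 := measurable_boxspace mY2.
have H (A : 'I_d -> set R) : (forall i, measurable (A i)) ->
  mu1 (V1 @^-1` box A) = mu2 (V2 @^-1` box A).
  move=> mA; have := Hbox mA; congr (_ = _); congr (_ _).
    by apply/seteqP; split=> w /= Hw i; have := Hw i; rewrite mxE.
  by apply/seteqP; split=> w /= Hw i; have := Hw i; rewrite mxE.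
have [m1 m1E] := pushforward_measure_exists mu1 mV1.
have [m2 m2E] := pushforward_measure_exists mu2 mV2.
rewrite -/(V1 @^-1` B) -m1E -m2E.
apply: (@measure_unique _ R boxspace boxes (fun=> setT)) => //.
- move=> _ _ [A mA <-] [B' mB <-]; exists (fun i => A i `&` B' i).
    by move=> i; apply: measurableI; [exact: mA|exact: mB].
  by apply/seteqP; split=> v /= => [Hv|[H1 H2] i]; [split=> i; case: (Hv i)|split].
- move=> _; exists (fun=> setT) => //.
  by apply/seteqP; split.
- by rewrite bigcup_const//; exists 0%N.
- by move=> _ [A mA <-]; rewrite m1E m2E; exact: H.
- by move=> _; rewrite m1E preimage_setT.
Qed.

Lemma same_law_ge0_integral (h : 'cV[R]_d -> R) : coord_measurable h ->
  (forall v, 0 <= h v) ->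
  (\int[mu1]_w (h (V1 w))%:E = \int[mu2]_w (h (V2 w))%:E)%E.
Proof.
move=> mh h0.
have mV1 := measurable_boxspace mY1; have mV2 := measurable_boxspace mY2.
have mh' : measurable_fun [set: boxspace] (fun v => (h v)%:E).
  apply/measurable_EFinP.
  have := mh _ _ _ measurable_boxspace_coord; apply: eq_measurable_fun => v _.
  by congr h; apply/matrixP => i j; rewrite mxE (ord1 j).
have E1 := ge0_integral_pushforward mV1 mu1 measurableT mh'.
have E2 := ge0_integral_pushforward mV2 mu2 measurableT mh'.
rewrite !preimage_setT in E1 E2.
rewrite -[LHS]E1; last by move=> v _; rewrite lee_fin.
rewrite -[RHS]E2; last by move=> v _; rewrite lee_fin.
by apply: eq_measure_integral => B mB _; exact: same_law.
Qed.

End SameLaw.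

End BoxLaw.

(** * Bounds on the Gamma function *)

Section GammaBound.
Context {R : realType}.
Notation mu := (@lebesgue_measure R).
Implicit Types p x c : R.

(** The maximum is at x = c; the bound is 1 + y <= e^y at y = x / c - 1. *)
Lemma mul_expRN_le c x : 0 < c -> x * expR (- x / c) <= c * expR (- 1).
Proof.
move=> c0; have := expR_ge1Dx (x / c - 1); rewrite addrC subrK expRD => H.
rewrite mulNr expRN ler_pdivrMr ?expR_gt0// -mulrA -ler_pdivrMl// mulrC.
by rewrite [X in _ <= X]mulrC.
Qed.

Lemma cvg_mul_expRN c : 0 < c -> (x * expR (- x / c)) @[x --> +oo%R] --> (0 : R).
Proof.
move=> c0; apply/cvgrPdist_le => e e0. near=> x.
have x0 : 0 < x by near: x; exact: nbhs_pinfty_gt.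
rewrite sub0r normrN ger0_norm ?mulr_ge0 ?expR_ge0 ?(ltW x0)//.
have := expR_ge1Dxn 1 (ltW (divr_gt0 x0 c0)) => H.
rewrite mulNr expRN ler_pdivrMr ?expR_gt0//.
apply: (@le_trans _ _ (e * ((x / c) ^+ 2 / 2%:R))); last first.
  rewrite ler_pM2l//; apply: le_trans H; rewrite lerDr; exact: ler01.
have xe : 2 * c ^+ 2 / e <= x by near: x; apply: nbhs_pinfty_ge; exact: num_real.
rewrite ler_pdivrMr// in xe.
have -> : e * ((x / c) ^+ 2 / 2%:R) = x * (x * e) / (2 * c ^+ 2) by field; rewrite gt_eqF.
rewrite -mulrA ler_peMr// ?(ltW x0)// ler_pdivlMr ?mul1r//.
by rewrite mulr_gt0// exprn_gt0.
Unshelve. all: by end_near. Qed.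

Lemma cvg_expRN c : 0 < c -> expR (- x / c) @[x --> +oo%R] --> (0 : R).
Proof.
move=> c0; apply: (@squeeze_cvgr _ _ _ _ (fun=> 0) (fun x => x * expR (- x / c))).
- near=> x; have x1 : 1 <= x by near: x; apply: nbhs_pinfty_ge; exact: num_real.
  by rewrite expR_ge0 /= ler_peMl ?expR_ge0.
- exact: cvg_cst.
- exact: cvg_mul_expRN.
Unshelve. all: by end_near. Qed.

Lemma integral_mul_expRN c : 0 < c ->
  (\int[mu]_(x in `[0%R, +oo[) (x * expR (- x / c))%:E = (c ^+ 2)%:E)%E.
Proof.
move=> c0; pose F x : R := - (c * (x * expR (- x / c)) + c ^+ 2 * expR (- x / c)).
have dF x : is_derive x 1 F (x * expR (- x / c)).
  rewrite /F; apply: is_derive_eq.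
  rewrite /GRing.scale /=; field; rewrite gt_eqF//.
have cF x : F y @[y --> x] --> F x.
  by apply: differentiable_continuous; apply/derivable1_diffP; exact: ex_derive.
have F0 : F 0 = - c ^+ 2 by rewrite /F oppr0 !mul0r expR0 mulr1 mulr0 add0r.
have := @ge0_continuous_FTC2y R (fun x => x * expR (- x / c)) F 0 0.
rewrite -EFinB sub0r {2}F0 opprK; apply => //.
- by move=> x x0; rewrite mulr_ge0 ?expR_ge0.
- apply: continuous_subspaceT => x.
  have : derivable (fun x => x * expR (- x / c)) x 1 by exact: ex_derive.
  by move/derivable1_diffP/differentiable_continuous.
- rewrite [X in _ --> X](_ : 0 = - (c * 0 + c ^+ 2 * 0)); last first.
    by rewrite !mulr0 addr0 oppr0.
  exact: (cvgN (cvgD (cvgM (cvg_cst c) (cvg_mul_expRN c0))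
                     (cvgM (cvg_cst (c ^+ 2)) (cvg_expRN c0)))).
- exact: cvg_at_right_filter.
- by move=> x _; rewrite derive1E derive_val.
Qed.

(** Factor x^p e^(-x) as (x e^(-x/p))^(p-1) times x e^(-x/p). The first factor is at most K =
    (p/e)^(p-1), the second integrates to p^2, and K p^2 <= p^p because p <= e^(p-1). *)
Lemma rfact_le p : 1 <= p -> rfact p <= p `^ p.
Proof.
move=> p1; have p0 : 0 < p by rewrite (lt_le_trans ltr01).
pose K := p `^ (p - 1) * expR (- (p - 1)).
have K0 : 0 <= K by rewrite mulr_ge0 ?powR_ge0 ?expR_ge0.
have fg x : 0 <= x -> x `^ (p + 1 - 1) * expR (- x) <= K * (x * expR (- x / p)).
  move=> x0; rewrite addrK -mulr_powRB1//.
  have -> : x * x `^ (p - 1) * expR (- x) =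
            (x * expR (- x / p)) `^ (p - 1) * (x * expR (- x / p)).
    rewrite powRM ?expR_ge0// -expRM.
    have -> : expR (- x) = expR (- x / p * (p - 1)) * expR (- x / p).
      by rewrite -expRD; congr expR; field; rewrite gt_eqF.
    by ring.
  rewrite ler_wpM2r ?mulr_ge0 ?expR_ge0//.
  apply: (@le_trans _ _ ((p * expR (- 1)) `^ (p - 1))).
    by apply: ge0_ler_powR; rewrite ?nnegrE ?subr_ge0 ?mulr_ge0 ?expR_ge0
      ?mul_expRN_le// ltW.
  by rewrite powRM ?expR_ge0 ?(ltW p0)// -expRM mulN1r.
have mg : measurable_fun [set: R] (fun x : R => K * (x * expR (- x / p))).
  by apply: measurable_funM => //; apply: measurable_funM => //;
     apply: measurableT_comp => //; apply: measurable_funM => //; exact: measurable_funN.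
have mf : measurable_fun (`]0%R, +oo[%classic : set R)
    (fun x : R => x `^ (p + 1 - 1) * expR (- x)).
  apply: measurable_funM.
    by apply: measurable_funTS; exact: measurable_powR.
  apply: measurable_funTS; apply: measurableT_comp => //.
have H1 : (\int[mu]_(x in `]0%R, +oo[) (x `^ (p + 1 - 1) * expR (- x))%:E
     <= (K * p ^+ 2)%:E)%E.
  apply: (@le_trans _ _ (\int[mu]_(x in `]0%R, +oo[) (K * (x * expR (- x / p)))%:E)%E).
    apply: ge0_le_integral => //.
    - by move=> x; rewrite /= in_itv/= andbT => x0;
      rewrite lee_fin mulr_ge0 ?powR_ge0 ?expR_ge0.
    - exact/measurable_EFinP.
    - by apply/measurable_EFinP; apply: measurable_funTS.
    - by move=> x; rewrite /= in_itv/= andbT => x0; rewrite lee_fin fg// ltW.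
  rewrite integral_itv_obnd_cbnd; last by apply/measurable_EFinP; apply: measurable_funTS.
  under eq_integral do rewrite EFinM.
  rewrite ge0_integralZl//; last 2 first.
  - apply/measurable_EFinP; apply: measurable_funTS.
    by apply: measurable_funM => //; apply: measurableT_comp => //;
       apply: measurable_funM => //; exact: measurable_funN.
  - by move=> x; rewrite /= in_itv/= andbT => x0; rewrite lee_fin mulr_ge0 ?expR_ge0.
  by rewrite integral_mul_expRN// EFinM.
apply: (@le_trans _ _ (K * p ^+ 2)).
  rewrite /rfact /Gamma /Rintegral -lee_fin fineK//.
  rewrite ge0_fin_numE; first exact: le_lt_trans H1 (ltry _).
  by apply: integral_ge0 => x _; rewrite lee_fin mulr_ge0 ?powR_ge0 ?expR_ge0.
rewrite -[p `^ p]mulr_powRB1// ?(ltW p0)// /K expr2.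
have -> : p `^ (p - 1) * expR (- (p - 1)) * (p * p) =
          (p * p `^ (p - 1)) * (p * expR (- (p - 1))) by ring.
rewrite ler_piMr ?mulr_ge0 ?powR_ge0 ?(ltW p0)// expRN ler_pdivrMr ?expR_gt0// mul1r.
by have := expR_ge1Dx (p - 1); rewrite addrC subrK.
Qed.

End GammaBound.

(** * Maurey's inequality *)

Section NormalDensity.
Context {R : realType}.
Notation mu := (@lebesgue_measure R).
Local Notation gam := (normal_prob (0 : R) 1).
Local Notation phi := (normal_pdf (0 : R) 1).

Lemma ge0_integral_normal_prob (f : R -> \bar R) :
  measurable_fun [set: R] f -> (forall x, 0 <= f x)%E ->
  (\int[gam]_x f x = \int[mu]_x (f x * (phi x)%:E))%E.
Proof.
move=> mf f0; have dom := @normal_prob_dominates R 0 1.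
rewrite -(Radon_Nikodym_SigmaFinite.change_of_variables dom)//=.
apply: ae_eq_integral => //.
- apply: emeasurable_funM => //; apply: (measurable_int mu).
  exact: Radon_Nikodym_SigmaFinite.f_integrable.
- apply: emeasurable_funM => //=; apply/measurableT_comp => //=.
  exact: measurable_normal_pdf.
- apply: ae_eqe_mul2l => /=.
  apply: integral_ae_eq => //=.
  + exact: Radon_Nikodym_SigmaFinite.f_integrable.
  + by apply/measurableT_comp => //=; exact: measurable_normal_pdf.
  + by move=> E _ mE; rewrite -Radon_Nikodym_SigmaFinite.f_integral.
Qed.

Lemma normal_pdf01E (x : R) : phi x = normal_peak 1 * expR (- (x ^+ 2 / 2)).
Proof.
rewrite normal_pdfE ?oner_neq0// /normal_fun subr0 expr1n; congr (_ * expR _).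
by rewrite mulNr.
Qed.

Lemma normal_peak1_gt0 : 0 < normal_peak (1 : R).
Proof. by rewrite normal_peak_gt0// oner_neq0. Qed.

Lemma normal_pdf01_gt0 (x : R) : 0 < phi x.
Proof. by rewrite normal_pdf01E mulr_gt0 ?expR_gt0// normal_peak1_gt0. Qed.

Lemma normal_pdf01_unimodal (x y : R) : `|y| <= `|x| -> phi x <= phi y.
Proof.
move=> xy; rewrite !normal_pdf01E ler_pM2l ?normal_peak1_gt0//.
rewrite ler_expR lerN2 ler_pM2r// -[y ^+ 2]real_normK ?num_real//.
by rewrite -[x ^+ 2]real_normK ?num_real// ler_sqr ?nnegrE.
Qed.

(** The parallelogram identity; it is the origin of the constant 1/4 in Maurey's condition. *)
Lemma normal_pdf01_midpoint (x y : R) :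
  expR ((x - y) ^+ 2 / 4) * (phi x * phi y) = phi ((x + y) / 2) ^+ 2.
Proof.
rewrite !normal_pdf01E.
have -> : expR ((x - y) ^+ 2 / 4) *
   (normal_peak 1 * expR (- (x ^+ 2 / 2)) * (normal_peak 1 * expR (- (y ^+ 2 / 2)))) =
   normal_peak 1 ^+ 2 * (expR ((x - y) ^+ 2 / 4) *
     (expR (- (x ^+ 2 / 2)) * expR (- (y ^+ 2 / 2)))) by ring.
rewrite exprMn; congr (_ * _); rewrite -!expRD -expRM_natl.
by congr expR; field.
Qed.

(** Heights are cut at 1 because the functions compared will be normalised to have supremum 1, so
    that their level sets are nonempty exactly where the comparison is made. *)
Definition level (F : R -> R) (s : R) : set R := [set x | 0 < s < 1 /\ s < F x].

(** Tonelli on the region below the graph and below height 1: sections at fixed height are level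
    sets, sections at fixed [x] are intervals. *)
Lemma layer_cake (F : R -> R) : measurable_fun [set: R] F -> (forall x, 0 <= F x) ->
  measurable_fun [set: R] (fun s => mu (level F s)) /\
  (\int[mu]_s mu (level F s) = \int[mu]_x (Num.min (F x) 1)%:E)%E.
Proof.
move=> mF F0.
pose A : set (R * R) := [set z | 0 < z.1 < 1 /\ z.1 < F z.2].
have mA : measurable A.
  rewrite (_ : A = (fst @^-1` `]0, 1[) `&` [set z | z.1 < F z.2]).
    apply: measurableI.
      by rewrite -[X in measurable X]setTI; exact: measurable_fst.
    have := @measurable_fun_ltr _ (R * R)%type R setT fst (F \o snd) measurable_fst
      (measurableT_comp mF measurable_snd).
    move=> H; rewrite -[X in measurable X]setTI.
    exact: (H measurableT [set true]).
  by apply/seteqP; split=> z /=; rewrite in_itv.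
pose f (z : R * R) : \bar R := (\1_A z)%:E.
have mf : measurable_fun setT f by apply/measurable_EFinP; exact: measurable_indic.
have f0 z : (0 <= f z)%E by rewrite lee_fin.
have E1 s : (\int[mu]_x f (s, x) = mu (level F s))%E.
  have mL : measurable (level F s).
    by have := measurable_xsection s mA; rewrite /xsection; congr measurable;
       apply/seteqP; split=> x /=; rewrite inE.
  by rewrite -[X in mu X]setIT -integral_indic.
have E2 x : (\int[mu]_s f (s, x) = (Num.min (F x) 1)%:E)%E.
  transitivity (\int[mu]_s (\1_(`]0, Num.min (F x) 1[%classic : set R) s)%:E)%E.
    apply: eq_integral => s _; rewrite /f /= !indicE /A; congr ((nat_of_bool _)%:R%:E).
    apply: is_true_inj; apply/propext; rewrite !inE /= in_itv/= lt_min.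
    by split=> [[/andP[-> ->] ->]|/and3P[-> -> ->]].
  rewrite integral_indic//= setIT.
  etransitivity; first exact: lebesgue_measure_itv.
  rewrite /= lte_fin.
  case: ifP => [_|]; first by rewrite -EFinB subr0.
  move/negbT; rewrite -leNgt => H; congr EFin; apply/eqP.
  by rewrite eq_le H le_min F0 ler01.
have := @fubini_tonelli _ _ _ _ R mu mu f mf f0.
under eq_integral do rewrite E1.
under [X in _ = X -> _]eq_integral do rewrite E2.
move=> ->; split=> //.
have := @measurable_fun_fubini_tonelli_F _ _ _ _ R mu f mf f0.
by apply: eq_measurable_fun => s _; exact: E1.
Qed.

(* Brunn-Minkowski on the line, in the only case needed: the midpoint set is
   contained in a symmetric interval. *)
Lemma level_sets_le (A B C : set R) : measurable A -> measurable B -> measurable C ->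
  A !=set0 -> B !=set0 ->
  (forall a b z, A a -> B b -> `|z| <= `|(a + b) / 2| -> C z) ->
  (mu A + mu B <= 2%:E * mu C)%E.
Proof.
move=> mA mB mC [a0 Aa0] [b0 Bb0] H.
have [->|Cfin] := eqVneq (mu C) +oo%E.
  by rewrite mulry gtr0_sg// mul1e leey.
have Cf : mu C \is a fin_num.
  by rewrite ge0_fin_numE// lt_neqAle Cfin leey.
set c := fine (mu C).
have cE : mu C = c%:E by rewrite fineK.
have key a b : A a -> B b -> `|a + b| <= c.
  (* The whole interval [-m, m] lies in [C], and its length is |a + b|. *)
  move=> Aa Bb; pose m : R := `|(a + b) / 2|.
  pose I : set R := `[- m, m]%classic.
  have : (mu I <= mu C)%E.
    apply: le_measure; [by rewrite inE; exact: measurable_itv|by rewrite inE|].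
    by move=> z; rewrite /I /= in_itv/= -ler_norml; exact: H.
  have -> : mu I = (if (- m < m)%R then (m - - m)%:E else 0)%E.
    by etransitivity; [exact: lebesgue_measure_itv|rewrite /= lte_fin -EFinB].
  rewrite cE; case: ifP => [_|].
    rewrite opprK lee_fin /m normrM [`|2^-1|]ger0_norm ?invr_ge0//; lra.
  move/negbT; rewrite -leNgt => H1 _.
  have m0 : m = 0.
    apply/eqP; rewrite eq_le; apply/andP; split; last exact: normr_ge0.
    have m1 : 0 <= m by exact: normr_ge0.
    move: m H1 m1 {I} => m'; lra.
  have : 0 <= c by rewrite fine_ge0.
  move: m0; rewrite /m => /normr0_eq0 => ab0.
  have -> : a + b = 0 by lra.
  by rewrite normr0.
have keyu a b : A a -> B b -> a + b <= c.
  by move=> Aa Bb; exact: le_trans (ler_norm _) (key _ _ Aa Bb).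
have keyl a b : A a -> B b -> - c <= a + b.
  by move=> Aa Bb; have := key _ _ Aa Bb; rewrite ler_norml => /andP[].
have uA : has_ubound A by exists (c - b0) => a Aa; rewrite lerBrDr; exact: keyu.
have uB : has_ubound B by exists (c - a0) => b Bb; rewrite lerBrDl; exact: keyu.
have lA : has_lbound A by exists (- c - b0) => a Aa; rewrite lerBlDr; exact: keyl.
have lB : has_lbound B by exists (- c - a0) => b Bb; rewrite lerBlDl; exact: keyl.
(* Bounds on all sums a + b pass to the suprema and infima; subtracting them bounds the total length
   of the hulls of [A] and [B] by 2 c. *)
have sup_le : sup A + sup B <= c.
  rewrite -lerBrDl; apply: ge_sup; first by exists b0.
  move=> b Bb; rewrite lerBrDl -lerBrDr; apply: ge_sup; first by exists a0.
  by move=> a Aa; rewrite lerBrDr; exact: keyu.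
have inf_ge : - c <= inf A + inf B.
  rewrite -lerBlDl; apply: lb_le_inf; first by exists b0.
  move=> b Bb; rewrite lerBlDl -lerBlDr; apply: lb_le_inf; first by exists a0.
  by move=> a Aa; rewrite lerBlDr; exact: keyl.
have HD (D : set R) : measurable D -> D !=set0 -> has_ubound D -> has_lbound D ->
    (mu D <= (sup D - inf D)%:E)%E.
  move=> mD D0 uD lD.
  pose I : set R := `[inf D, sup D]%classic.
  apply: (@le_trans _ _ (mu I)).
    apply: le_measure; [by rewrite inE|by rewrite inE; exact: measurable_itv|].
    move=> x Dx; rewrite /I /= in_itv/=.
    by rewrite ge_inf//= ub_le_sup.
  have -> : mu I = (if (inf D < sup D)%R then (sup D - inf D)%:E else 0)%E.
    by etransitivity; [exact: lebesgue_measure_itv|rewrite /= lte_fin -EFinB].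
  case: ifP => // _.
  case: D0 => x Dx; rewrite lee_fin subr_ge0.
  by apply: (@le_trans _ _ x); [exact: ge_inf|exact: ub_le_sup].
have HA : (mu A <= (sup A - inf A)%:E)%E by apply: HD => //; exists a0.
have HB : (mu B <= (sup B - inf B)%:E)%E by apply: HD => //; exists b0.
apply: le_trans (leeD HA HB) _; rewrite cE -EFinD -EFinM lee_fin; lra.
Qed.

Lemma expR_integral_bounded d' (T' : measurableType d') (Q : probability T' R)
    (f : T' -> R) (K : R) : measurable_fun [set: T'] f -> (forall z, `|f z| <= K) ->
  exists2 a : R, expR (- K) <= a <= expR K & (\int[Q]_z (expR (f z))%:E)%E = a%:E.
Proof.
move=> mf fK.
have mef : measurable_fun [set: T'] (fun z => (expR (f z))%:E).
  by apply/measurable_EFinP; apply: measurableT_comp.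
have lo : ((expR (- K))%:E <= \int[Q]_z (expR (f z))%:E)%E.
  rewrite -[leLHS]mule1 -(probability_setT Q) -integral_cst//.
  apply: ge0_le_integral => [//|z _|//|//|z _]; first by rewrite lee_fin expR_ge0.
  by rewrite lee_fin ler_expR; have := fK z; rewrite ler_norml => /andP[].
have hi : (\int[Q]_z (expR (f z))%:E <= (expR K)%:E)%E.
  rewrite -[leRHS]mule1 -(probability_setT Q) -integral_cst//.
  apply: ge0_le_integral => [//|z _|//|//|z _]; first by rewrite lee_fin expR_ge0.
  by rewrite lee_fin ler_expR; exact: le_trans (ler_norm _) (fK z).
have fin : (\int[Q]_z (expR (f z))%:E)%E \is a fin_num.
  rewrite ge0_fin_numE; first exact: le_lt_trans hi (ltry _).
  by apply: integral_ge0 => x _; rewrite lee_fin expR_ge0.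
exists (fine (\int[Q]_z (expR (f z))%:E)%E); last by rewrite fineK.
by rewrite -!lee_fin fineK// lo hi.
Qed.

(** The Prekopa-Leindler argument at the midpoint. The condition on u, v and the parallelogram
    identity give U(x) V(y) <= W((x + y) / 2)^2 for the normalised tilted densities; level sets are
    compared at each height, and integrating over heights bounds a sum of masses, from which AM-GM
    extracts the product. *)
Lemma maurey_real (u v : R -> R) (K : R) :
  measurable_fun [set: R] u -> measurable_fun [set: R] v ->
  (forall x, `|u x| <= K) -> (forall x, `|v x| <= K) ->
  (forall x y, u x + v y <= (x - y) ^+ 2 / 4) ->
  ((\int[gam]_x (expR (u x))%:E) * (\int[gam]_x (expR (v x))%:E) <= 1)%E.
Proof.
move=> mu_ mv uK vK uv.
have [a /andP[ea _] aE] := @expR_integral_bounded _ _ gam u K mu_ uK.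
have a0 := lt_le_trans (expR_gt0 _) ea.
have [b /andP[eb _] bE] := @expR_integral_bounded _ _ gam v K mv vK.
have b0 := lt_le_trans (expR_gt0 _) eb.
rewrite aE bE -EFinM lee_fin.
(* Dividing by the supremum [M] makes every height below 1 exceeded somewhere, which supplies the
   nonempty sets of [level_sets_le]. *)
have tilt (f : R -> R) c : measurable_fun [set: R] f -> (forall x, `|f x| <= K) ->
    0 < c -> (\int[gam]_x (expR (f x))%:E)%E = c%:E ->
    exists2 M : R, 0 < M &
     [/\ forall x, expR (f x) * phi x / M <= 1,
        forall s, s < 1 -> exists x, s < expR (f x) * phi x / M,
        measurable_fun [set: R] (fun x => expR (f x) * phi x / M) &
        (\int[mu]_x (Num.min (expR (f x) * phi x / M) 1)%:E)%E = (c / M)%:E].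
  move=> mf fK c0 cE.
  pose U x := expR (f x) * phi x.
  have hs : has_sup (range U).
    split; first by exists (U 0), 0.
    exists (expR K * normal_peak 1) => _ [x _ <-];
      rewrite /U ler_pM ?expR_ge0 ?normal_pdf_ge0//.
      by rewrite ler_expR; exact: le_trans (ler_norm _) (fK x).
    by rewrite normal_pdf_ub// oner_neq0.
  have U0 x : 0 < U x by rewrite mulr_gt0 ?expR_gt0 ?normal_pdf01_gt0.
  have UM x : U x <= sup (range U) by apply: sup_upper_bound => //; exists x.
  have M0 : 0 < sup (range U) by exact: lt_le_trans (U0 0) (UM 0).
  have U1 x : U x / sup (range U) <= 1 by rewrite ler_pdivrMr// mul1r.
  have mU : measurable_fun [set: R] (fun x => U x / sup (range U)).
    apply: measurable_funM => //; apply: measurable_funM => //.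
      exact: measurableT_comp.
    exact: measurable_normal_pdf.
  exists (sup (range U)) => //; split=> //.
    move=> s s1.
    have e0 : 0 < (1 - s) * sup (range U) by rewrite mulr_gt0// subr_gt0.
    have [_ [x _ <-] Hx] := sup_adherent e0 hs; exists x.
    by rewrite ltr_pdivlMr//; apply: le_lt_trans Hx;
      rewrite mulrBl mul1r opprB addrC subrK.
  under eq_integral => x _ do rewrite (min_l (U1 x)) mulrC EFinM.
  rewrite ge0_integralZl//; last 3 first.
  - apply/measurable_EFinP; apply: measurable_funM; last exact: measurable_normal_pdf.
    exact: measurableT_comp.
  - by move=> x _; rewrite lee_fin ltW.
  - by rewrite lee_fin invr_ge0 ltW.
  rewrite [c / _]mulrC EFinM -cE ge0_integral_normal_prob//.
  by apply/measurable_EFinP; exact: measurableT_comp.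
have [Mu Mu0 [U1 Us mU iU]] := tilt u a mu_ uK a0 aE.
have [Mv Mv0 [V1 Vs mV iV]] := tilt v b mv vK b0 bE.
pose U x := expR (u x) * phi x / Mu; pose V x := expR (v x) * phi x / Mv.
pose m := Num.sqrt (Mu * Mv).
have MM0 : 0 < Mu * Mv by rewrite mulr_gt0.
have m0 : 0 < m by rewrite sqrtr_gt0.
pose W x := phi x / m.
have mW : measurable_fun [set: R] W.
  by apply: measurable_funM => //; exact: measurable_normal_pdf.
have W0 x : 0 <= W x by rewrite divr_ge0 ?normal_pdf_ge0 ?ltW.
have U0 x : 0 <= U x by rewrite divr_ge0 ?mulr_ge0 ?expR_ge0 ?normal_pdf_ge0 ?ltW.
have V0 x : 0 <= V x by rewrite divr_ge0 ?mulr_ge0 ?expR_ge0 ?normal_pdf_ge0 ?ltW.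
have UVW x y : U x * V y <= W ((x + y) / 2) ^+ 2.
  rewrite /W expr_div_n -normal_pdf01_midpoint sqr_sqrtr ?(ltW MM0)//.
  have -> : U x * V y = expR (u x + v y) * (phi x * phi y) / (Mu * Mv).
    by rewrite /U /V expRD; field; rewrite !gt_eqF.
  rewrite ler_pM2r ?invr_gt0// ler_pM2r ?mulr_gt0 ?normal_pdf01_gt0//.
  by rewrite ler_expR.
have mlev F s : measurable_fun [set: R] F -> measurable (level F s).
  move=> mF; rewrite (_ : level F s = [set x | 0 < s < 1] `&` (F @^-1` `]s, +oo[)).
    apply: measurableI; last by rewrite -[X in measurable X]setTI; exact: mF.
    by case: (0 < s < 1); rewrite ?set_true ?set_false.
  by apply/seteqP; split=> x /=; rewrite in_itv/= andbT.
have lev_le s : (mu (level U s) + mu (level V s) <= 2%:E * mu (level W s))%E.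
  have [s01|s01] := boolP (0 < s < 1); last first.
    have l0 F : level F s = set0.
      by apply/seteqP; split=> x //= [H]; rewrite H in s01.
    by rewrite !l0 measure0 mule0 adde0.
  have [s0 s1] := andP s01.
  apply: level_sets_le; try exact: mlev.
  - by have [x Hx] := Us s s1; exists x.
  - by have [x Hx] := Vs s s1; exists x.
  - move=> x y z [_ Hx] [_ Hy] zxy; split=> //.
    apply: (@lt_le_trans _ _ (W ((x + y) / 2))).
      rewrite -ltr_sqr ?nnegrE ?(ltW s0)//; apply: lt_le_trans (UVW x y).
      by rewrite expr2 ltr_pM ?(ltW s0).
    by rewrite /W ler_pM2r ?invr_gt0// normal_pdf01_unimodal.
have [mlU iU'] := layer_cake mU U0.
have [mlV iV'] := layer_cake mV V0.
have [mlW iW'] := layer_cake mW W0.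
(* [W] may exceed 1, but truncation only lowers the integral of phi / m. *)
have iW : (\int[mu]_x (Num.min (W x) 1)%:E <= m^-1%:E)%E.
  apply: (@le_trans _ _ (\int[mu]_x (m^-1%:E * (phi x)%:E))%E).
    apply: ge0_le_integral => //.
    - by move=> x _; rewrite lee_fin le_min W0 ler01.
    - by apply/measurable_EFinP; exact: measurable_minr.
    - apply/measurable_EFinP; apply: measurable_funM => //.
      exact: measurable_normal_pdf.
    - by move=> x _; rewrite -EFinM lee_fin ge_min /W mulrC lexx.
  rewrite ge0_integralZl//.
  - by rewrite integral_normal_pdf mule1.
  - by apply/measurable_EFinP; exact: measurable_normal_pdf.
  - by move=> x _; rewrite lee_fin normal_pdf_ge0.
  - by rewrite lee_fin invr_ge0 ltW.
have main : a / Mu + b / Mv <= 2 * m^-1.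
  rewrite -lee_fin EFinD -iU -iV -iU' -iV' -ge0_integralD//.
  apply: (@le_trans _ _ (\int[mu]_s (2%:E * mu (level W s)))%E).
    apply: ge0_le_integral => //.
    - by move=> s _; rewrite adde_ge0.
    - exact: emeasurable_funD.
    - exact: emeasurable_funM.
  rewrite ge0_integralZl// ?lee_fin// iW' EFinM.
  by rewrite lee_pmul2l// ?lte_fin.
pose al := a / Mu; pose be := b / Mv.
have : al * be <= m ^- 2.
  have : (al + be) ^+ 2 <= (2 * m^-1) ^+ 2.
    have al0 : 0 <= al by rewrite divr_ge0 ?ltW.
    have be0 : 0 <= be by rewrite divr_ge0 ?ltW.
    by rewrite ler_sqr ?nnegrE ?addr_ge0// mulr_ge0// invr_ge0 ltW.
  have := sqr_ge0 (al - be); rewrite -exprVn; nra.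
rewrite sqr_sqrtr ?(ltW MM0)// /al /be.
have -> : a / Mu * (b / Mv) = (a * b) / (Mu * Mv) by field; rewrite !gt_eqF.
by rewrite ler_pdivrMr// mulVf ?gt_eqF.
Qed.

End NormalDensity.

Section Tensorization.
Context {R : realType} {d : nat} {disp : measure_display}
  {T : measurableType disp} {P : probability T R} (G : 'I_d -> {RV P >-> R}).
Context (hG : std_gaussian G).
Local Notation gam := (normal_prob (0 : R) 1).
Implicit Types (v x y : 'cV[R]_d) (i j : 'I_d).

Definition upd i (a : R) v : 'cV[R]_d := \col_j (if j == i then a else v j 0).

Lemma upd_same i a v : upd i a v i 0 = a.
Proof. by rewrite mxE eqxx. Qed.

Lemma upd_other i j a v : j != i -> upd i a v j 0 = v j 0.
Proof. by move=> ji; rewrite mxE (negbTE ji). Qed.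

Lemma measurable_RV i : measurable_fun [set: T] (G i).
Proof. exact: measurable_funP. Qed.

Lemma measurable_rvec (h : 'cV[R]_d -> R) : coord_measurable h ->
  measurable_fun [set: T] (fun w => h (rvec G w)).
Proof. by move=> mh; apply: mh; exact: measurable_RV. Qed.

Lemma measurable_upd i (h : 'cV[R]_d -> R) d' (T' : measurableType d')
    (Y : 'I_d -> T' -> R) :
  coord_measurable h -> (forall j, measurable_fun [set: T'] (Y j)) ->
  measurable_fun [set: T' * measurableTypeR R]
    (fun z => h (upd i z.2 (\col_j Y j z.1))).
Proof.
move=> mh mY.
have := mh _ (T' * measurableTypeR R)%type
  (fun j z => if j == i then z.2 else Y j z.1).
rewrite (_ : (fun w : T' * measurableTypeR R => h _)
  = (fun z => h (upd i z.2 (\col_j Y j z.1)))).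
  apply => j; case: (j == i); first exact: measurable_snd.
  by apply: measurableT_comp => //; exact: measurable_fst.
apply/funext => z; congr h; apply/matrixP => j k; rewrite !mxE.
by case: ifP.
Qed.

(** Replacing coordinate [i] by an independent normal variable leaves the probability of every box
    unchanged. This is how independence of the coordinates is exploited throughout. *)
Lemma resample i (h : 'cV[R]_d -> R) : coord_measurable h -> (forall v, 0 <= h v) ->
  (\int[P]_w (h (rvec G w))%:E =
   \int[P]_w \int[gam]_a (h (upd i a (rvec G w)))%:E)%E.
Proof.
move=> mh h0.
pose Y2 j (z : T * measurableTypeR R) : R := if j == i then z.2 else G j z.1.
have mY2 j : measurable_fun setT (Y2 j).
  rewrite /Y2; case: (j == i); first exact: measurable_snd.
  apply: (measurableT_comp (@measurable_RV j)); exact: measurable_fst.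
rewrite (@same_law_ge0_integral R d _ _ T (T * measurableTypeR R)%type P
  (P \x gam)%E (fun j => G j) Y2 measurable_RV mY2 _ _ h mh h0).
- have mf : measurable_fun setT (fun z : T * measurableTypeR R =>
     (h (\col_j Y2 j z))%:E).
    by apply/measurable_EFinP; exact: mh.
  rewrite (fubini_tonelli1
    (fun z : T * measurableTypeR R => (h (\col_j Y2 j z))%:E) mf)//.
    apply: eq_integral => w _; apply: eq_integral => a _.
    congr (h _)%:E; apply/matrixP => j k; rewrite !mxE /Y2/=.
    by case: ifP.
  by move=> z; rewrite lee_fin.
- by apply: le_lt_trans (ltry 1); exact: probability_le1.
move=> A mA; etransitivity; first exact: (hG mA).
(* The box with its constraint on coordinate [i] removed, which the new variable takes over. *)
pose A' j := if j == i then setT else A j.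
have mA' j : measurable (A' j) by rewrite /A'; case: ifP.
have mW : measurable [set w | forall j, A' j (G j w)].
  rewrite (_ : [set w | _] = \bigcap_(j in [set: 'I_d]) (G j @^-1` A' j)).
    apply: fin_bigcap_measurable => // j _.
    by rewrite -[X in measurable X]setTI; exact: measurable_RV.
  by apply/seteqP; split=> w /= H j => [_|]; exact: H.
rewrite (_ : [set w | _] = [set w | forall j, A' j (G j w)] `*` A i); last first.
  apply/seteqP; split=> [[w a]|[w a]] /= => [H|[H Ha] j].
    split; last by have := H i; rewrite /Y2 eqxx.
    move=> j; have := H j; rewrite /Y2 /A'; case: eqP => //.
  by rewrite /Y2; case: eqP => [->//|/eqP ji]; have := H j; rewrite /A' (negbTE ji).
rewrite [RHS]product_measure1E//; last exact: mA.
transitivity (\prod_(j < d) gam (A' j) * gam (A i))%E; last first.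
  by congr (_ * _)%E; apply/esym; exact: (hG mA').
rewrite (bigD1 i)//= [in RHS](bigD1 i)//=.
have -> : A' i = setT by rewrite /A' eqxx.
have -> : gam setT = 1%E by exact: probability_setT.
rewrite mul1e muleC; congr (_ * _)%E.
by apply: eq_bigr => j ji; rewrite /A' (negbTE ji).
Qed.

(** Integrates e^u over the coordinates in [s]; the logarithm brings the result back to the additive
    form in which [maurey_real] takes its hypothesis. *)
Fixpoint partial_lse (s : seq 'I_d) (u : 'cV[R]_d -> R) v : R :=
  if s is i :: s' then
    ln (fine (\int[gam]_a (expR (partial_lse s' u (upd i a v)))%:E)%E)
  else u v.

Lemma coord_measurable_upd i (h : 'cV[R]_d -> R) v : coord_measurable h ->
  measurable_fun [set: R] (fun a => h (upd i a v)).
Proof.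
move=> mh; have := mh _ R (fun j a => if j == i then a else v j 0).
by apply => j; case: (j == i).
Qed.

Lemma partial_lse_regular s u (K : R) : coord_measurable u -> (forall v, `|u v| <= K) ->
  coord_measurable (partial_lse s u) /\ (forall v, `|partial_lse s u v| <= K).
Proof.
move=> mu uK; elim: s => [//|i s [IHm IHb]] /=.
have Hv v := @expR_integral_bounded R _ (measurableTypeR R) gam
  (fun a => partial_lse s u (upd i a v)) K (coord_measurable_upd i v IHm)
  (fun a => IHb (upd i a v)).
split; last first.
  move=> v; have [a /andP[a1 a2] ->] := Hv v; rewrite /=.
  have a0 : 0 < a by apply: lt_le_trans a1; exact: expR_gt0.
  rewrite ler_norml; apply/andP; split.
    by rewrite -[leLHS]expRK ler_ln ?posrE ?expR_gt0.
  by rewrite -[leRHS]expRK ler_ln ?posrE ?expR_gt0.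
move=> d' T' Y mY.
apply: (measurableT_comp (@measurable_ln R)).
apply: (measurableT_comp (@fine_measurable R setT measurableT)).
have mf : measurable_fun setT (fun z : T' * measurableTypeR R =>
    (expR (partial_lse s u (upd i z.2 (\col_j Y j z.1))))%:E).
  apply/measurable_EFinP; apply: measurableT_comp => //.
  exact: measurable_upd.
exact: (@measurable_fun_fubini_tonelli_F _ _ T' (measurableTypeR R) R gam _ mf
  (fun z => expR_ge0 _)).
Qed.

Lemma partial_lse_integral s u (K : R) : coord_measurable u -> (forall v, `|u v| <= K) ->
  (\int[P]_w (expR (partial_lse s u (rvec G w)))%:E =
   \int[P]_w (expR (u (rvec G w)))%:E)%E.
Proof.
move=> mu uK; elim: s => [//|i s IH].
have [IHm IHb] := partial_lse_regular s mu uK.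
rewrite -IH [in RHS](resample i (h := fun v => expR (partial_lse s u v))); last 2 first.
- by apply: coord_measurable_comp.
- by move=> v; exact: expR_ge0.
apply: eq_integral => w _ /=.
have [a /andP[a1 _] ->] := @expR_integral_bounded R _ (measurableTypeR R) gam
  (fun a => partial_lse s u (upd i a (rvec G w))) K (coord_measurable_upd i _ IHm)
  (fun a => IHb _).
by rewrite /= lnK// posrE; apply: lt_le_trans a1; exact: expR_gt0.
Qed.

(** Each integrated coordinate removes its own term from the quadratic cost: with the others frozen,
    the induction hypothesis is an instance of the condition of [maurey_real]. *)
Lemma partial_lse_le s (u v : 'cV[R]_d -> R) (K : R) : coord_measurable u ->
  coord_measurable v ->
  (forall x, `|u x| <= K) -> (forall x, `|v x| <= K) ->
  (forall x y, u x + v y <= \sum_j (x j 0 - y j 0) ^+ 2 / 4) ->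
  forall x y, partial_lse s u x + partial_lse s v y <=
    \sum_(j | j \notin s) (x j 0 - y j 0) ^+ 2 / 4.
Proof.
move=> mu mv uK vK uv; elim: s => [|i s IH] x y; first exact: uv.
have [um ub] := partial_lse_regular s mu uK.
have [vm vb] := partial_lse_regular s mv vK.
(* The cost of the coordinates that stay frozen. It is subtracted from the [u] side and returns as
   the factor e^c. *)
set c := \sum_(j | j \notin i :: s) _.
have c0 : 0 <= c by apply: sumr_ge0 => j _; rewrite divr_ge0 ?sqr_ge0.
have K0 : 0 <= K by apply: le_trans (uK x); exact: normr_ge0.
have H a b : partial_lse s u (upd i a x) - c + partial_lse s v (upd i b y)
    <= (a - b) ^+ 2 / 4.
  rewrite addrAC lerBlDr; apply: le_trans (IH _ _) _.
  apply: (@le_trans _ _ (\sum_(j | (j \notin s) && (j != i)) (x j 0 - y j 0) ^+ 2 / 4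
     + (a - b) ^+ 2 / 4)); last first.
    rewrite addrC lerD2l /c le_eqVlt; apply/orP; left; apply/eqP.
    by apply: eq_bigl => j; rewrite inE negb_or andbC.
  rewrite (bigID (fun j => j != i))/=; apply: lerD.
    rewrite le_eqVlt; apply/orP; left; apply/eqP; apply: eq_bigr => j /andP[_ ji].
    by rewrite !upd_other.
  (* If [i] was integrated before, its term is already absent. *)
  have [iS|iS] := boolP (i \in s).
    rewrite big_pred0 ?divr_ge0 ?sqr_ge0// => j.
    by rewrite negbK; case: eqP => [->|]; rewrite ?iS ?andbF.
  rewrite (big_pred1 i) ?upd_same// => j; rewrite negbK /=.
  by case: eqP => [->|]; rewrite ?iS ?andbF.
have m1 : measurable_fun [set: R] (fun a => partial_lse s u (upd i a x) - c).
  by apply: measurable_funB => //; exact: coord_measurable_upd.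
have m2 := coord_measurable_upd i y vm.
have b1 a : `|partial_lse s u (upd i a x) - c| <= K + c.
  by apply: le_trans (ler_normB _ _) _; rewrite [`|c|]ger0_norm// lerD2r.
have b2 a : `|partial_lse s v (upd i a y)| <= K + c.
  by apply: le_trans (vb _) _; rewrite lerDl.
have := maurey_real m1 m2 b1 b2 H.
have [a /andP[a1 _] aE] := @expR_integral_bounded R _ (measurableTypeR R) gam _ K
  (coord_measurable_upd i x um) (fun a => ub (upd i a x)).
have [b /andP[b1' _] bE] := @expR_integral_bounded R _ (measurableTypeR R) gam _ K
  (coord_measurable_upd i y vm) (fun a => vb (upd i a y)).
have a0 : 0 < a by apply: lt_le_trans a1; exact: expR_gt0.
have b0 : 0 < b by apply: lt_le_trans b1'; exact: expR_gt0.
rewrite bE.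
under eq_integral do rewrite expRD mulrC EFinM.
rewrite ge0_integralZl//; last first.
  by apply/measurable_EFinP; apply: measurableT_comp => //; exact: coord_measurable_upd.
rewrite aE -!EFinM lee_fin /= aE bE /= => Hab.
rewrite -lnM ?posrE// -[leRHS]expRK ler_ln ?posrE ?mulr_gt0 ?expR_gt0//.
by rewrite expRN -mulrA ler_pdivrMl ?expR_gt0// mulr1 in Hab.
Qed.

(* Maurey's property (tau): a dimension-free form of concentration that only
   sees metric (not differential) properties of [u]. *)
Lemma maurey_gaussian (u v : 'cV[R]_d -> R) (K : R) : coord_measurable u ->
  coord_measurable v ->
  (forall x, `|u x| <= K) -> (forall x, `|v x| <= K) ->
  (forall x y, u x + v y <= dotv (x - y) (x - y) / 4) ->
  (\int[P]_w (expR (u (rvec G w)))%:E * \int[P]_w (expR (v (rvec G w)))%:E <= 1)%E.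
Proof.
move=> mu mv uK vK uv.
have uv' x y : u x + v y <= \sum_j (x j 0 - y j 0) ^+ 2 / 4.
  apply: le_trans (uv x y) _; rewrite dotvE mulr_suml le_eqVlt; apply/orP; left.
  by apply/eqP; apply: eq_bigr => j _; rewrite !mxE expr2.
have s0 x y := partial_lse_le (enum 'I_d) mu mv uK vK uv' x y.
rewrite -(partial_lse_integral (enum 'I_d) mu uK).
rewrite -(partial_lse_integral (enum 'I_d) mv vK).
have [um ub] := partial_lse_regular (enum 'I_d) mu uK.
have [vm vb] := partial_lse_regular (enum 'I_d) mv vK.
have {}s0 x y : partial_lse (enum 'I_d) u x + partial_lse (enum 'I_d) v y <= 0.
  apply: le_trans (s0 x y) _; rewrite big_pred0// => j.
  by rewrite mem_enum.
have [a /andP[a1 _] aE] := @expR_integral_bounded R _ T P _ K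
  (measurable_rvec um) (fun w => ub (rvec G w)).
have [b /andP[b1 _] bE] := @expR_integral_bounded R _ T P _ K
  (measurable_rvec vm) (fun w => vb (rvec G w)).
have a0 : 0 < a by apply: lt_le_trans a1; exact: expR_gt0.
have b0 : 0 < b by apply: lt_le_trans b1; exact: expR_gt0.
have cst_le (f : T -> R) (c : R) : measurable_fun [set: T] f ->
  (forall w, expR (f w) <= c) ->
    (\int[P]_w (expR (f w))%:E <= c%:E)%E.
  move=> mf fc; rewrite -[leRHS]mule1 -(probability_setT P) -integral_cst//.
  apply: ge0_le_integral => [//|w _||//|w _]; last by rewrite lee_fin.
    by rewrite lee_fin expR_ge0.
  by apply/measurable_EFinP; exact: measurableT_comp.
(* No cost is left: average over the first argument with [y] fixed, then over [y]. *)
have Ha y : expR (partial_lse (enum 'I_d) v y) <= a^-1.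
  rewrite -[leLHS]invrK lef_pV2 ?posrE ?invr_gt0 ?expR_gt0//.
  rewrite -lee_fin -aE; apply: cst_le; first exact: measurable_rvec.
  by move=> w; rewrite -expRN ler_expR -subr_le0 opprK.
rewrite aE bE -EFinM lee_fin -ler_pdivlMl// mulr1 -lee_fin -bE.
by apply: cst_le; first exact: measurable_rvec.
Qed.

End Tensorization.

(** * A Gaussian Poincare inequality *)

Section ExpInequalities.
Context {R : realType}.

Lemma expR_ge_quad (x : R) : 0 <= x -> 1 + x + x ^+ 2 / 2 <= expR x.
Proof.
move=> x0.
have <- : series (exp_coeff x) 3 = 1 + x + x ^+ 2 / 2.
  rewrite /series /= !big_nat_recr//= big_geq// add0r /exp_coeff /=.
  by rewrite expr0 expr1 !divr1.
apply: nondecreasing_cvgn_le; last exact: is_cvg_series_exp_coeff.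
by apply: nondecreasing_series => n _ _; exact: exp_coeff_ge0.
Qed.

(** With p = 1 + x + x^2/2 <= e^x, it suffices that 1/p <= p - 2 x, and (p - 2 x) p = 1 + x^4/4. *)
Lemma expR_sinh_ge (x : R) : 0 <= x -> 2 * x <= expR x - expR (- x).
Proof.
move=> x0; have q := expR_ge_quad x0.
set p := 1 + x + x ^+ 2 / 2 in q.
have p0 : 0 < p by rewrite /p -addrA ltr_pwDl// addr_ge0// divr_ge0// sqr_ge0.
have : expR (- x) <= p^-1 by rewrite expRN lef_pV2// posrE ?expR_gt0.
have : p^-1 <= p - 2 * x.
  rewrite -[leLHS]mul1r ler_pdivrMr//.
  have -> : (p - 2 * x) * p = 1 + (x ^+ 2 / 2) ^+ 2 by rewrite /p; field.
  by rewrite lerDl sqr_ge0.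
lra.
Qed.

(** The excess over 2 is the square of e^(x/2) - e^(-x/2). *)
Lemma expR_cosh_ge (x : R) : 2 + x ^+ 2 <= expR x + expR (- x).
Proof.
wlog x0 : x / 0 <= x.
  move=> H; have [|/ltW] := leP 0 x; first exact: H.
  by rewrite -oppr_ge0 => /H; rewrite opprK sqrrN addrC [X in _ <= X]addrC addrC.
have := @expR_sinh_ge (x / 2) (divr_ge0 x0 (ler0n _ 2)).
rewrite mulrC divfK// => H.
have : x ^+ 2 <= (expR (x / 2) - expR (- (x / 2))) ^+ 2.
  by rewrite ler_sqr ?nnegrE// (le_trans x0).
rewrite sqrrB -!expRM_natl -expRD subrr expR0.
have -> : 2%:R * (x / 2) = x by field.
have -> : 2%:R * (- (x / 2)) = - x by field.
lra.
Qed.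

End ExpInequalities.

Section BoundedExpectation.
Context {R : realType} {disp : measure_display}
  {T : measurableType disp} (P : probability T R).

Definition bounded_rv (f : T -> R) : Prop :=
  measurable_fun [set: T] f /\ exists K, forall w, `|f w| <= K.

Local Notation EE f := (Rintegral P setT f).

Lemma bounded_rv_integrable f : bounded_rv f -> P.-integrable [set: T] (EFin \o f).
Proof.
move=> [mf [K fK]]; apply: measurable_bounded_integrable => //.
  by apply: le_lt_trans (ltry 1); exact: probability_le1.
exists K; split; first exact: num_real.
by move=> M KM w _ /=; exact: le_trans (fK w) (ltW KM).
Qed.

Lemma bounded_rv_EFin f : bounded_rv f -> (\int[P]_w (f w)%:E = (EE f)%:E)%E.
Proof.
move=> bf; rewrite /Rintegral fineK//.
by apply: integrable_fin_num => //; exact: bounded_rv_integrable.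
Qed.

Lemma bounded_rv_cst c : bounded_rv (fun=> c).
Proof. by split; [exact: measurable_cst|exists `|c|]. Qed.

Lemma bounded_rvD f g : bounded_rv f -> bounded_rv g -> bounded_rv (fun w => f w + g w).
Proof.
move=> [mf [K fK]] [mg [L gL]]; split; first exact: measurable_funD.
by exists (K + L) => w; apply: le_trans (ler_normD _ _) _; exact: lerD.
Qed.

Lemma bounded_rvM f g : bounded_rv f -> bounded_rv g -> bounded_rv (fun w => f w * g w).
Proof.
move=> [mf [K fK]] [mg [L gL]]; split; first exact: measurable_funM.
by exists (K * L) => w; rewrite normrM ler_pM.
Qed.

Lemma bounded_rvZ c f : bounded_rv f -> bounded_rv (fun w => c * f w).
Proof. by apply: bounded_rvM; exact: bounded_rv_cst. Qed.

Lemma bounded_rv_expR f : bounded_rv f -> bounded_rv (fun w => expR (f w)).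
Proof.
move=> [mf [K fK]]; split; first exact: measurableT_comp.
exists (expR K) => w; rewrite ger0_norm ?expR_ge0// ler_expR.
exact: le_trans (ler_norm _) (fK w).
Qed.

Lemma ERD f g : bounded_rv f -> bounded_rv g ->
  EE (fun w => f w + g w) = EE f + EE g.
Proof. by move=> bf bg; apply: RintegralD => //; exact: bounded_rv_integrable. Qed.

Lemma ERZ c f : bounded_rv f -> EE (fun w => c * f w) = c * EE f.
Proof. by move=> bf; apply: RintegralZl => //; exact: bounded_rv_integrable. Qed.

Lemma ERcst c : EE (fun=> c) = c.
Proof.
rewrite Rintegral_cst// -[RHS]mulr1; congr (_ * _).
by rewrite -[RHS]/(fine 1%E); congr fine; exact: probability_setT.
Qed.

Lemma ER_le f g : bounded_rv f -> bounded_rv g -> (forall w, f w <= g w) ->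
  EE f <= EE g.
Proof. by move=> bf bg fg; apply: le_Rintegral => //; exact: bounded_rv_integrable. Qed.

(* With [A = E e^(f - E f)] and [B = E e^(E f - f)], both at least [1],
   [A B >= A + B - 1] and [A + B >= 2 + Var f]. *)
Lemma variance_le_expR f : bounded_rv f ->
  1 + (EE (fun w => f w * f w) - EE f ^+ 2) <=
  EE (fun w => expR (f w)) * EE (fun w => expR (- f w)).
Proof.
move=> bf; set m := EE f.
have bN : bounded_rv (fun w => - f w).
  have := bounded_rvZ (-1) bf; congr bounded_rv.
  by apply/funext => w; rewrite mulN1r.
pose g w := f w + - m.
have bg : bounded_rv g by apply: bounded_rvD => //; exact: bounded_rv_cst.
pose A := EE (fun w => expR (g w)).
pose B := EE (fun w => expR (- g w)).
have bgN : bounded_rv (fun w => - g w).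
  have := bounded_rvZ (-1) bg; congr bounded_rv.
  by apply/funext => w; rewrite mulN1r.
have bA : bounded_rv (fun w => expR (g w)) by exact: bounded_rv_expR.
have bB : bounded_rv (fun w => expR (- g w)) by exact: bounded_rv_expR.
have bgg : bounded_rv (fun w => g w * g w) by exact: bounded_rvM.
have AB : EE (fun w => expR (f w)) * EE (fun w => expR (- f w)) = A * B.
  have -> : A = expR (- m) * EE (fun w => expR (f w)).
    rewrite -ERZ; last exact: bounded_rv_expR.
    by apply: eq_Rintegral => w _; rewrite -expRD addrC.
  have -> : B = expR m * EE (fun w => expR (- f w)).
    rewrite -ERZ; last exact: bounded_rv_expR.
    by apply: eq_Rintegral => w _; rewrite -expRD /g opprD opprK addrC.
  have := expRxMexpNx_1 m; set a := expR m; set b := expR (- m) => ab.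
  by rewrite -[LHS]mul1r -ab; ring.
have Eg : EE g = 0 by rewrite ERD ?ERcst ?subrr//; exact: bounded_rv_cst.
have Egg : EE (fun w => g w * g w) = EE (fun w => f w * f w) - m ^+ 2.
  have bff : bounded_rv (fun w => f w * f w) by exact: bounded_rvM.
  have bc : bounded_rv (fun w => - (2 * m) * f w + m ^+ 2).
    by apply: bounded_rvD; [exact: bounded_rvZ|exact: bounded_rv_cst].
  transitivity (EE (fun w => f w * f w + (- (2 * m) * f w + m ^+ 2))).
    by apply: eq_Rintegral => w _; rewrite /g; ring.
  rewrite ERD// ERD; [|exact: bounded_rvZ|exact: bounded_rv_cst].
  by rewrite ERZ// ERcst -/m; ring.
have A1 : 1 <= A.
  rewrite -(ERcst 1) -[X in X <= _]addr0 -{1}Eg -ERD//; last exact: bounded_rv_cst.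
  apply: ER_le => //; first by apply: bounded_rvD => //; exact: bounded_rv_cst.
  by move=> w; exact: expR_ge1Dx.
have B1 : 1 <= B.
  have EgN : EE (fun w => - g w) = 0.
    transitivity (EE (fun w => -1 * g w)); last by rewrite ERZ// Eg mulr0.
    by apply: eq_Rintegral => w _; rewrite mulN1r.
  rewrite -(ERcst 1) -[X in X <= _]addr0 -{1}EgN -ERD//; last exact: bounded_rv_cst.
  apply: ER_le => //; first by apply: bounded_rvD => //; exact: bounded_rv_cst.
  by move=> w; exact: expR_ge1Dx.
have ABs : 2 + EE (fun w => g w * g w) <= A + B.
  rewrite -(ERcst 2) -!ERD//; last exact: bounded_rv_cst.
  apply: ER_le; [|exact: bounded_rvD|].
    by apply: bounded_rvD => //; exact: bounded_rv_cst.
  by move=> w; rewrite -expr2; exact: expR_cosh_ge.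
rewrite AB -Egg; have : 0 <= (A - 1) * (B - 1) by rewrite mulr_ge0 ?subr_ge0.
lra.
Qed.

End BoundedExpectation.

Section Poincare.
Context {R : realType} {d : nat} {disp : measure_display}
  {T : measurableType disp} {P : probability T R} (G : 'I_d -> {RV P >-> R}).
Context (hG : std_gaussian G) (h delta : 'cV[R]_d -> R) (B L0 L1 C s : R)
  (h_ge0 : forall x, 0 <= h x) (h_le : forall x, h x <= B)
  (L0_ge0 : 0 <= L0) (L01 : L0 <= L1) (C0 : 0 <= C)
  (h_lip : forall x y, `|h x - h y| <= L1 * norm2 (x - y))
  (delta_lip : forall x y, delta x <= delta y + C * norm2 (x - y))
  (h_loc : forall x y, delta x < s -> delta y < s ->
    `|h x - h y| <= L0 * norm2 (x - y)).
Local Notation EE f := (Rintegral P setT f).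
Implicit Types (x y z : 'cV[R]_d) (w : T).

Let L1_ge0 : 0 <= L1. Proof. exact: le_trans L01. Qed.
Let B_ge0 : 0 <= B. Proof. exact: le_trans (h_ge0 0) (h_le 0). Qed.

Lemma delta_measurable : coord_measurable delta.
Proof.
apply: (@lipschitz_coord_measurable _ _ _ C) => // x y.
have := delta_lip x y; have := delta_lip y x.
by rewrite -[norm2 (y - x)]norm2N opprB ler_norml => ? ?; apply/andP; split; lra.
Qed.

Let h_measurable : coord_measurable h.
Proof. exact: (@lipschitz_coord_measurable _ _ _ L1). Qed.

Lemma delta_lt_measurable t : measurable [set w | delta (rvec G w) < t].
Proof.
have := measurable_rvec G delta_measurable.
move=> /(_ measurableT `]-oo, t[%classic (measurable_itv _)); rewrite setTI.
rewrite (_ : [set w | _] = (fun w => delta (rvec G w)) @^-1` `]-oo, t[%classic)//.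
Qed.

Let hG_bounded : bounded_rv (fun w => h (rvec G w)).
Proof.
split; first exact: measurable_rvec.
by exists B => w; rewrite ger0_norm.
Qed.

Section Scale.
Context (e : R) (e0 : 0 < e).

(** Squared local Lipschitz constant. The margin keeps x - z in the region delta < s for every
    displacement |z| <= 4 e L1, and longer ones are too costly to matter. *)
Let ell x : R := if delta x < s - 4 * C * L1 * e then L0 ^+ 2 else L1 ^+ 2.

(** The largest [u] admissible in [maurey_gaussian] against - e h (the Hopf-Lax formula). *)
Definition inf_conv x : R :=
  inf [set dotv z z / 4 + e * h (x - z) | z in [set: 'cV[R]_d]].

Let inf_conv_has_inf x :
  has_inf [set dotv z z / 4 + e * h (x - z) | z in [set: 'cV[R]_d]].
Proof.
split; first by exists (dotv (0 : 'cV[R]_d) 0 / 4 + e * h (x - 0)), 0.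
exists 0 => _ [z _ <-]; rewrite addr_ge0 ?divr_ge0 ?dotvv_ge0//.
by rewrite mulr_ge0// ltW.
Qed.

Lemma inf_conv_le x z : inf_conv x <= dotv z z / 4 + e * h (x - z).
Proof. by apply: ge_inf; [exact: (inf_conv_has_inf x).2|exists z]. Qed.

Lemma le_inf_conv x c : (forall z, c <= dotv z z / 4 + e * h (x - z)) -> c <= inf_conv x.
Proof.
move=> H; apply: lb_le_inf; first exact: (inf_conv_has_inf x).1.
by move=> _ [z _ <-].
Qed.

Lemma inf_conv_bounded x : 0 <= inf_conv x <= e * B.
Proof.
apply/andP; split.
  apply: le_inf_conv => z; rewrite addr_ge0 ?divr_ge0 ?dotvv_ge0//.
  by rewrite mulr_ge0// ltW.
apply: le_trans (inf_conv_le x 0) _.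
by rewrite dotv0l mul0r add0r subr0 ler_pM2l.
Qed.

Lemma inf_conv_lipschitz x y : `|inf_conv x - inf_conv y| <= e * L1 * norm2 (x - y).
Proof.
have H a b : inf_conv a - inf_conv b <= e * L1 * norm2 (a - b).
  rewrite lerBlDr addrC -lerBlDr; apply: le_inf_conv => z.
  rewrite lerBlDr; apply: le_trans (inf_conv_le a z) _.
  rewrite -addrA lerD2l -mulrA -mulrDr ler_pM2l//.
  have := le_trans (ler_norm _) (h_lip (a - z) (b - z)).
  by rewrite opprB addrA subrK; lra.
rewrite ler_norml H andbT.
by have := H y x; rewrite -[norm2 (y - x)]norm2N opprB; lra.
Qed.

(** For a decrease of [h] at rate L, completing the square in t^2/4 - e L t gives - e^2 L^2. Deep
    inside the region and for t <= 4 e L1 the rate is L0; for larger t the cost t^2/4 already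
    exceeds e L1 t, so nothing is lost. *)
Lemma inf_conv_lower x : e * h x - e ^+ 2 * ell x <= inf_conv x.
Proof.
apply: le_inf_conv => z; set t := norm2 z.
have t0 : 0 <= t by exact: norm2_ge0.
have zE : dotv z z = t ^+ 2 by rewrite /t norm2_sqr.
have key L : h x - L * t <= h (x - z) ->
    e * h x - e ^+ 2 * L ^+ 2 <= t ^+ 2 / 4 + e * h (x - z).
  move=> H; have H2 : e * (h x - L * t) <= e * h (x - z) by rewrite ler_pM2l.
  by have := sqr_ge0 (t / 2 - e * L); lra.
have Hlip L : `|h x - h (x - z)| <= L * norm2 (x - (x - z)) -> h x - L * t <= h (x - z).
  rewrite subKr => /(le_trans (ler_norm _)); rewrite -/t; lra.
rewrite zE /ell; case: ifPn => [dx|_]; last first.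
  by apply: key; apply: Hlip; exact: h_lip.
have [tle|tgt] := leP t (4 * e * L1).
  apply: key; apply: Hlip; apply: h_loc.
    apply: lt_le_trans dx _; rewrite gerBl.
    by rewrite !mulr_ge0// ltW.
  apply: le_lt_trans (delta_lip _ x) _.
  rewrite addrAC subrr add0r norm2N -/t.
  rewrite -ltrBrDr; apply: lt_le_trans dx _; rewrite lerD2l lerN2.
  apply: le_trans (ler_wpM2l C0 tle) _; rewrite le_eqVlt; apply/orP; left.
  by apply/eqP; ring.
have H := Hlip _ (h_lip x (x - z)).
have H2 : e * (h x - L1 * t) <= e * h (x - z) by rewrite ler_pM2l.
have H3 : 0 <= t * (t - 4 * e * L1) by rewrite mulr_ge0// subr_ge0 ltW.
have H4 : 0 <= e ^+ 2 * L0 ^+ 2 by rewrite mulr_ge0 ?sqr_ge0.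
lra.
Qed.

Let q := fine (P [set w | delta (rvec G w) < s - 4 * C * L1 * e]).

Let ell_bounded : bounded_rv (fun w => ell (rvec G w)) /\
  EE (fun w => ell (rvec G w)) = L1 ^+ 2 - (L1 ^+ 2 - L0 ^+ 2) * q.
Proof.
set A := [set w | delta (rvec G w) < s - 4 * C * L1 * e].
have mA : measurable A by exact: delta_lt_measurable.
have bI : bounded_rv (fun w => \1_A w : R).
  split; first exact: measurable_indic.
  by exists 1 => w; rewrite indicE; case: (_ \in _); rewrite ?normr1 ?normr0 ?ler01.
have E : (fun w => ell (rvec G w)) =
    (fun w => L1 ^+ 2 + (- (L1 ^+ 2 - L0 ^+ 2)) * \1_A w).
  apply/funext => w; rewrite indicE /ell /A; case: ifPn => H.
    by rewrite mem_set//= mulr1; ring.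
  by rewrite memNset/= ?mulr0 ?addr0//; exact/negP.
rewrite E; split.
  by apply: bounded_rvD; [exact: bounded_rv_cst|exact: bounded_rvZ].
rewrite ERD; [|exact: bounded_rv_cst|exact: bounded_rvZ].
rewrite ERcst ERZ// mulNr; congr (_ - _ * _).
by rewrite /q -/A /Rintegral integral_indic// setIT.
Qed.

(** Since u >= e h - e^2 ell, E e^u is at least E e^(e h) minus e^2 e^(e B) E ell. Multiply by E
    e^(- e h) <= 1, use Maurey's bound on the left and [variance_le_expR] on E e^(e h) E e^(- e h),
    and divide by e^2. *)
Lemma variance_scale :
  EE (fun w => h (rvec G w) * h (rvec G w)) - EE (fun w => h (rvec G w)) ^+ 2 <=
  expR (e * B) * (L1 ^+ 2 - (L1 ^+ 2 - L0 ^+ 2) * q).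
Proof.
pose f w := e * h (rvec G w).
have bf : bounded_rv f by exact: bounded_rvZ.
have bfN : bounded_rv (fun w => - f w).
  have := bounded_rvZ (-1) bf; congr bounded_rv.
  by apply/funext => w; rewrite mulN1r.
pose u := inf_conv; pose v x := - (e * h x).
have mu_ : coord_measurable u.
  apply: (@lipschitz_coord_measurable _ _ _ (e * L1)); last exact: inf_conv_lipschitz.
  by rewrite mulr_ge0// ltW.
have mv : coord_measurable v.
  apply: (@lipschitz_coord_measurable _ _ _ (e * L1)) => [|x y].
    by rewrite mulr_ge0// ltW.
  rewrite /v opprK addrC -mulrBr normrM gtr0_norm// -mulrA ler_pM2l//.
  by rewrite distrC.
have uK x : `|u x| <= e * B.
  by have /andP[u0 u1] := inf_conv_bounded x; rewrite ger0_norm.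
have vK x : `|v x| <= e * B.
  by rewrite normrN ger0_norm ?ler_pM2l// mulr_ge0// ltW.
have uv x y : u x + v y <= dotv (x - y) (x - y) / 4.
  have := inf_conv_le x (x - y).
  by rewrite /u /v subKr; lra.
have := maurey_gaussian hG mu_ mv uK vK uv.
have bu : bounded_rv (fun w => u (rvec G w)).
  by split; [exact: measurable_rvec|exists (e * B) => w].
have beu := bounded_rv_expR bu.
have bev := bounded_rv_expR bfN.
rewrite !bounded_rv_EFin// -EFinM lee_fin.
set a := EE _; set b := EE _ => ab.
have [bl El] := ell_bounded.
have bef := bounded_rv_expR bf.
set A := EE (fun w => expR (f w)).
have aA : A - e ^+ 2 * expR (e * B) * EE (fun w => ell (rvec G w)) <= a.
  rewrite -mulNr -ERZ// -ERD//; last exact: bounded_rvZ.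
  apply: ER_le => //; first by apply: bounded_rvD => //; exact: bounded_rvZ.
  move=> w; set x := rvec G w.
  apply: (@le_trans _ _ (expR (e * h x - e ^+ 2 * ell x))); last first.
    by rewrite ler_expR inf_conv_lower.
  rewrite expRD /f -/x.
  have el0 : 0 <= e ^+ 2 * ell x.
    by rewrite mulr_ge0 ?sqr_ge0// /ell; case: ifP => _; exact: sqr_ge0.
  have H1 : 1 - e ^+ 2 * ell x <= expR (- (e ^+ 2 * ell x)) by exact: expR_ge1Dx.
  have H2 : expR (e * h x) <= expR (e * B) by rewrite ler_expR ler_pM2l.
  apply: (@le_trans _ _ (expR (e * h x) * (1 - e ^+ 2 * ell x))); last first.
    by rewrite ler_pM2l ?expR_gt0.
  by have := ler_wpM2r el0 H2; lra.
have b1 : b <= 1.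
  rewrite -(ERcst P 1); apply: ER_le => //; first exact: bounded_rv_cst.
  by move=> w; rewrite expR_le1 oppr_le0 mulr_ge0// ltW.
have b0 : 0 <= b by apply: Rintegral_ge0 => w _; exact: expR_ge0.
have l0 : 0 <= EE (fun w => ell (rvec G w)).
  by apply: Rintegral_ge0 => w _; rewrite /ell; case: ifP => _; exact: sqr_ge0.
have := variance_le_expR P bf; rewrite -/A -[EE (fun w => expR (- f w))]/b.
have -> : EE (fun w => f w * f w) = e ^+ 2 * EE (fun w => h (rvec G w) * h (rvec G w)).
  rewrite -ERZ; last exact: bounded_rvM.
  by apply: eq_Rintegral => w _; rewrite /f; ring.
have -> : EE f = e * EE (fun w => h (rvec G w)) by rewrite -ERZ.
set m2 := EE _; set m1 := EE _ => Hvar.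
rewrite -El; set l := EE (fun w => ell (rvec G w)) in aA l0 *.
have e20 : 0 < e ^+ 2 by rewrite exprn_gt0.
rewrite -(ler_pM2l e20).
have K0 : 0 <= e ^+ 2 * expR (e * B) * l by apply: mulr_ge0 => //; apply: mulr_ge0;
  [exact: ltW|exact: expR_ge0].
have H3 : A * b <= a * b + e ^+ 2 * expR (e * B) * l * b.
  by rewrite -mulrDl ler_wpM2r//; lra.
have H4 : e ^+ 2 * expR (e * B) * l * b <= e ^+ 2 * expR (e * B) * l.
  by rewrite ler_piMr.
have E : e ^+ 2 * m2 - (e * m1) ^+ 2 = e ^+ 2 * (m2 - m1 ^+ 2) by ring.
rewrite E in Hvar; rewrite mulrA.
move: (e ^+ 2 * (m2 - _)) (e ^+ 2 * _ * l) (e ^+ 2 * _ * l * b)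
  (A * b) (a * b) Hvar H3 H4 ab.
move=> X1 X2 X3 X4 X5; lra.
Qed.

End Scale.

(* [variance_scale] is [maurey_gaussian] for [inf_conv e] and [- e * h], expanded
   to second order; let [e] tend to [0]. *)
Lemma gaussian_poincare_local (t : R) :
  t = fine (P [set w | s <= delta (rvec G w)]) ->
  EE (fun w => h (rvec G w) * h (rvec G w)) - EE (fun w => h (rvec G w)) ^+ 2 <=
  L0 ^+ 2 * (1 - t) + L1 ^+ 2 * t.
Proof.
move=> tE.
pose e n : R := n.+1%:R^-1.
have e0 n : 0 < e n by rewrite invr_gt0.
pose F n := [set w | delta (rvec G w) < s - 4 * C * L1 * e n].
have mF n : measurable (F n) by exact: delta_lt_measurable.
(* The shrunken regions exhaust delta < s, so their probabilities increase to 1 - t. *)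
have FU : \bigcup_n F n = [set w | delta (rvec G w) < s].
  apply/seteqP; split=> [w [n _] /= H|w /= H].
    by apply: lt_le_trans H _; rewrite gerBl !mulr_ge0// ltW.
  pose g := s - delta (rvec G w); have g0 : 0 < g by rewrite subr_gt0.
  pose c := 4 * C * L1 + 1.
  have c0 : 0 < c by rewrite ltr_wpDl// !mulr_ge0.
  have [n Hn] := ltr_add_invr (divr_gt0 g0 c0).
  exists n => //; rewrite /F /= ltrBrDr -ltrBrDl -/g.
  rewrite add0r ltr_pdivlMr// mulrC -/(e n) in Hn.
  apply: le_lt_trans Hn; rewrite ler_pM2r// /c lerDl; exact: ler01.
have cq : fine (P (F n)) @[n --> \oo] --> 1 - t.
  have mU : measurable [set w | delta (rvec G w) < s] by exact: delta_lt_measurable.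
  have -> : 1 - t = fine (P (\bigcup_n F n)).
    rewrite FU tE.
    have -> : [set w | s <= delta (rvec G w)] = ~` [set w | delta (rvec G w) < s].
      by apply/seteqP; split=> w /=; rewrite leNgt => /negP.
    rewrite probability_setC// fineB ?fin_num_measure//=; lra.
  apply: fine_cvg; rewrite fineK; last by rewrite fin_num_measure// FU.
  apply: nondecreasing_cvg_mu => //; first by rewrite FU.
  apply/nondecreasing_seqP => n; apply/subsetPset => w /= H.
  apply: lt_le_trans H _; rewrite lerD2l lerN2 ler_wpM2l ?mulr_ge0//.
  by rewrite lef_pV2 ?posrE// ler_nat.
have ce : e n @[n --> \oo] --> (0 : R) by exact: cvg_harmonic.
have cexp : expR (e n * B) @[n --> \oo] --> expR (0 * B).
  apply: continuous_cvg; first exact: continuous_expR.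
  exact: (cvgM ce (cvg_cst B)).
have cl : expR (e n * B) * (L1 ^+ 2 - (L1 ^+ 2 - L0 ^+ 2) * fine (P (F n)))
    @[n --> \oo] --> expR (0 * B) * (L1 ^+ 2 - (L1 ^+ 2 - L0 ^+ 2) * (1 - t)).
  exact: (cvgM cexp (cvgB (cvg_cst (L1 ^+ 2)) (cvgM (cvg_cst (L1 ^+ 2 - L0 ^+ 2)) cq))).
have -> : L0 ^+ 2 * (1 - t) + L1 ^+ 2 * t =
  expR (0 * B) * (L1 ^+ 2 - (L1 ^+ 2 - L0 ^+ 2) * (1 - t)).
  by rewrite mul0r expR0; ring.
rewrite -(cvg_lim _ cl)//; apply: limr_ge; first by apply/cvg_ex; eexists; exact: cl.
by near=> n; exact: variance_scale.
Unshelve. all: by end_near. Qed.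

End Poincare.

(** * Moments of Gaussian quadratic forms *)

Section SteinIdentity.
Context {R : realType}.
Notation mu := (@lebesgue_measure R).
Local Notation gam := (normal_prob (0 : R) 1).
Local Notation phi := (normal_pdf (0 : R) 1).
Implicit Types (p q : {poly R}) (x : R).

(** Horner induction: half of the exponent goes to the shorter polynomial, the other half absorbs
    the new factor x through |x| <= 1 + x^2. *)
Lemma poly_expR_bound q (e : R) : 0 < e ->
  exists2 C : R, 0 <= C & forall x, `|q.[x]| <= C * expR (e * x ^+ 2).
Proof.
elim/poly_ind: q e => [|q c IH] e e0.
  by exists 0 => // x; rewrite horner0 normr0 mul0r.
have e20 : 0 < e / 2 by rewrite divr_gt0.
have [C C0 HC] := IH _ e20.
exists (C * (1 + 2 / e) + `|c|) => [|x].
  have e2 : 0 <= 2 / e by rewrite divr_ge0// ltW.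
  by rewrite addr_ge0// mulr_ge0// addr_ge0.
have E : expR (e * x ^+ 2) = expR (e / 2 * x ^+ 2) * expR (e / 2 * x ^+ 2).
  by rewrite -expRD; congr expR; field.
rewrite hornerD hornerM hornerX hornerC.
apply: le_trans (ler_normD _ _) _; rewrite mulrDl lerD//; last first.
  rewrite ler_peMr// -expR0 ler_expR mulr_ge0 ?sqr_ge0//; exact: ltW.
rewrite normrM E mulrACA; apply: ler_pM => //.
have x2 : `|x| <= 1 + x ^+ 2.
  rewrite -real_normK ?num_real//; have := sqr_ge0 (`|x| - 2^-1); lra.
apply: (@le_trans _ _ ((1 + 2 / e) * (1 + e / 2 * x ^+ 2))).
  apply: le_trans x2 _.
  have -> : (1 + 2 / e) * (1 + e / 2 * x ^+ 2) =
    (1 + x ^+ 2) + (2 / e + e / 2 * x ^+ 2) by field; rewrite gt_eqF.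
  have := mulr_ge0 (ltW e20) (sqr_ge0 x).
  by have := ltW (divr_gt0 (ltr0n R 2) e0); rewrite lerDl; exact: addr_ge0.
have e2 : 0 <= 2 / e by rewrite divr_ge0// ltW.
rewrite ler_pM2l; last exact: ltr_wpDr.
exact: expR_ge1Dx.
Qed.

(** An unnormalised normal density of variance 2; it dominates every polynomial times the standard
    density, up to a constant. *)
Lemma integrable_expR_sqr : mu.-integrable [set: R] (fun x => (expR (- (x ^+ 2 / 4)))%:E).
Proof.
pose s : R := Num.sqrt 2.
have s0 : s != 0 by rewrite gt_eqF// sqrtr_gt0.
have := @integrable_normal_pdf R 0 s.
have pk : normal_peak s != 0 by rewrite gt_eqF// normal_peak_gt0.
move=> /(integrableZl measurableT (normal_peak s)^-1); apply: eq_integrable => // x _.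
rewrite normal_pdfE// /normal_fun subr0 sqr_sqrtr// -EFinM mulrA mulVf// mul1r.
by congr (expR _)%:E; field.
Qed.

Lemma measurable_poly q : measurable_fun [set: R] (fun x => q.[x]).
Proof.
apply: continuous_measurable_fun => x.
apply: differentiable_continuous; apply/derivable1_diffP.
exact: derivable_horner.
Qed.

Lemma poly_normal_bound q : exists2 C : R, 0 <= C &
  forall x, `|q.[x] * phi x| <= C * expR (- (x ^+ 2 / 4)).
Proof.
have [C C0 HC] := @poly_expR_bound q 4^-1 ltac:(by rewrite invr_gt0).
exists (C * normal_peak 1) => [|x]; first by rewrite mulr_ge0 ?normal_peak_ge0.
rewrite normrM (ger0_norm (normal_pdf_ge0 _ _ _)) normal_pdf01E.
rewrite mulrCA [X in _ <= X]mulrAC [X in _ <= X]mulrC.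
rewrite ler_pM2l ?normal_peak1_gt0//.
apply: le_trans (ler_wpM2r (expR_ge0 _) (HC x)) _.
rewrite -mulrA ler_wpM2l// -expRD ler_expR; lra.
Qed.

Lemma integrable_poly_normal q :
  mu.-integrable [set: R] (fun x => (q.[x] * phi x)%:E).
Proof.
have [C C0 HC] := poly_normal_bound q.
apply: (le_integrable measurableT _ _ (integrableZl measurableT C integrable_expR_sqr)).
  apply/measurable_EFinP; apply: measurable_funM; first exact: measurable_poly.
  exact: measurable_normal_pdf.
move=> x _; rewrite /= lee_fin; apply: le_trans (HC x) _.
exact: ler_norm.
Qed.

Lemma integral_normal_signed (f : R -> R) : measurable_fun [set: R] f ->
  mu.-integrable [set: R] (fun x => (f x * phi x)%:E) ->
  gam.-integrable [set: R] (EFin \o f) /\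
  (\int[gam]_x (f x)%:E = \int[mu]_x (f x * phi x)%:E)%E.
Proof.
move=> mf intf.
have mfE : measurable_fun [set: R] (EFin \o f) by exact/measurable_EFinP.
split.
  apply/integrableP; split => //.
  rewrite ge0_integral_normal_prob//; last exact: measurableT_comp.
  have /integrableP[_] := intf; apply: le_lt_trans.
  rewrite le_eqVlt; apply/orP; left; apply/eqP; apply: eq_integral => x _ /=.
  by rewrite normrM (ger0_norm (normal_pdf_ge0 _ _ x)).
rewrite integralE [RHS]integralE; congr (_ - _)%E.
  rewrite ge0_integral_normal_prob//; last exact: measurable_funepos.
  apply: eq_integral => x _; rewrite !funeposE -!EFin_max -EFinM; congr EFin.
  by rewrite maxr_pMl ?normal_pdf_ge0// mul0r.
rewrite ge0_integral_normal_prob//; last exact: measurable_funeneg.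
apply: eq_integral => x _; rewrite !funenegE -!EFinN -!EFin_max -EFinM; congr EFin.
by rewrite maxr_pMl ?normal_pdf_ge0// mul0r mulNr.
Qed.

Lemma integrable_poly q : gam.-integrable [set: R] (fun x => (q.[x])%:E).
Proof.
exact: (integral_normal_signed (measurable_poly q) (integrable_poly_normal q)).1.
Qed.

Lemma integral_poly q : (\int[gam]_x (q.[x])%:E = \int[mu]_x (q.[x] * phi x)%:E)%E.
Proof.
exact: (integral_normal_signed (measurable_poly q) (integrable_poly_normal q)).2.
Qed.

Lemma cvg_expR_sqr_nat : expR (- (n%:R ^+ 2 / 4)) @[n --> \oo] --> (0 : R).
Proof.
apply: (@squeeze_cvgr _ _ _ _ (fun=> 0) (fun n : nat => 4 * (n%:R^-1 : R))).
- near=> n; rewrite expR_ge0 /= expRN.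
  have n0 : (0 < n)%N by near: n; exact: nbhs_infty_gt.
  have n1 : 1 <= n%:R :> R by rewrite ler1n.
  rewrite -[X in _ <= X]invrK lef_pV2 ?posrE ?expR_gt0 ?invr_gt0 ?mulr_gt0
    ?invr_gt0 ?ltr0n//.
  rewrite invfM invrK; apply: le_trans (expR_ge1Dx _).
  rewrite mulrC; have : n%:R * 1 <= n%:R * n%:R :> R by rewrite ler_pM2l ?ltr0n.
  rewrite -expr2; lra.
- exact: cvg_cst.
- rewrite [X in _ --> X](_ : 0 = 4 * 0); last by rewrite mulr0.
  apply: cvgM; first exact: cvg_cst.
  apply/gtr0_cvgV0; last exact: cvgr_idn.
  by near=> n; rewrite ltr0n; near: n; exact: nbhs_infty_gt.
Unshelve. all: by end_near. Qed.

(** The integrand is the derivative of - p phi. The fundamental theorem on [-n-1, n+1] leaves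
    boundary terms that vanish, and dominated convergence handles the integrals. *)
Lemma stein_lebesgue p :
  (\int[mu]_x ((('X * p - p^`()).[x]) * phi x)%:E = 0)%E.
Proof.
pose q := 'X * p - p^`()%R.
pose F x := - (p.[x] * phi x).
have dphi (y : R) : is_derive y 1 phi (- y * phi y).
  have phiE : phi = fun z => normal_peak 1 * expR (- (z ^+ 2 / 2)).
    by apply/funext => z; exact: normal_pdf01E.
  rewrite phiE; apply: is_derive_eq; rewrite /GRing.scale /=; by field.
have dp (x : R) : is_derive x 1 (horner p) (p^`()).[x] by exact: is_derive_poly.
have dF (x : R) : is_derive x 1 F (q.[x] * phi x).
  rewrite /F; apply: is_derive_eq.
  by rewrite /q !hornerE /GRing.scale /=; ring.
have cont (f : R -> R) (f' : R -> R) : (forall x, is_derive x 1 f (f' x)) -> continuous f.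
  move=> df x; apply: differentiable_continuous; apply/derivable1_diffP.
  exact: ex_derive.
have cF := cont _ _ dF.
have cq : continuous (fun x => q.[x] * phi x).
  move=> x; apply: cvgM; last exact: (cont _ _ dphi).
  apply: differentiable_continuous; apply/derivable1_diffP.
  exact: derivable_horner.
pose D (n : nat) : set R := `[(- n.+1%:R), n.+1%:R]%classic.
pose f_ n x : \bar R := ((q.[x] * phi x) * \1_(D n) x)%:E.
have HI n : (\int[mu]_x f_ n x = (F n.+1%:R - F (- n.+1%:R))%:E)%E.
  rewrite EFinB -(@continuous_FTC2 R (fun x => q.[x] * phi x) F).
  - rewrite [RHS]integral_mkcond; apply: eq_integral => x _.
    by rewrite /f_ patchE indicE; case: ifPn; rewrite ?mulr1 ?mulr0.
  - have : 0 < n.+1%:R :> R by []. lra.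
  - exact: continuous_subspaceT.
  - split; first by move=> x _; exact: ex_derive.
      by apply: cvg_at_right_filter; exact: cF.
    by apply: cvg_at_left_filter; exact: cF.
  - by move=> x _; rewrite derive1E derive_val.
have [C C0 HC] := poly_normal_bound q.
have cv : ((\int[mu]_x f_ n x)%E @[n --> \oo] --> (\int[mu]_x (q.[x] * phi x)%:E)%E).
  apply: (@dominated_cvg _ _ R mu setT measurableT f_ _
    (fun x => (C * expR (- (x ^+ 2 / 4)))%:E)) => //.
  - move=> n; apply/measurable_EFinP; apply: measurable_funM.
      by apply: (@measurable_funM _ R);
        [exact: measurable_poly|exact: measurable_normal_pdf].
    by have mD : measurable (D n);
      [exact: measurable_itv|exact: (@measurable_indic _ _ R _ _ mD)].
  - move=> x _; apply: cvg_near_cst; near=> n.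
    rewrite /f_ indicE mem_set ?mulr1// /D /= in_itv/= -ler_norml.
    apply: le_trans (_ : n%:R <= _); last by rewrite ler_nat.
    by near: n; exact: nbhs_infty_ger.
  - exact: (integrableZl measurableT C integrable_expR_sqr).
  - move=> n x _; rewrite /f_ abse_EFin lee_fin normrM; apply: le_trans (HC x).
    by rewrite ler_piMr// indicE; case: (_ \in _); rewrite ?normr1 ?normr0.
have cF0 : F n%:R @[n --> \oo] --> (0 : R) /\ F (- n%:R) @[n --> \oo] --> (0 : R).
  have [C' C'0 HC'] := poly_normal_bound p.
  have sq : C' * expR (- (n%:R ^+ 2 / 4)) @[n --> \oo] --> (0 : R).
    rewrite [X in _ --> X](_ : 0 = C' * 0); last by rewrite mulr0.
    exact: (cvgM (cvg_cst C') cvg_expR_sqr_nat).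
  split; apply/norm_cvg0P.
    apply: (@squeeze_cvgr _ _ _ _ (fun=> 0) _ _ _ _ _ sq); last exact: cvg_cst.
    by near=> n; rewrite normr_ge0 /= normrN.
  apply: (@squeeze_cvgr _ _ _ _ (fun=> 0) _ _ _ _ _ sq); last exact: cvg_cst.
  by near=> n; rewrite normr_ge0 /= normrN; have := HC' (- n%:R); rewrite sqrrN.
have cv0 : ((\int[mu]_x f_ n x)%E @[n --> \oo] --> (0 - 0 : R)%:E).
  under eq_cvg do rewrite HI.
  have [c1 c2] := cF0; apply: cvg_EFin; first by near=> n.
  apply: (@cvgB _ R^o _ _ _ (fun n : nat => F n.+1%:R) (fun n : nat => F (- n.+1%:R))).
    by rewrite (cvg_shiftS (fun n : nat => F n%:R)).
  by rewrite (cvg_shiftS (fun n : nat => F (- n%:R))).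
rewrite subr0 in cv0.
exact: (cvg_unique _ cv cv0).
Unshelve. all: by end_near. Qed.

Lemma stein_poly p :
  (\int[gam]_x ((('X * p).[x])%:E) = \int[gam]_x ((p^`().[x])%:E))%E.
Proof.
have := stein_lebesgue p; rewrite -integral_poly.
under eq_integral do rewrite hornerD hornerN EFinB.
rewrite integralB//; [|exact: integrable_poly|exact: integrable_poly].
move=> /eqP; rewrite sube_eq ?add0e; first by move=> /eqP.
- by rewrite ?integrable_fin_num//; exact: integrable_poly.
- by rewrite fin_num_adde_defl//; apply: integrable_fin_num => //; exact: integrable_poly.
Qed.

End SteinIdentity.

Section QuadraticMoments.
Context {R : realType} {d : nat} {disp : measure_display}
  {T : measurableType disp} {P : probability T R}.
Local Notation gam := (normal_prob (0 : R) 1).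
Context (G : 'I_d -> {RV P >-> R}) (hG : std_gaussian G).
Implicit Types (v : 'cV[R]_d).

Local Notation nn h := (coord_measurable h /\ forall v, 0 <= h v).
Definition mean (h : 'cV[R]_d -> R) : \bar R := (\int[P]_w (h (rvec G w))%:E)%E.

Lemma mean_measurable (h : 'cV[R]_d -> R) : nn h ->
  measurable_fun [set: T] (fun w => (h (rvec G w))%:E).
Proof. by move=> [mh _]; apply/measurable_EFinP; exact: measurable_rvec. Qed.

Lemma mean_ge0 (h : 'cV[R]_d -> R) : nn h -> (0 <= mean h)%E.
Proof. by move=> [_ h0]; apply: integral_ge0 => w _; rewrite lee_fin. Qed.

Lemma meanD (h k : 'cV[R]_d -> R) : nn h -> nn k ->
  mean (fun v => h v + k v) = (mean h + mean k)%E.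
Proof.
move=> nh nk; rewrite /mean -ge0_integralD//.
- by move=> w _; rewrite lee_fin; exact: nh.2.
- exact: mean_measurable.
- by move=> w _; rewrite lee_fin; exact: nk.2.
- exact: mean_measurable.
Qed.

Lemma meanZ c (h : 'cV[R]_d -> R) : 0 <= c -> nn h ->
  mean (fun v => c * h v) = (c%:E * mean h)%E.
Proof.
move=> c0 nh; rewrite /mean -ge0_integralZl//; first exact: mean_measurable.
by move=> w _; rewrite lee_fin; exact: nh.2.
Qed.

Lemma mean_lincomb c1 c2 (h k : 'cV[R]_d -> R) : 0 <= c1 -> 0 <= c2 -> nn h -> nn k ->
  mean (fun v => c1 * h v + c2 * k v) = (c1%:E * mean h + c2%:E * mean k)%E.
Proof.
move=> c10 c20 nh nk; rewrite -!meanZ// -meanD//.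
  by split=> [|v]; [apply: coord_measurableM; [exact: coord_measurable_cst|exact: nh.1]|
    exact: mulr_ge0 (nh.2 v)].
by split=> [|v]; [apply: coord_measurableM; [exact: coord_measurable_cst|exact: nk.1]|
  exact: mulr_ge0 (nk.2 v)].
Qed.

Lemma mean_sum (F : 'I_d -> 'cV[R]_d -> R) : (forall i, nn (F i)) ->
  mean (fun v => \sum_i F i v) = (\sum_i mean (F i))%E.
Proof.
move=> nF; rewrite /mean -ge0_integral_sum//.
- by apply: eq_integral => w _; rewrite sumEFin.
- by move=> i; exact: mean_measurable.
- by move=> i w _; rewrite lee_fin; exact: (nF i).2.
Qed.

Lemma mean_le (h k : 'cV[R]_d -> R) : nn h -> nn k -> (forall v, h v <= k v) ->
  (mean h <= mean k)%E.
Proof.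
move=> nh nk hk; apply: ge0_le_integral => [//|w _|||w _].
- by rewrite lee_fin; exact: nh.2.
- exact: mean_measurable.
- exact: mean_measurable.
- by rewrite lee_fin.
Qed.

Lemma updE i (a : R) v : upd i a v = upd i 0 v + a *: delta_mx i 0.
Proof.
apply/colP => j; rewrite !mxE andbT; case: (j == i); first by rewrite add0r mulr1.
by rewrite mulr0 addr0.
Qed.

Lemma coord_measurable_exp (h : 'cV[R]_d -> R) n : coord_measurable h ->
  coord_measurable (fun v => h v ^+ n).
Proof.
by move=> mh; apply: (@coord_measurable_comp _ _ _ (fun x => x ^+ n)) => //;
  exact: exprn_measurable.
Qed.

Lemma coord_measurable_dot (F K : 'cV[R]_d -> 'cV[R]_d) :
  (forall i, coord_measurable (fun v => F v i 0)) ->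
  (forall i, coord_measurable (fun v => K v i 0)) ->
  coord_measurable (fun v => dotv (F v) (K v)).
Proof.
move=> mF mK; under [X in coord_measurable X]eq_fun do rewrite dotvE.
apply: (@coord_measurable_sum _ _ _ _ (fun i v => F v i 0 * K v i 0)) => i.
exact: coord_measurableM.
Qed.

Lemma coord_measurable_mulmx (A : 'M[R]_d) i : coord_measurable (fun v => (A *m v) i 0).
Proof.
under [X in coord_measurable X]eq_fun do rewrite mxE.
apply: (@coord_measurable_sum _ _ _ _ (fun j (v : 'cV[R]_d) => A i j * v j 0)) => j.
by apply: coord_measurableM; [exact: coord_measurable_cst|exact: coord_measurable_coord].
Qed.

Lemma coord_measurable_qform (A : 'M[R]_d) : coord_measurable (qform A).
Proof.
have -> : qform A = fun v => dotv v (A *m v) by apply/funext => v; exact: qformE.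
apply: coord_measurable_dot => i; first exact: coord_measurable_coord.
exact: coord_measurable_mulmx.
Qed.

Lemma coord_measurable_dotvv : coord_measurable (fun v => dotv v v).
Proof. by apply: coord_measurable_dot => i; exact: coord_measurable_coord. Qed.

Lemma coord_moment_finite i n : (mean (fun v => (v i 0 ^+ n.*2)%R) < +oo)%E.
Proof.
rewrite /mean (resample hG i (h := fun v => v i 0 ^+ n.*2)).
- have c0 : (0 <= \int[gam]_a (a ^+ n.*2)%:E)%E.
    by apply: integral_ge0 => a _; rewrite lee_fin -mul2n exprM exprn_ge0 ?sqr_ge0.
  have cfin : ((\int[gam]_a (a ^+ n.*2)%:E) \is a fin_num)%E.
    have -> : (fun a : R => (a ^+ n.*2)%:E) = (fun a => (('X^(n.*2) : {poly R}).[a])%:E).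
      by apply/funext => a; rewrite hornerXn.
    by apply: integrable_fin_num => //; exact: integrable_poly.
  under eq_integral do under eq_integral do rewrite upd_same.
  rewrite integral_cst//; apply: lte_mul_pinfty => //; last first.
    by apply: le_lt_trans (ltry 1); exact: probability_le1.
- by apply: coord_measurable_exp; exact: coord_measurable_coord.
- by move=> v; rewrite -mul2n exprM exprn_ge0 ?sqr_ge0.
Qed.

Lemma nn_coord_exp i n : nn (fun v : 'cV[R]_d => v i 0 ^+ n.*2).
Proof.
split; first by apply: coord_measurable_exp; exact: coord_measurable_coord.
by move=> v; rewrite -mul2n exprM exprn_ge0 ?sqr_ge0.
Qed.

Lemma nn_dotvv_exp n : nn (fun v : 'cV[R]_d => dotv v v ^+ n).
Proof.
split; first by apply: coord_measurable_exp; exact: coord_measurable_dotvv.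
by move=> v; rewrite exprn_ge0 ?dotvv_ge0.
Qed.

Lemma nnZ c (h : 'cV[R]_d -> R) : 0 <= c -> nn h -> nn (fun v => c * h v).
Proof.
move=> c0 [mh h0]; split; last by move=> v; exact: mulr_ge0.
by apply: coord_measurableM => //; exact: coord_measurable_cst.
Qed.

Lemma nn_sum (F : 'I_d -> 'cV[R]_d -> R) : (forall i, nn (F i)) ->
  nn (fun v => \sum_i F i v).
Proof.
move=> nF; split; first by apply: coord_measurable_sum => i; exact: (nF i).1.
by move=> v; apply: sumr_ge0 => i _; exact: (nF i).2.
Qed.

Lemma dotvv_moment_finite n : (0 < d)%N -> (mean (fun v => (dotv v v ^+ n)%R) < +oo)%E.
Proof.
move=> hd; have dn0 : 0 <= d%:R ^+ n :> R by exact: exprn_ge0.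
have nF i := nnZ dn0 (nn_coord_exp i n).
apply: le_lt_trans (mean_le (nn_dotvv_exp n) (nn_sum nF) _) _.
  (* The largest coordinate controls |v|^2 up to the factor d; summing over all [i] makes the bound
     independent of which one it is. *)
  move=> v; have [i _ Hi] := @arg_maxP _ R _ (Ordinal hd) xpredT (fun i =>
    v i 0 ^+ 2) isT.
  have dE : dotv v v <= d%:R * v i 0 ^+ 2.
    rewrite dotvE -[d in d%:R]card_ord mulr_natl -sumr_const.
    by apply: ler_sum => j _; rewrite -expr2; exact: Hi.
  rewrite (bigD1 i)//=; apply: (@le_trans _ _ (d%:R ^+ n * v i 0 ^+ n.*2)).
    rewrite -mul2n exprM -exprMn; apply: lerXn2r => //.
    - by rewrite nnegrE dotvv_ge0.
    - by rewrite nnegrE mulr_ge0// sqr_ge0.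
  by rewrite lerDl sumr_ge0// => j _; exact: (nF j).2.
rewrite mean_sum//; apply: lte_sum_pinfty => i _.
rewrite meanZ//; last exact: nn_coord_exp.
by apply: lte_mul_pinfty => //; exact: coord_moment_finite.
Qed.

Section Fixed.
Context (A : 'M[R]_d) (hA : psdmx A).
Let Z v := qform A v.
Let L := opnorm A.

Lemma qform_ge0 v : 0 <= Z v. Proof. exact: hA.2. Qed.

Lemma diag_psd_ge0 i : 0 <= A i i.
Proof.
by rewrite -qform_delta; exact: hA.2.
Qed.

Section Coordinate.
Context (i : 'I_d) (n : nat).

(** [g] is the partial derivative in coordinate [i] of (A v)_i Z^n, so Stein's identity equates the
    means of [f] and [g]; [k] dominates |f|. For n = 0 the term with [n.-1] has coefficient 0. *)
Let f v := v i 0 * (A *m v) i 0 * Z v ^+ n.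
Let g v := A i i * Z v ^+ n + 2 * n%:R * ((A *m v) i 0 ^+ 2 * Z v ^+ n.-1).
Let k v := L ^+ n.+1 * dotv v v ^+ n.+1.

Lemma stein_integrand_bound v : - k v <= f v.
Proof.
rewrite lerNl; apply: le_trans (ler_norm _) _; rewrite normrN /f /k.
rewrite normrM (ger0_norm (exprn_ge0 _ (qform_ge0 v))) !exprS mulrACA.
have L0 : 0 <= L by exact: opnorm_ge0.
apply: ler_pM => //; first by rewrite exprn_ge0 ?qform_ge0.
  rewrite normrM -norm2_sqr expr2 mulrCA; apply: ler_pM => //;
    first exact: coord_le_norm2.
  by apply: le_trans (coord_le_norm2 _ _) _; exact: norm2_mulmx_le.
rewrite -exprMn; apply: lerXn2r; rewrite ?nnegrE ?qform_ge0 ?mulr_ge0 ?dotvv_ge0//.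
exact: qform_le.
Qed.

(** Along a coordinate line every function here is a polynomial in [a], so [stein_poly] applies.
    Basing the line at the point [w] with coordinate [i] zero makes |w + a e_i|^2 = |w|^2 + a^2. *)
Lemma stein_line v : (\int[gam]_a (f (upd i a v) + k (upd i a v))%:E =
   \int[gam]_a (g (upd i a v) + k (upd i a v))%:E)%E.
Proof.
have hE := (@hornerD R, @hornerC R, @hornerZ R, @hornerX R, @hornerXn R).
pose w := upd i 0 v.
pose b := (A *m w) i 0.
pose r : {poly R} := b%:P + A i i *: 'X.
pose zp : {poly R} := (Z w)%:P + (2 * b) *: 'X + A i i *: 'X^2.
pose s : {poly R} := (L ^+ n.+1) *: ((dotv w w)%:P + 'X^2) ^+ n.+1.
have Adelta : (A *m (delta_mx i 0 : 'cV[R]_d)) i 0 = A i i by rewrite -colE mxE.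
have rE a : (A *m upd i a v) i 0 = r.[a].
  by rewrite updE mulmxDr -scalemxAr mxE [X in _ + X]mxE Adelta /r !hE mulrC.
have zE a : Z (upd i a v) = zp.[a].
  rewrite updE /Z qformD; last exact: hA.1.
  rewrite qformZ qform_delta.
  rewrite -scalemxAr dotvZr (sym_dotvC _ _ hA.1) dotv_delta -/(b) /zp !hE -/(Z w).
  rewrite /b; ring.
have sE a : k (upd i a v) = s.[a].
  have wi0 : w i 0 = 0 by exact: upd_same.
  rewrite /k /s hornerZ horner_exp !hE updE; congr (_ * _ ^+ _).
  rewrite dotvDl !dotvDr !dotvZl !dotvZr [dotv w (delta_mx i 0)]dotvC !dotv_delta wi0.
  rewrite mxE !eqxx -/w /=; ring.
have dzp : zp^`() = 2%:R *: r.
  rewrite /zp /r !derivD derivC !derivZ derivX derivXn /= add0r.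
  by rewrite scalerDr alg_polyC polyCM -!mul_polyC; ring.
pose p : {poly R} := r * zp ^+ n.
have fE a : f (upd i a v) = ('X * p).[a].
  by rewrite /f rE zE upd_same /p hornerM hornerX hornerM horner_exp mulrA.
have gE a : g (upd i a v) = (p^`()).[a].
  have dr : r^`() = (A i i)%:P by rewrite /r derivD derivC derivZ derivX add0r alg_polyC.
  rewrite /g rE zE /p derivM deriv_exp dr dzp.
  move: (r) (zp) => r' z'; rewrite hornerD !hornerM hornerC hornerMn hornerM.
  rewrite hornerZ !horner_exp -[X in _ = _ + _ * X]mulr_natl; ring.
have intp q := @integrable_poly R q.
under eq_integral do rewrite fE sE EFinD.
under [RHS]eq_integral do rewrite gE sE EFinD.
by rewrite !integralD// stein_poly.
Qed.

Let mZ m : coord_measurable (fun v => Z v ^+ m).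
Proof. by apply: coord_measurable_exp; exact: coord_measurable_qform. Qed.

Lemma measurable_stein_bound : coord_measurable k.
Proof.
apply: coord_measurableM; first exact: coord_measurable_cst.
by apply: coord_measurable_exp; exact: coord_measurable_dotvv.
Qed.

Lemma stein_bound_ge0 v : 0 <= k v.
Proof. by rewrite mulr_ge0 ?exprn_ge0 ?opnorm_ge0 ?dotvv_ge0. Qed.

Lemma measurable_stein_lhs : coord_measurable (fun v => f v + k v).
Proof.
apply: coord_measurableD; last exact: measurable_stein_bound.
apply: coord_measurableM => //; apply: coord_measurableM.
  exact: coord_measurable_coord.
exact: coord_measurable_mulmx.
Qed.

Lemma measurable_stein_rhs : coord_measurable (fun v => g v + k v).
Proof.
apply: coord_measurableD; last exact: measurable_stein_bound.
apply: coord_measurableD; first by apply: coord_measurableM;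
  [exact: coord_measurable_cst|].
apply: coord_measurableM; first exact: coord_measurable_cst.
apply: coord_measurableM => //.
by apply: coord_measurable_exp; exact: coord_measurable_mulmx.
Qed.

Lemma stein_rhs_ge0 v : 0 <= g v.
Proof.
have Z0 m : 0 <= Z v ^+ m by rewrite exprn_ge0 ?qform_ge0.
apply: addr_ge0; apply: mulr_ge0 => //; first exact: diag_psd_ge0.
by apply: mulr_ge0 => //; exact: sqr_ge0.
Qed.

(* [f] has no sign, and [resample] is about nonnegative functions: hence [k]. *)
Lemma stein_expectation :
  mean (fun v => f v + k v) = mean (fun v => g v + k v).
Proof.
rewrite /mean (resample hG i measurable_stein_lhs); last first.
  by move=> v; have := stein_integrand_bound v; rewrite -subr_ge0 opprK.
rewrite [RHS](resample hG i measurable_stein_rhs); last first.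
  by move=> v; rewrite addr_ge0 ?stein_rhs_ge0 ?stein_bound_ge0.
by apply: eq_integral => w _; exact: stein_line.
Qed.

End Coordinate.

Lemma nn_qform_exp n : nn (fun v => Z v ^+ n).
Proof.
split; last by move=> v; rewrite exprn_ge0 ?qform_ge0.
by apply: coord_measurable_exp; exact: coord_measurable_qform.
Qed.

Lemma tr_psd_ge0 : 0 <= \tr A.
Proof. by apply: sumr_ge0 => i _; exact: diag_psd_ge0. Qed.

(** Summing Stein's identity over the coordinates turns the left side into Z^(n+1) and the right
    side into tr A Z^n + 2 n |A v|^2 Z^(n-1), where |A v|^2 <= L Z. The common term d k has finite
    mean and cancels. *)
Lemma qform_moment_step n : (0 < d)%N ->
  (mean (fun v => (Z v ^+ n.+1)%R)
    <= (\tr A + 2 * n%:R * L)%:E * mean (fun v => (Z v ^+ n)%R))%E.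
Proof.
move=> hd.
pose k v := L ^+ n.+1 * dotv v v ^+ n.+1.
pose f i v := v i 0 * (A *m v) i 0 * Z v ^+ n.
pose g i v := A i i * Z v ^+ n + 2 * n%:R * ((A *m v) i 0 ^+ 2 * Z v ^+ n.-1).
have nk : nn k by split; [exact: measurable_stein_bound|exact: stein_bound_ge0].
have ndk : nn (fun v => d%:R * k v) by exact: nnZ.
have nZ := nn_qform_exp.
have c0 : 0 <= \tr A + 2 * n%:R * L by rewrite addr_ge0 ?mulr_ge0 ?opnorm_ge0 ?tr_psd_ge0.
have kfin : (mean (fun v => (d%:R * k v)%R) \is a fin_num)%E.
  rewrite ge0_fin_numE; last exact: mean_ge0.
  rewrite meanZ// meanZ; last 2 first.
  - by rewrite exprn_ge0 ?opnorm_ge0.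
  - exact: nn_dotvv_exp.
  by rewrite !lte_mul_pinfty// ?lee_fin ?exprn_ge0 ?opnorm_ge0
    ?dotvv_moment_finite// mule_ge0
    ?lee_fin ?exprn_ge0 ?opnorm_ge0 ?mean_ge0//; exact: nn_dotvv_exp.
have fE v : Z v ^+ n.+1 + d%:R * k v = \sum_i (f i v + k v).
  rewrite big_split /= sumr_const card_ord -[k v *+ d]mulr_natl; congr (_ + _).
  by rewrite -mulr_suml exprS; congr (_ * _); rewrite /Z qformE dotvE.
have gE v : \sum_i (g i v + k v) <= (\tr A + 2 * n%:R * L) * Z v ^+ n + d%:R * k v.
  rewrite big_split /= sumr_const card_ord -[k v *+ d]mulr_natl lerD2r.
  have -> : \sum_i g i v = \tr A * Z v ^+ n +
      2 * n%:R * (dotv (A *m v) (A *m v) * Z v ^+ n.-1).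
    rewrite big_split /=; congr (_ + _); first by rewrite -mulr_suml.
    rewrite -mulr_sumr -mulr_suml dotvE; congr (_ * (_ * _)).
  rewrite [X in _ <= X]mulrDl lerD2l; case: (n) => [|m]; first by rewrite !(mulr0, mul0r).
  rewrite -!mulrA !ler_wpM2l// exprS mulrA ler_wpM2r ?exprn_ge0 ?qform_ge0//=.
  exact: psd_mulmx_sqr_le.
have nf i : nn (fun v => f i v + k v).
  split; first exact: measurable_stein_lhs.
  by move=> v; have := stein_integrand_bound i n v; rewrite -subr_ge0 opprK.
have ng i : nn (fun v => g i v + k v).
  split; first exact: measurable_stein_rhs.
  by move=> v; apply: addr_ge0; [exact: stein_rhs_ge0|exact: nk.2].
have nR : nn (fun v => (\tr A + 2 * n%:R * L) * Z v ^+ n) by exact: nnZ.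
rewrite -(leeD2rE _ _ kfin) -meanZ// -!meanD//.
under [X in mean X]eq_fun do rewrite fE.
rewrite mean_sum//; under eq_bigr do rewrite stein_expectation.
rewrite -mean_sum//; apply: mean_le => //; first exact: nn_sum.
split; last by move=> v; rewrite addr_ge0 ?nR.2 ?ndk.2.
by apply: coord_measurableD; [exact: nR.1|exact: ndk.1].
Qed.

Lemma qform_moment_nat n : (0 < d)%N ->
  (mean (fun v => (Z v ^+ n)%R) <= (\prod_(j < n) (\tr A + 2 * j%:R * L))%:E)%E.
Proof.
move=> hd; elim: n => [|n IH].
  rewrite big_ord0 /mean; under eq_integral do rewrite expr0.
  by rewrite integral_cst//= mul1e; exact: probability_le1.
apply: le_trans (qform_moment_step n hd) _.
rewrite big_ord_recr /= EFinM [leRHS]muleC; apply: lee_wpmul2l => //.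
by rewrite lee_fin addr_ge0 ?mulr_ge0 ?opnorm_ge0 ?tr_psd_ge0.
Qed.

(* Weighted AM-GM, the weights being [1] ([n] times) and [phi]. *)
Lemma qform_moment_prod (n : nat) (phi : R) : 0 < \tr A -> 0 <= phi <= 1 ->
  (\prod_(j < n) (\tr A + 2 * j%:R * L)) * (\tr A + 2 * n%:R * L) `^ phi <=
  (\tr A + (n%:R + phi) * L) `^ (n%:R + phi).
Proof.
move=> S0 /andP[p0 p1]; set m : R := n%:R + phi; set S := \tr A in S0 *;
  set y := S + m * L.
have L0 : 0 <= L by exact: opnorm_ge0.
have m0 : 0 <= m by exact: addr_ge0.
have y0 : 0 < y by rewrite ltr_pwDl// mulr_ge0.
(* Each factor is compared with the target base [y] through 1 + x <= e^x; only the sum of the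
   exponents will matter. *)
have fac (j : R) : S + 2 * j * L <= y * expR ((2 * j - m) * L / y).
  have -> : S + 2 * j * L = y * (1 + (2 * j - m) * L / y).
    by rewrite /y; field; rewrite gt_eqF.
  by rewrite ler_pM2l//; exact: expR_ge1Dx.
have prodle k : \prod_(j < k) (S + 2 * j%:R * L) <=
    y ^+ k * expR ((k%:R * (k%:R - 1) - k%:R * m) * L / y).
  elim: k => [|k IH]; first by rewrite big_ord0 expr0 !mul0r subr0 !mul0r expR0 mulr1.
  rewrite big_ord_recr /=; apply: le_trans (ler_pM _ _ IH (fac k%:R)) _.
  - by apply: prodr_ge0 => j _; rewrite addr_ge0 ?mulr_ge0// ltW.
  - by rewrite addr_ge0 ?mulr_ge0// ltW.
  rewrite mulrACA -exprSr -expRD le_eqVlt; apply/orP; left; apply/eqP.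
  by congr (_ * expR _); rewrite -natr1; field; rewrite gt_eqF.
have a0 : 0 <= S + 2 * n%:R * L by rewrite addr_ge0 ?mulr_ge0// ltW.
have last_le : (S + 2 * n%:R * L) `^ phi
  <= y `^ phi * expR (phi * ((2 * n%:R - m) * L / y)).
  rewrite [X in expR X]mulrC expRM -powRM ?expR_ge0 ?(ltW y0)//.
  by apply: ge0_ler_powR; rewrite ?nnegrE ?mulr_ge0 ?expR_ge0 ?(ltW y0)//; exact: fac.
apply: le_trans (ler_pM _ _ (prodle n) last_le) _.
- by apply: prodr_ge0 => j _; rewrite addr_ge0 ?mulr_ge0// ltW.
- exact: powR_ge0.
rewrite mulrACA -expRD -powR_mulrn ?(ltW y0)// -powRD; last first.
  by apply/implyP => _; rewrite gt_eqF.
rewrite ler_piMr ?powR_ge0// -[leRHS](@expR0 R) ler_expR.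
have -> : (n%:R * (n%:R - 1) - n%:R * m) * L / y + phi * ((2 * n%:R - m) * L / y) =
   - ((n%:R + phi ^+ 2) * (L / y)) by rewrite /m; ring.
by rewrite oppr_le0 mulr_ge0 ?addr_ge0 ?sqr_ge0// divr_ge0// ltW.
Qed.

(** The concave power lies below its tangent at [a]; after dividing by a^phi this is convexity of
    exp between ln(z / a) and 0. *)
Lemma powR_le_chord (phi z a : R) : 0 <= phi <= 1 -> 0 <= z -> 0 < a ->
  z `^ phi <= a `^ phi * ((1 - phi) + phi * (z / a)).
Proof.
move=> /andP[p0 p1] z0 a0.
rewrite -[in leLHS](divfK (lt0r_neq0 a0) z) powRM ?divr_ge0// ?(ltW a0)// mulrC.
rewrite ler_pM2l ?powR_gt0//; set r := z / a.
have r0 : 0 <= r by rewrite divr_ge0// ltW.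
have [->|pn0] := eqVneq phi 0; first by rewrite powRr0 mul0r subr0 addr0.
move: r0; rewrite le_eqVlt => /orP[/eqP <-|r0].
  by rewrite powR0// mulr0 addr0 subr_ge0.
have := @convex_expR R (Itv01 p0 p1) (ln r) 0.
rewrite !convRE /= !mulr0 !addr0 expR0 mulr1 lnK ?posrE//.
by rewrite /powR gt_eqF// [leRHS]addrC.
Qed.

Lemma powR_natD (n : nat) (phi z : R) : 0 <= z -> 0 <= phi ->
  z `^ (n%:R + phi) = z ^+ n * z `^ phi.
Proof.
move=> z0 p0; have [E|E] := eqVneq (n%:R + phi) 0.
  have /andP[/eqP n0 /eqP ->] : (n%:R == 0 :> R) && (phi == 0) by rewrite -paddr_eq0// E.
  by move/eqP: n0; rewrite pnatr_eq0 => /eqP ->; rewrite addr0 powRr0 expr0 mul1r.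
by rewrite powRD ?(negPf E)// powR_mulrn.
Qed.

(** For real m = n + phi, bound Z^phi by its tangent at a = tr A + 2 n L. As E Z^(n+1) <= a E Z^n,
    this choice of [a] gives exactly E Z^m <= a^phi E Z^n. *)
Theorem qform_moment (m : R) : (0 < d)%N -> 0 < \tr A -> 0 <= m ->
  (mean (fun v => (Z v `^ m)%R) <= ((\tr A + m * L) `^ m)%:E)%E.
Proof.
move=> hd S0 m0.
have /andP[n1 n2] := truncn_itv m0; set n := Num.trunc m in n1 n2.
pose phi := m - n%:R.
have mE : m = n%:R + phi by rewrite /phi addrC subrK.
have phi01 : 0 <= phi <= 1.
  rewrite /phi subr_ge0 n1 /= lerBlDr; apply: ltW; apply: lt_le_trans n2 _.
  by rewrite -natr1 addrC.
have [p0 p1] := andP phi01.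
have L0 : 0 <= L by exact: opnorm_ge0.
pose a := \tr A + 2 * n%:R * L.
have a0 : 0 < a by rewrite ltr_pwDl// mulr_ge0.
have nZ := nn_qform_exp.
pose c0 := a `^ phi * (1 - phi); pose c1 := a `^ phi * (phi / a).
have c00 : 0 <= c0 by rewrite mulr_ge0 ?powR_ge0// subr_ge0.
have c10 : 0 <= c1 by rewrite mulr_ge0 ?powR_ge0// divr_ge0// ltW.
have n0 : nn (fun v => c0 * Z v ^+ n) by exact: nnZ.
have n1' : nn (fun v => c1 * Z v ^+ n.+1) by exact: nnZ.
have nm : nn (fun v => Z v `^ m).
  split; last by move=> v; exact: powR_ge0.
  apply: (@coord_measurable_comp _ _ _ (fun x => x `^ m));
    last exact: coord_measurable_qform.
  exact: measurable_powR.
apply: (@le_trans _ _ (mean (fun v => c0 * Z v ^+ n + c1 * Z v ^+ n.+1))).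
  apply: mean_le => //.
    split; last by move=> v; rewrite addr_ge0 ?n0.2 ?n1'.2.
    by apply: coord_measurableD; [exact: n0.1|exact: n1'.1].
  move=> v; have z0 := qform_ge0 v.
  have := powR_le_chord phi01 z0 a0; move/(ler_wpM2l (exprn_ge0 n z0)).
  rewrite -powR_natD// -mE => /le_trans; apply.
  rewrite le_eqVlt; apply/orP; left; apply/eqP; rewrite /c0 /c1 exprS; ring.
rewrite meanD// !meanZ//; pose M := mean (fun v => Z v ^+ n).
apply: (@le_trans _ _ ((a `^ phi)%:E * M)%E).
  apply: (@le_trans _ _ (c0%:E * M + (c1 * a)%:E * M)%E).
    rewrite leeD2l// (EFinM c1 a) -muleA; apply: lee_wpmul2l; first by rewrite lee_fin.
    exact: qform_moment_step.
  have E : a `^ phi = c0 + c1 * a by rewrite /c0 /c1; field; rewrite gt_eqF.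
  by rewrite E EFinD ge0_muleDl// lee_fin// mulr_ge0// ltW.
apply: (@le_trans _ _ ((a `^ phi)%:E * (\prod_(j < n) (\tr A + 2 * j%:R * L))%:E)%E).
  by apply: lee_wpmul2l; [rewrite lee_fin powR_ge0|exact: qform_moment_nat].
by rewrite -EFinM lee_fin mulrC mE; exact: qform_moment_prod.
Qed.

End Fixed.
End QuadraticMoments.

(** * Anti-concentration of the gradient *)

Section BoundedCS.
Context {R : realType} {disp : measure_display}
  {T : measurableType disp} (P : probability T R).
Local Notation EE f := (Rintegral P setT f).

Lemma ER_CS (f g : T -> R) : bounded_rv f -> bounded_rv g ->
  EE (fun w => f w * g w) ^+ 2 <= EE (fun w => f w * f w) * EE (fun w => g w * g w).
Proof.
move=> bf bg; have [bff bfg bgg] :=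
  And3 (bounded_rvM bf bf) (bounded_rvM bf bg) (bounded_rvM bg bg).
have E0 (h : T -> R) : bounded_rv h -> (forall w, 0 <= h w) -> 0 <= EE h.
  by move=> bh h0; rewrite -(ERcst P 0); apply: ER_le => //; exact: bounded_rv_cst.
apply: quadratic_ge0_disc => [|t]; first by apply: E0 => // w; rewrite -expr2 sqr_ge0.
rewrite -(ERZ P (2 * t) bfg) -(ERZ P (t ^+ 2) bgg) -(ERD P bff (bounded_rvZ _ bfg)).
rewrite -ERD; [|exact: bounded_rvD bff (bounded_rvZ _ bfg)|exact: bounded_rvZ].
apply: E0 => [|w]; first by apply: bounded_rvD; [apply: bounded_rvD => //|];
  exact: bounded_rvZ.
have := sqr_ge0 (f w + t * g w); lra.
Qed.

Lemma bounded_rv_indic (A : set T) : measurable A -> bounded_rv (\1_A : T -> R).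
Proof.
move=> mA; split; first exact: measurable_indic.
by exists 1 => w; rewrite indicE; case: (_ \in _); rewrite ?normr1 ?normr0.
Qed.

Lemma ER_indic (A : set T) : measurable A -> EE (\1_A : T -> R) = fine (P A).
Proof. by move=> mA; rewrite /Rintegral integral_indic// setIT. Qed.

End BoundedCS.

Section Envelope.
Context {R : realType} {d : nat} (hd : (0 < d)%N).
Context (N : 'cV[R]_d -> R) (hN : is_norm N) (Sigma : 'M[R]_d)
  (hSigma : pdmx Sigma) (kappa rho : R) (hk : 0 < kappa) (hr : 0 <= rho).
Implicit Types u v x y g : 'cV[R]_d.

Let S := sqrtmx Sigma.
Let F := gradS N Sigma kappa rho.

Lemma dotvv_le_qform_inv (A : 'M[R]_d) u : psdmx A -> A \in unitmx ->
  dotv u u <= opnorm (invmx A) * qform A u.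
Proof.
move=> pA uA; have pM := psd_of_pd (pd_invmx (psd_unit_pd pA uA)).
have := psd_mulmx_sqr_le (A *m u) pM; rewrite mulKmx// => /le_trans; apply.
by rewrite [qform (invmx A) _]qformE mulKmx// dotvC -qformE.
Qed.

(** [gradS_nonexp] is stated in the norm of [S]; converting both sides to the Euclidean norm costs
    the root of the condition number of [S]. *)
Lemma gradS_lipschitz g g' :
  norm2 (F g - F g') <= kappa * Num.sqrt (opnorm (invmx S) * opnorm S) * norm2 (g - g').
Proof.
have [pS _ uS] := sqrtmx_pd hd hSigma.
have c0 : 0 <= opnorm (invmx S) * opnorm S by rewrite mulr_ge0 ?opnorm_ge0.
rewrite -ler_sqr ?nnegrE ?norm2_ge0 ?mulr_ge0 ?sqrtr_ge0 ?(ltW hk)//.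
rewrite !exprMn !norm2_sqr sqr_sqrtr//.
apply: le_trans (dotvv_le_qform_inv _ pS uS) _.
rewrite [kappa ^+ 2 * _]mulrC -!mulrA ler_wpM2l ?opnorm_ge0//.
apply: le_trans (gradS_nonexp hd hN hSigma hk hr g g') _.
rewrite (_ : opnorm S * _
  = kappa ^+ 2 * (opnorm S * dotv (g - g') (g - g'))); last by ring.
by rewrite ler_wpM2l ?sqr_ge0//; exact: qform_le.
Qed.

Lemma gradS_coord_measurable i : coord_measurable (fun g => F g i 0).
Proof.
apply: (@lipschitz_coord_measurable _ _ _
  (kappa * Num.sqrt (opnorm (invmx S) * opnorm S))).
  by rewrite mulr_ge0 ?sqrtr_ge0// ltW.
move=> g g'; apply: le_trans (gradS_lipschitz g g').
have coordB (u v : 'cV[R]_d) : u i 0 - v i 0 = (u - v) i 0 by rewrite !mxE.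
by rewrite coordB; exact: coord_le_norm2.
Qed.

Definition hinge x g : R := Num.max (`|dotv (F g) x| - 1) 0.

Lemma hinge_ge0 x g : 0 <= hinge x g.
Proof. by rewrite /hinge le_max lexx orbT. Qed.

Lemma normr_dotv_gradS_le x g : N x = 1 -> `|dotv (F g) x| <= rho.
Proof.
move=> x1; apply: le_trans (normr_dotv_le_dual hN _ _) _; rewrite x1 mulr1.
exact: dual_grad_le.
Qed.

Lemma hinge_le x g : N x = 1 -> hinge x g <= rho.
Proof. by move=> x1; have := normr_dotv_gradS_le g x1;
  rewrite /hinge ge_max hr andbT; lra. Qed.

Lemma hinge_lip x g g' : `|hinge x g - hinge x g'| <= norm2 (F g - F g') * norm2 x.
Proof.
rewrite /hinge; move: (F g) (F g') => u u'.
apply: (@le_trans _ _ `|dotv (u - u') x|); last exact: normr_dotv_CS.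
rewrite dotvBl; move: (dotv u x) (dotv u' x) => a b.
have maxB (p q : R) : `|Num.max p 0 - Num.max q 0| <= `|p - q|.
  rewrite /Num.max; case: (ltP p 0) => p0; case: (ltP q 0) => q0 //.
  - by rewrite subrr normr0.
  - by rewrite sub0r normrN ger0_norm// distrC ger0_norm; lra.
  - by rewrite subr0 !ger0_norm; lra.
apply: le_trans (maxB _ _) _; rewrite opprB addrA subrK.
exact: ler_dist_dist.
Qed.

Context {disp : measure_display} {T : measurableType disp} {P : probability T R}
  (G : 'I_d -> {RV P >-> R}) (hG : std_gaussian G).
Local Notation EE f := (Rintegral P setT f).
Implicit Types w : T.

Lemma bounded_rv_comp (h : 'cV[R]_d -> R) K : coord_measurable h ->
  (forall v, `|h v| <= K) -> bounded_rv (fun w => h (rvec G w)).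
Proof. by move=> mh hK; split; [exact: measurable_rvec|exists K => w]. Qed.

Let V : R := kappa ^+ 2
  * (T_ge N G (rho / kappa) * (opnorm (invmx Sigma) * opnorm Sigma - 1) + 1)
  * rad (unit_ball N) ^+ 2.

Lemma T_ge_ge0 s : 0 <= T_ge N G s.
Proof. by rewrite /T_ge fine_ge0. Qed.

(** The condition number c of [S] is at least 1, so c <= c^2, and c^2 is at most that of S S =
    Sigma. *)
Lemma condition_number_sqrt : opnorm (invmx S) * opnorm S
  <= opnorm (invmx Sigma) * opnorm Sigma.
Proof.
have [pS SS uS] := sqrtmx_pd hd hSigma; set c := _ * _.
have c1 : 1 <= c by exact: opnorm_inv_ge1.
have MM : invmx S *m invmx S = invmx Sigma.
  rewrite -[LHS](mulmxK (pd_unitmx hSigma)) -[X in _ *m X *m _]SS -/S mulmxA.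
  by rewrite -(mulmxA (invmx S)) mulVmx// mulmx1 mulVmx// mul1mx.
apply: (@le_trans _ _ (c ^+ 2)); first by rewrite expr2 ler_peMl// (le_trans ler01).
rewrite /c exprMn; apply: ler_pM; rewrite ?sqr_ge0//.
  by rewrite -MM; apply: opnorm_sqr_sym; rewrite trmx_inv (pS.1).
by rewrite -[in leRHS]SS; apply: opnorm_sqr_sym; exact: pS.1.
Qed.

(** The local Poincare inequality with delta the dual norm, s = rho / kappa, L0 = kappa |x| and L1 =
    L0 sqrt c, c the condition number of [S]. Its two terms combine to kappa^2 (t (c - 1) + 1)
    |x|^2. *)
Lemma hinge_variance x : N x = 1 ->
  EE (fun w => hinge x (rvec G w) * hinge x (rvec G w)) -
  EE (fun w => hinge x (rvec G w)) ^+ 2 <= V.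
Proof.
move=> x1; set c := opnorm (invmx S) * opnorm S.
have [pS _ uS] := sqrtmx_pd hd hSigma.
have c1 : 1 <= c by exact: opnorm_inv_ge1.
have nx := norm2_ge0 x; have kx : 0 <= kappa * norm2 x by rewrite mulr_ge0// ltW.
have sc1 : 1 <= Num.sqrt c by rewrite -sqrtr1 ler_wsqrtr.
have [C C0 HC] := dual_norm_lipschitz hN.
have := @gaussian_poincare_local _ _ _ _ _ G hG (hinge x) (dual_norm N) rho
  (kappa * norm2 x) (kappa * Num.sqrt c * norm2 x) C (rho / kappa)
  (hinge_ge0 x) (fun g => hinge_le g x1) kx _ (ltW C0) _ HC _ _ erefl.
move=> /(_ _ _ _)/le_trans; apply.
- by rewrite mulrAC ler_peMr.
- move=> g g'; apply: le_trans (hinge_lip _ _ _) _.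
  by rewrite mulrAC ler_wpM2r//; exact: gradS_lipschitz.
- have small g : dual_norm N g < rho / kappa -> F g = kappa *: g.
    move=> Hg; apply: gradS_small => //.
    by rewrite dual_normZ ?(ltW hk)// mulrC -ler_pdivlMr// ltW.
  move=> g g' /small Fg /small Fg'; apply: le_trans (hinge_lip _ _ _) _.
  by rewrite Fg Fg' -scalerBr norm2Z gtr0_norm// mulrAC.
have xr : norm2 x ^+ 2 <= rad (unit_ball N) ^+ 2.
  have xr : norm2 x <= rad (unit_ball N) by apply: norm2_le_rad => //; rewrite x1.
  by apply: lerXn2r => //; rewrite nnegrE// (le_trans nx xr).
rewrite /V -/(T_ge N G (rho / kappa)); set t := T_ge _ _ _;
  have t0 : 0 <= t := T_ge_ge0 _.
rewrite !exprMn (sqr_sqrtr (le_trans ler01 c1)).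
rewrite (_ : _ + _ = kappa ^+ 2 * (t * (c - 1) + 1) * norm2 x ^+ 2); last by ring.
have cc := condition_number_sqrt; rewrite -/c in cc.
have tc : 0 <= t * (c - 1) by rewrite mulr_ge0// subr_ge0.
apply: ler_pM => //; [|exact: sqr_ge0|].
  by apply: mulr_ge0; [exact: sqr_ge0|exact: addr_ge0].
by rewrite ler_wpM2l ?sqr_ge0// lerD2r ler_wpM2l// lerD2r.
Qed.

Definition large_set x : set T := [set w | 1 <= `|dotv (F (rvec G w)) x|].

Lemma hinge_coord_measurable x : coord_measurable (hinge x).
Proof.
apply: (@coord_measurable_comp _ _ _ (fun a => Num.max (`|a| - 1) 0)).
  by apply: measurable_maxr => //; apply: measurable_funB.
by apply: coord_measurable_dotv => i; exact: gradS_coord_measurable.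
Qed.

Lemma measurable_large_set x : measurable (large_set x).
Proof.
have mh : coord_measurable (fun g => dotv (F g) x).
  by apply: coord_measurable_dotv => i; exact: gradS_coord_measurable.
have mn : measurable_fun setT (fun w => `|dotv (F (rvec G w)) x|).
  apply: measurableT_comp => //; exact: (measurable_rvec G mh).
have := mn measurableT `[1, +oo[%classic (measurable_itv _); rewrite setTI.
by congr measurable; apply/seteqP; split=> w; rewrite /= in_itv/= andbT.
Qed.

Let V_ge0 : 0 <= V.
Proof.
rewrite mulr_ge0 ?sqr_ge0// mulr_ge0 ?sqr_ge0// addr_ge0// mulr_ge0 ?T_ge_ge0//.
rewrite subr_ge0; exact: opnorm_inv_ge1 (pd_unitmx hSigma).
Qed.

Lemma bounded_rv_hinge x : N x = 1 -> bounded_rv (fun w => hinge x (rvec G w)).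
Proof.
move=> x1; apply: (bounded_rv_comp (hinge_coord_measurable x)) => v.
by rewrite ger0_norm ?hinge_ge0//; exact: hinge_le.
Qed.

(* The second bound is the Paley-Zygmund argument. *)
Lemma large_set_lower_bound x l : N x = 1 -> 0 < l ->
  l <= EE (fun w => hinge x (rvec G w)) ->
  let p := fine (P (large_set x)) in
  1 <= rho / l * p /\ 1 <= (V / l ^+ 2 + 1) * p.
Proof.
move=> x1 l0; have := hinge_variance x1; have bh := bounded_rv_hinge x1.
set a := EE (fun w => hinge x _); set b := EE _ => bV la p.
have mA := measurable_large_set x.
have b1 := @bounded_rv_indic R _ _ _ mA.
have hz w : w \notin large_set x -> hinge x (rvec G w) = 0.
  rewrite notin_setE /large_set /= => /negP; rewrite -ltNge => /ltW H.
  by apply/max_idPr; rewrite subr_le0.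
have pE : EE (\1_(large_set x)) = p by exact: ER_indic.
have a_le : a <= rho * p.
  rewrite -pE -ERZ//; apply: ER_le => //; first exact: bounded_rvZ.
  move=> w; rewrite indicE; case: (boolP (w \in large_set x)) => [_|/hz ->];
    last by rewrite mulr0.
  by rewrite mulr1 hinge_le.
have a_sq : a ^+ 2 <= b * p.
  have := ER_CS P bh b1.
  rewrite (_ : EE _ = a); last first.
    apply: eq_Rintegral => w _; rewrite indicE;
      case: (boolP (w \in large_set x)) => [_|/hz ->]; first by rewrite mulr1.
    by rewrite mul0r.
  rewrite (_ : EE (fun w => \1_(large_set x) w * _) = p)//.
  rewrite -pE; apply: eq_Rintegral => w _; rewrite indicE.
  by case: (_ \in _); rewrite ?mulr1 ?mulr0.
have a0 : 0 < a by exact: lt_le_trans la.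
have p0 : 0 < p.
  rewrite ltNge; apply/negP => p0; have := lt_le_trans a0 a_le.
  by rewrite ltNge mulr_ge0_le0.
split; first by rewrite mulrAC ler_pdivlMr// mul1r; exact: le_trans a_le.
rewrite -(@ler_pM2r _ (l ^+ 2)) ?exprn_gt0// mul1r.
have -> : (V / l ^+ 2 + 1) * p * l ^+ 2 = V * p + p * l ^+ 2.
  by field; rewrite gt_eqF.
have p1 : p <= 1.
  rewrite -[leRHS](ERcst P 1) -pE; apply: ER_le => //; exact: bounded_rv_cst.
(* From a^2 <= b p and b <= V + a^2 follows (1 - p) a^2 <= V p; as 1 - p >= 0, [a] may be lowered to
   [l]. *)
have lsq : l ^+ 2 <= a ^+ 2 by apply: lerXn2r; rewrite ?nnegrE// ltW.
have : (1 - p) * l ^+ 2 <= (1 - p) * a ^+ 2 by rewrite ler_wpM2l// subr_ge0.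
have : b * p <= (V + a ^+ 2) * p by rewrite ler_pM2r// -lerBlDr.
lra.
Qed.

Lemma normalized_vector_exists : exists x, N x = 1.
Proof.
pose e : 'cV[R]_d := delta_mx (Ordinal hd) 0.
have e0 : e != 0.
  by apply/negP => /eqP/(congr1 (fun u : 'cV[R]_d => u (Ordinal hd) 0));
    rewrite !mxE !eqxx => /eqP; rewrite oner_eq0.
have Ne := is_norm_gt0 hN e0; exists ((N e)^-1 *: e).
by rewrite is_normZ// ger0_norm ?invr_ge0 ?(ltW Ne)// mulVf// gt_eqF.
Qed.

Lemma lambda_inf_le x : N x = 1 ->
  (lambda_inf N Sigma G kappa rho <= (EE (fun w => hinge x (rvec G w)))%:E)%E.
Proof.
move=> x1; apply: ereal_inf_lbound; exists x; first exact: boundary_unit_ball.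
by rewrite unlock; exact: (bounded_rv_EFin P (bounded_rv_hinge x1)).
Qed.

Lemma lambda_inf_ge0 : (0 <= lambda_inf N Sigma G kappa rho)%E.
Proof.
apply: le_ereal_inf_tmp => _ [x _ <-]; rewrite unlock.
by apply: integral_ge0 => w _; rewrite lee_fin (hinge_ge0 x (rvec G w)).
Qed.

Lemma nu_bar_infty : lambda_inf N Sigma G kappa rho = 0%E ->
  nu_bar N Sigma G kappa rho = +oo%E.
Proof. by move=> l0; rewrite /nu_bar l0 /div_infty expe2 mule0 eqxx /= minxx. Qed.

Lemma nu_bar_finite : lambda_inf N Sigma G kappa rho != 0%E ->
  exists2 nu : R, nu_bar N Sigma G kappa rho = nu%:E &
    0 <= nu /\ forall x, N x = 1 -> 1 <= nu * fine (P (large_set x)).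
Proof.
move=> l0; have [x0 x01] := normalized_vector_exists.
have := lambda_inf_le x01; have := lambda_inf_ge0; have := lambda_inf_le.
rewrite /nu_bar; case: (lambda_inf _ _ _ _ _) l0 => [l| |]// l0 lle l_ge0 _.
have lp : 0 < l by rewrite lt_def -lee_fin l_ge0 andbT.
exists (Num.min (rho / l) (V / l ^+ 2 + 1)).
  rewrite EFin_min /div_infty expe2 -EFinM !eqe mulf_eq0 orbb gt_eqF//.
  by rewrite !inver mulf_eq0 orbb gt_eqF// -!EFinM -EFinD expr2.
split=> [|x x1].
  by rewrite le_min divr_ge0 ?(ltW lp)//= addr_ge0// divr_ge0// sqr_ge0.
have := large_set_lower_bound x1 lp; have := lle x x1; rewrite lee_fin => H /(_ H)[H1 H2].
by rewrite /Num.min; case: ifP.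
Qed.

End Envelope.

(** * Moments of the gradient *)

Section PowerInequalities.
Context {R : realType}.
Implicit Types a b q s x y z : R.

Lemma ler_powR_base q x y : 0 <= q -> 0 <= x -> x <= y -> x `^ q <= y `^ q.
Proof. by move=> q0 x0 xy; apply: ge0_ler_powR; rewrite ?nnegrE// (le_trans x0). Qed.

Lemma sqrtr_powR z q : 0 <= z -> Num.sqrt z `^ (2 * q) = z `^ q.
Proof. by move=> z0; rewrite -powR12_sqrt// -powRrM mulrA mulVf// mul1r. Qed.

Lemma sqrtrD_le a b : 0 <= a -> 0 <= b -> Num.sqrt (a + b) <= Num.sqrt a + Num.sqrt b.
Proof.
move=> a0 b0; rewrite -ler_sqr ?nnegrE ?addr_ge0 ?sqrtr_ge0//.
rewrite sqr_sqrtr ?addr_ge0// sqrrD !sqr_sqrtr// -addrA lerD2l lerDr.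
by rewrite mulrn_wge0// mulr_ge0 ?sqrtr_ge0.
Qed.

(** Each x <= a + b satisfies x^q <= (a + b)^q x / (a + b), and the two fractions add up to 1. It
    gathers sums of 2p-th powers into a power of a sum. *)
Lemma powR_superadditive q a b : 1 <= q -> 0 <= a -> 0 <= b ->
  a `^ q + b `^ q <= (a + b) `^ q.
Proof.
move=> q1 a0 b0; have q0 : 0 < q by rewrite (lt_le_trans ltr01).
have [s0|s0] := eqVneq (a + b) 0.
  have /andP[/eqP -> /eqP ->] : (a == 0) && (b == 0) by rewrite -paddr_eq0// s0.
  by rewrite addr0 powR0 ?gt_eqF// addr0.
have sp : 0 < a + b by rewrite lt_def s0 addr_ge0.
have H x : 0 <= x -> x <= a + b -> x `^ q <= (a + b) `^ q * (x / (a + b)).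
  move=> x0 xs; rewrite -[in leLHS](divfK s0 x) mulrC powRM ?divr_ge0 ?(ltW sp)//.
  rewrite ler_pM2l ?powR_gt0//.
  have [->|xn0] := eqVneq x 0; first by rewrite mul0r powR0 ?gt_eqF.
  apply: ge1r_powR => //; apply/andP; split; last by rewrite ler_pdivrMr// mul1r.
  by rewrite divr_gt0// lt_def xn0.
apply: le_trans (lerD (H a a0 _) (H b b0 _)) _; rewrite ?lerDl ?lerDr//.
by rewrite -mulrDr -mulrDl divff// mulr1.
Qed.

(* Integrated with [m1] and [m2] the L^q norms of [x] and [y], this is Minkowski's
   inequality. *)
Lemma powR_convex_sum q (al be m1 m2 x y : R) : 1 <= q -> 0 <= al -> 0 <= be ->
  0 < m1 -> 0 < m2 -> 0 < al * m1 + be * m2 -> 0 <= x -> 0 <= y ->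
  (al * x + be * y) `^ q <= (al * m1 + be * m2) `^ q *
    (al * m1 / (al * m1 + be * m2) / m1 `^ q * x `^ q +
     be * m2 / (al * m1 + be * m2) / m2 `^ q * y `^ q).
Proof.
move=> q1 al0 be0 m10 m20 s0 x0 y0; set s := al * m1 + be * m2 in s0 *.
pose l := al * m1 / s.
have l0 : 0 <= l by rewrite divr_ge0 ?mulr_ge0// ltW.
have l1 : l <= 1 by rewrite ler_pdivrMr// mul1r lerDl mulr_ge0// ltW.
have lE : be * m2 / s = 1 - l by rewrite /l /s; field; rewrite gt_eqF.
rewrite lE -/l.
have -> : al * x + be * y = s * (l * (x / m1) + (1 - l) * (y / m2)).
  by rewrite -lE /l; field; rewrite !gt_eqF.
have x'0 : 0 <= x / m1 by rewrite divr_ge0// ltW.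
have y'0 : 0 <= y / m2 by rewrite divr_ge0// ltW.
have l1' : 0 <= 1 - l by rewrite subr_ge0.
rewrite powRM ?(ltW s0)//; last by apply: addr_ge0; exact: mulr_ge0.
rewrite ler_pM2l ?powR_gt0//.
have := @convex_powR R q q1 (Itv01 l0 l1) (x / m1) (y / m2).
rewrite !convRE /= !inE /= !in_itv /= !andbT => /(_ x'0 y'0)/le_trans; apply.
have E (z m : R) : 0 <= z -> 0 < m -> (z / m) `^ q = (m `^ q)^-1 * z `^ q.
  move=> z0 m0; have mi : 0 <= m^-1 by rewrite invr_ge0 ltW.
  by rewrite powRM// mulrC; congr (_ * _);
    rewrite -powR_inv1 ?ltW// powRAC powR_inv1 ?powR_ge0.
by rewrite !E// !mulrA.
Qed.

Lemma rfact_ge0 q : 0 <= rfact q.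
Proof.
rewrite /rfact /Gamma /Rintegral fine_ge0// integral_ge0// => x _.
by rewrite lee_fin mulr_ge0 ?powR_ge0 ?expR_ge0.
Qed.

End PowerInequalities.

Section PositiveDefiniteTrace.
Context {R : realType} {d : nat}.

Lemma tr_pd_gt0 (A : 'M[R]_d) : (0 < d)%N -> pdmx A -> 0 < \tr A.
Proof.
move=> hd [_ pA]; have D i : 0 < A i i.
  rewrite -qform_delta; apply: pA;
    apply/negP => /eqP/(congr1 (fun u : 'cV[R]_d => u i 0)).
  by rewrite !mxE !eqxx => /eqP; rewrite oner_eq0.
rewrite /mxtrace (bigD1 (Ordinal hd))//=; apply: ltr_wpDr => //.
by apply: sumr_ge0 => i _; exact: ltW.
Qed.

End PositiveDefiniteTrace.

Section UpperBound.
Context {R : realType} {d : nat} (hd : (0 < d)%N).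
Context (N : 'cV[R]_d -> R) (hN : is_norm N) (Sigma : 'M[R]_d)
  (hSigma : pdmx Sigma) (kappa rho : R) (hk : 0 < kappa) (hr : 0 <= rho).
Context {disp : measure_display} {T : measurableType disp} {P : probability T R}
  (G : 'I_d -> {RV P >-> R}) (hG : std_gaussian G).
Implicit Types (u v x y g : 'cV[R]_d) (w : T).
Local Notation EE f := (Rintegral P setT f).

Let S := sqrtmx Sigma.
Let F := gradS N Sigma kappa rho.
Let sq := rho * Num.sqrt (square_norm N Sigma).

Let sq_ge0 : 0 <= sq. Proof. by rewrite mulr_ge0 ?sqrtr_ge0. Qed.

Let S_psd : psdmx S. Proof. by have [] := sqrtmx_pd hd hSigma. Qed.

Let SS : S *m S = Sigma. Proof. by have [] := sqrtmx_pd hd hSigma. Qed.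

Let Sigma_psd : psdmx Sigma. Proof. exact: psd_of_pd. Qed.

Let opS : opnorm S <= Num.sqrt (opnorm Sigma).
Proof.
rewrite -(ger0_norm (opnorm_ge0 S)) -sqrtr_sqr ler_wsqrtr// -SS.
exact: opnorm_sqr_sym S_psd.1.
Qed.

Lemma normM_gradS_le g : normM Sigma (F g) <= sq.
Proof.
rewrite /normM /sq -[rho in leRHS]ger0_norm// -sqrtr_sqr -sqrtrM ?sqr_ge0// ler_wsqrtr//.
apply: le_trans (qform_le_square_norm hN _ _) _.
rewrite mulrC ler_wpM2r ?square_norm_ge0//.
by apply: lerXn2r; rewrite ?nnegrE ?dual_norm_ge0//; exact: dual_grad_le.
Qed.

Lemma normM_Sigma_le u : normM Sigma u <= Num.sqrt (opnorm S) * normM S u.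
Proof.
rewrite /normM -sqrtrM ?opnorm_ge0// ler_wsqrtr//.
rewrite -SS qformE -mulmxA -{1}(S_psd.1) -dotv_mull.
exact: psd_mulmx_sqr_le.
Qed.

(** tau g lies in the region where [F] is linear. The remainder F g - F (tau g) is controlled in the
    norm of [S], where [F] is kappa-Lipschitz, and moving it to the norm of [Sigma] costs sqrt
    (opnorm S). *)
Lemma normM_gradS_small (tau : R) g : 0 < tau -> tau <= 1 ->
  dual_norm N g < rho / (tau * kappa) ->
  normM Sigma (F g) <=
    kappa * ((1 - tau) * Num.sqrt (opnorm S) * normM S g + tau * normM Sigma g).
Proof.
move=> t0 t1 Hg; have tk : 0 < tau * kappa by exact: mulr_gt0.
have Ft : F (tau *: g) = (kappa * tau) *: g.
  rewrite -scalerA; apply: gradS_small => //; rewrite scalerA mulrC.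
  rewrite (dual_normZ hN _ (ltW tk)) [leLHS]mulrC -ler_pdivlMr//; exact: ltW.
rewrite -[F g](subrK (F (tau *: g))); apply: le_trans (normM_triangle _ _ Sigma_psd) _.
rewrite mulrDr; apply: lerD; last first.
  by rewrite Ft normMZ ger0_norm ?mulrA// mulr_ge0// ltW.
apply: le_trans (normM_Sigma_le _) _.
rewrite (_ : _ * (_ * normM S g)
  = Num.sqrt (opnorm S) * (kappa * (1 - tau) * normM S g)); last by ring.
rewrite ler_wpM2l ?sqrtr_ge0//.
have k1 : 0 <= kappa * (1 - tau) by rewrite mulr_ge0 ?subr_ge0// ltW.
rewrite -ler_sqr ?nnegrE ?normM_ge0 ?(mulr_ge0 k1)// ?normM_ge0//.
rewrite !exprMn !(normM_sqr _ S_psd).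
apply: le_trans (gradS_nonexp hd hN hSigma hk hr _ _) _.
have -> : g - tau *: g = (1 - tau) *: g by rewrite scalerBl scale1r.
by rewrite qformZ -/S mulrA.
Qed.

Lemma coord_measurable_normM (A : 'M[R]_d) : coord_measurable (normM A).
Proof.
apply: (@coord_measurable_comp _ _ _ (@Num.sqrt R)); last exact: coord_measurable_qform.
by apply: continuous_measurable_fun; exact: sqrt_continuous.
Qed.

Lemma nn_normM_powR (A : 'M[R]_d) (q : R) : coord_measurable (fun v => normM A v `^ q) /\
  (forall v, 0 <= normM A v `^ q).
Proof.
split; last by move=> v; exact: powR_ge0.
apply: (@coord_measurable_comp _ _ _ (fun z => z `^ q));
  last exact: coord_measurable_normM.
exact: measurable_powR.
Qed.

Lemma normM_moment (A : 'M[R]_d) (m : R) : psdmx A -> 0 < \tr A -> 0 <= m ->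
  (mean G (fun v => (normM A v `^ (2 * m))%R) <=
    (Num.sqrt (\tr A + m * opnorm A) `^ (2 * m))%:E)%E.
Proof.
move=> pA tA m0; rewrite sqrtr_powR;
  last by rewrite addr_ge0 ?(ltW tA)// mulr_ge0 ?opnorm_ge0.
under [X in mean _ X]eq_fun => v do rewrite sqrtr_powR ?pA.2//.
exact: qform_moment.
Qed.

Context (p : R) (p1 : 1 <= p).
Let p0 : 0 < p. Proof. exact: lt_le_trans p1. Qed.

Definition bracket_dev (tau : R) : R :=
  (1 - tau) * opnorm Sigma `^ (1 / 4) * Num.sqrt (\tr S)
  + tau * Num.sqrt (\tr Sigma) + Num.sqrt (2 * p) * Num.sqrt (opnorm Sigma).

Lemma combined_measurable (tau q : R) : coord_measurable (fun g =>
  (kappa * ((1 - tau) * Num.sqrt (opnorm S) * normM S g + tau * normM Sigma g)) `^ q).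
Proof.
apply: (@coord_measurable_comp _ _ _ (fun z => z `^ q)); first exact: measurable_powR.
apply: coord_measurableM; first exact: coord_measurable_cst.
apply: coord_measurableD; apply: coord_measurableM; try exact: coord_measurable_cst.
  exact: coord_measurable_normM.
exact: coord_measurable_normM.
Qed.

(** Minkowski's inequality in L^(4p), with [m1] and [m2] the bounds of [qform_moment] at exponent 2
    p. The order is 4 p because Cauchy-Schwarz will be applied to a moment of order 2 p. *)
Lemma combined_moment (tau : R) : 0 < tau -> tau <= 1 ->
  (mean G (fun g => (
      (kappa * ((1 - tau) * Num.sqrt (opnorm S) * normM S g + tau * normM Sigma g))
      `^ (2 * (2 * p)))%R) <= ((kappa * bracket_dev tau) `^ (2 * (2 * p)))%:E)%E.
Proof.
move=> t0 t1; set q := 2 * (2 * p).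
have q1 : 1 <= q by rewrite /q; have := p1; lra.
have q0 : 0 <= q by exact: le_trans q1.
have [S_pd Sig_tr] : pdmx S /\ 0 < \tr Sigma.
  by split; [apply: psd_unit_pd => //; have [] := sqrtmx_pd hd hSigma|exact: tr_pd_gt0].
have S_tr : 0 < \tr S by exact: tr_pd_gt0.
pose al := (1 - tau) * Num.sqrt (opnorm S).
pose m1 := Num.sqrt (\tr S + 2 * p * opnorm S).
pose m2 := Num.sqrt (\tr Sigma + 2 * p * opnorm Sigma).
have al0 : 0 <= al by rewrite mulr_ge0 ?sqrtr_ge0// subr_ge0.
have pp : 0 <= 2 * p by rewrite mulr_ge0// ltW.
have m10 : 0 < m1 by rewrite sqrtr_gt0 ltr_pwDl// mulr_ge0 ?opnorm_ge0.
have m20 : 0 < m2 by rewrite sqrtr_gt0 ltr_pwDl// mulr_ge0 ?opnorm_ge0.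
set s := al * m1 + tau * m2.
have s0 : 0 < s by apply: ltr_wpDl; [rewrite mulr_ge0// ltW|exact: mulr_gt0].
have oS0 := opnorm_ge0 S; have oSig0 := opnorm_ge0 Sigma.
have sb : s <= bracket_dev tau.
  set rS := Num.sqrt (opnorm S); set rp := Num.sqrt (2 * p).
  set tS := Num.sqrt (\tr S); set tSig := Num.sqrt (\tr Sigma).
  set rSig := Num.sqrt (opnorm Sigma).
  have m1E : m1 <= tS + rp * rS.
    by rewrite /rp /rS -sqrtrM//; apply: sqrtrD_le; [exact: ltW|exact: mulr_ge0].
  have m2E : m2 <= tSig + rp * rSig.
    by rewrite /rp /rSig -sqrtrM//; apply: sqrtrD_le; [exact: ltW|exact: mulr_ge0].
  have rSE : rS <= opnorm Sigma `^ (1 / 4).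
    have -> : 1 / 4 = 2^-1 * 2^-1 :> R by field.
    by rewrite powRrM powR12_sqrt// powR12_sqrt ?sqrtr_ge0// ler_wsqrtr.
  have rS2 : rS * rS <= rSig by rewrite -expr2 sqr_sqrtr.
  have t1' : 0 <= 1 - tau by rewrite subr_ge0.
  have h1 := ler_wpM2l al0 m1E; have h2 := ler_wpM2l (ltW t0) m2E.
  have h3 : (1 - tau) * tS * rS <= (1 - tau) * tS * opnorm Sigma `^ (1 / 4).
    by rewrite ler_wpM2l// mulr_ge0 ?sqrtr_ge0.
  (* With this the two deviation terms, weighted 1 - tau and tau, merge into the single sqrt(2 p)
     term of the bracket. *)
  have h4 : (1 - tau) * rp * (rS * rS) <= (1 - tau) * rp * rSig.
    by rewrite ler_wpM2l// mulr_ge0 ?sqrtr_ge0.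
  rewrite /bracket_dev -/tS -/tSig -/rp -/rSig /s.
  rewrite /al -/rS in h1 *; lra.
apply: (@le_trans _ _ ((kappa * s) `^ q)%:E); last first.
  rewrite lee_fin; apply: ler_powR_base => //; last by rewrite ler_pM2l.
  by apply: mulr_ge0; exact: ltW.
have si : 0 <= s^-1 by rewrite invr_ge0 ltW.
(* Coefficients from [powR_convex_sum], normalised so that replacing the moments by m1^q and m2^q
   returns (kappa s)^q, as [cE] checks. *)
pose c1 := (kappa * s) `^ q * (al * m1 / s / m1 `^ q).
pose c2 := (kappa * s) `^ q * (tau * m2 / s / m2 `^ q).
have c10 : 0 <= c1.
  apply: mulr_ge0; first exact: powR_ge0.
  apply: mulr_ge0; last by rewrite invr_ge0 powR_ge0.
  by apply: mulr_ge0 => //; apply: mulr_ge0 => //; exact: ltW.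
have c20 : 0 <= c2.
  apply: mulr_ge0; first exact: powR_ge0.
  apply: mulr_ge0; last by rewrite invr_ge0 powR_ge0.
  by apply: mulr_ge0 => //; apply: mulr_ge0 => //; exact: ltW.
have key v : (kappa * (al * normM S v + tau * normM Sigma v)) `^ q <=
    c1 * normM S v `^ q + c2 * normM Sigma v `^ q.
  have S0 := normM_ge0 S v; have Sg0 := normM_ge0 Sigma v.
  rewrite (powRM _ (ltW hk)); last first.
    by apply: addr_ge0; [exact: mulr_ge0 al0 S0|exact: mulr_ge0 (ltW t0) Sg0].
  have := powR_convex_sum q1 al0 (ltW t0) m10 m20 s0 S0 Sg0.
  move/(ler_wpM2l (powR_ge0 kappa q))/le_trans; apply.
  rewrite mulrA -(powRM _ (ltW hk) (ltW s0)) mulrDr.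
  by rewrite le_eqVlt; apply/orP; left; apply/eqP; congr (_ + _); exact: mulrA.
have cE : c1 * m1 `^ q + c2 * m2 `^ q = (kappa * s) `^ q.
  have mq1 : m1 `^ q != 0 by rewrite gt_eqF ?powR_gt0.
  have mq2 : m2 `^ q != 0 by rewrite gt_eqF ?powR_gt0.
  rewrite /c1 /c2; move: (m1 `^ q) (m2 `^ q) mq1 mq2 => a b a0 b0.
  have E : al * m1 / s + tau * m2 / s = 1 by rewrite -mulrDl divff// gt_eqF.
  move: (_ `^ _) (al * m1 / s) (tau * m2 / s) E => X l r E.
  by rewrite -!mulrA !mulVf// !mulr1 -mulrDr E mulr1.
have M1 : (mean G (fun v => (normM S v `^ q)%R) <= (m1 `^ q)%:E)%E :=
  normM_moment S_psd S_tr pp.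
have M2 : (mean G (fun v => (normM Sigma v `^ q)%R) <= (m2 `^ q)%:E)%E :=
  normM_moment Sigma_psd Sig_tr pp.
rewrite -cE; clearbody c1 c2; move: (m1 `^ q) (m2 `^ q) M1 M2 => a b M1 M2.
have n1 := nnZ c10 (nn_normM_powR S q); have n2 := nnZ c20 (nn_normM_powR Sigma q).
apply: (@le_trans _ _ (mean G (fun g => c1 * normM S g `^ q + c2 * normM Sigma g `^ q))).
  apply: mean_le => //.
  - by split; [exact: combined_measurable|move=> v; exact: powR_ge0].
  - split; last by move=> v; apply: addr_ge0; [exact: n1.2|exact: n2.2].
    by apply: coord_measurableD; [exact: n1.1|exact: n2.1].
rewrite (mean_lincomb G c10 c20 (nn_normM_powR S q) (nn_normM_powR Sigma q)).
have c1E : (0 <= c1%:E)%E by exact: c10.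
have c2E : (0 <= c2%:E)%E by exact: c20.
exact: leeD (lee_wpmul2l c1E M1) (lee_wpmul2l c2E M2).
Qed.

Lemma coord_measurable_gradS (h : 'cV[R]_d -> R) : coord_measurable h ->
  coord_measurable (fun g => h (F g)).
Proof.
move=> mh disp' T' Y mY.
have mF i := gradS_coord_measurable hd hN hSigma hk hr i mY.
have := mh _ T' (fun i z => F (\col_j Y j z) i 0) mF.
by apply: eq_measurable_fun => z _; congr h; apply/colP => i; rewrite mxE.
Qed.

Let nF g := normM Sigma (F g).

Lemma bounded_gradS_powR (q : R) : 0 <= q -> bounded_rv (fun w => nF (rvec G w) `^ q).
Proof.
move=> q0; split; last first.
  exists (sq `^ q) => w; rewrite ger0_norm ?powR_ge0//.
  by apply: ler_powR_base => //; [exact: normM_ge0|exact: normM_gradS_le].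
apply: (measurable_rvec G (h := fun g => nF g `^ q)).
exact: (coord_measurable_gradS (nn_normM_powR Sigma q).1).
Qed.

Definition far_set (s : R) : set T := [set w | s <= dual_norm N (rvec G w)].

Lemma measurable_far_set s : measurable (far_set s).
Proof.
have [C C0 HC] := dual_norm_lipschitz hN.
have md := measurable_rvec G (delta_measurable (ltW C0) HC).
have := md measurableT `[s, +oo[%classic (measurable_itv _); rewrite setTI.
by congr measurable; apply/seteqP; split=> w; rewrite /= in_itv/= andbT.
Qed.

Lemma T_lt_E s : T_lt N G s = fine (P (~` far_set s)).
Proof.
rewrite /T_lt /T_ge probability_setC; last exact: measurable_far_set.
by rewrite fineB ?fin_num_measure//; exact: measurable_far_set.
Qed.

Let Y w : R := nF (rvec G w) `^ (2 * p).
Let e : R := EE Y.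

Lemma gradS_moment_crude : e <= sq `^ (2 * p).
Proof.
have p20 : 0 <= 2 * p by rewrite mulr_ge0// ltW.
rewrite -[leRHS](ERcst P (sq `^ (2 * p))); apply: ER_le; first exact: bounded_gradS_powR.
  exact: bounded_rv_cst.
by move=> w; apply: ler_powR_base => //; [exact: normM_ge0|exact: normM_gradS_le].
Qed.

Definition bracket (tau : R) : R :=
  T_ge N G (rho / (tau * kappa)) `^ (1 / (2 * p))
    * rho * Num.sqrt (square_norm N Sigma)
  + T_lt N G (rho / (tau * kappa)) `^ (1 / (4 * p)) * kappa * bracket_dev tau.

(** Split on [far_set]. Far away the uniform bound [sq] gives the [T_ge] term. Nearby,
    Cauchy-Schwarz separates the moment of order 4 p from the root of [T_lt], whence the exponent
    1/(4p) after taking a 2p-th root. *)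
Lemma gradS_moment_bracket (tau : R) : 0 < tau -> tau <= 1 ->
  e <= bracket tau `^ (2 * p).
Proof.
move=> t0 t1; rewrite /bracket; set s := rho / (tau * kappa).
have p20 : 0 < 2 * p by rewrite mulr_gt0.
have p40 : 0 < 2 * (2 * p) by rewrite mulr_gt0.
have bY : bounded_rv Y by exact: bounded_gradS_powR (ltW p20).
have mD := measurable_far_set s; have mDc := measurableC mD.
pose f : T -> R := \1_(far_set s); pose g : T -> R := \1_(~` far_set s).
have bf : bounded_rv f by exact: bounded_rv_indic.
have bg : bounded_rv g by exact: bounded_rv_indic.
have gg w : g w * g w = g w by rewrite /g indicE; case: (_ \in _); rewrite ?mulr1 ?mulr0.
have Yfg w : Y w = Y w * f w + Y w * g w.
  rewrite -mulrDr /f /g !indicE in_setC; case: (_ \in _);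
    rewrite /= ?addr0 ?add0r mulr1//.
have eE : e = EE (fun w => Y w * f w) + EE (fun w => Y w * g w).
  rewrite -ERD; [|exact: bounded_rvM|exact: bounded_rvM].
  by apply: eq_Rintegral => w _; exact: Yfg.
have Ef : EE f = T_ge N G s by exact: ER_indic.
have Eg : EE g = T_lt N G s by rewrite T_lt_E; exact: ER_indic.
have Tge0 : 0 <= T_ge N G s by exact: T_ge_ge0.
have Tlt0 : 0 <= T_lt N G s by rewrite T_lt_E fine_ge0.
have E1 : EE (fun w => Y w * f w) <= sq `^ (2 * p) * T_ge N G s.
  rewrite -Ef -ERZ//; apply: ER_le; [exact: bounded_rvM|exact: bounded_rvZ|].
  move=> w; apply: ler_wpM2r; first by rewrite /f indicE; case: (_ \in _).
  by apply: ler_powR_base; [exact: ltW|exact: normM_ge0|exact: normM_gradS_le].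
set b := kappa * bracket_dev tau.
have b0 : 0 <= b.
  rewrite mulr_ge0 ?(ltW hk)// /bracket_dev !addr_ge0 ?mulr_ge0 ?powR_ge0
    ?sqrtr_ge0 ?(ltW t0)//.
  by rewrite subr_ge0.
have E2 : EE (fun w => (Y w * g w) * (Y w * g w)) <= b `^ (2 * (2 * p)).
  have bYg := bounded_rvM bY bg; have bYg2 := bounded_rvM bYg bYg.
  rewrite -lee_fin -bounded_rv_EFin//; apply: le_trans (combined_moment t0 t1).
  apply: ge0_le_integral => [//|w _|||w _].
  - by rewrite lee_fin -expr2 sqr_ge0.
  - by apply/measurable_EFinP; exact: bYg2.1.
  - by apply/measurable_EFinP;
    exact: (measurable_rvec G (combined_measurable tau (2 * (2 * p)))).
  - rewrite lee_fin /g indicE in_setC; case: (boolP (w \in far_set s)) => /= [_|].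
      by rewrite !mulr0 powR_ge0.
    rewrite notin_setE /far_set /= => /negP; rewrite -ltNge => Hw; rewrite mulr1.
    rewrite /Y -powRD; last by rewrite implybE gt_eqF// addr_gt0.
    have <- : 2 * (2 * p) = 2 * p + 2 * p :> R by ring.
    apply: ler_powR_base; [exact: ltW|exact: normM_ge0|exact: normM_gradS_small].
have E3 : EE (fun w => Y w * g w) <= b `^ (2 * p) * T_lt N G s `^ (1 / 2).
  have := ER_CS P (bounded_rvM bY bg) bg.
  rewrite (_ : EE (fun w => Y w * g w * g w) = EE (fun w => Y w * g w)); last first.
    by apply: eq_Rintegral => w _; rewrite -mulrA gg.
  rewrite (_ : EE (fun w => g w * g w) = T_lt N G s); last first.
    by rewrite -Eg; apply: eq_Rintegral => w _; rewrite gg.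
  move=> CS; rewrite -ler_sqr ?nnegrE ?mulr_ge0 ?powR_ge0//; last first.
    rewrite -(ERcst P 0); apply: ER_le; [exact: bounded_rv_cst|exact: bounded_rvM|].
    move=> w; apply: mulr_ge0; first exact: powR_ge0.
    by rewrite /g indicE; case: (_ \in _).
  apply: le_trans CS _; rewrite exprMn; apply: ler_pM => //.
  - rewrite -(ERcst P 0); apply: ER_le; [exact: bounded_rv_cst|apply: bounded_rvM;
    exact: bounded_rvM|].
    by move=> w; rewrite -expr2 sqr_ge0.
  - apply: le_trans E2 _; rewrite -powR_mulrn ?powR_ge0// -powRrM.
    by rewrite [2 * p * _]mulrC.
  - by rewrite -powR_mulrn ?powR_ge0// -powRrM mul1r mulVf// powRr1.
rewrite eE; apply: le_trans (lerD E1 E3) _.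
have H1 : sq `^ (2 * p) * T_ge N G s =
    (T_ge N G s `^ (1 / (2 * p)) * rho * Num.sqrt (square_norm N Sigma)) `^ (2 * p).
  rewrite -[_ * rho * _]mulrA -/sq powRM ?powR_ge0// -powRrM.
  by rewrite mulrC div1r mulVf ?gt_eqF// powRr1.
have H2 : b `^ (2 * p) * T_lt N G s `^ (1 / 2) =
    (T_lt N G s `^ (1 / (4 * p)) * kappa * bracket_dev tau) `^ (2 * p).
  rewrite -[_ * kappa * _]mulrA -/b powRM ?powR_ge0// -powRrM mulrC; congr (_ `^ _ * _).
  by field; rewrite gt_eqF.
rewrite H1 H2; apply: powR_superadditive.
- by have := p1; lra.
- by rewrite -mulrA mulr_ge0 ?powR_ge0.
- by rewrite -mulrA mulr_ge0 ?powR_ge0.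
Qed.

Definition Omega_core : R :=
  Num.min (rho * Num.sqrt (square_norm N Sigma))
    (inf [set bracket tau | tau in `]0, 1] ]).

Let e_ge0 : 0 <= e.
Proof.
rewrite -(ERcst P 0); apply: ER_le; first exact: bounded_rv_cst.
  by apply: bounded_gradS_powR; rewrite mulr_ge0// ltW.
by move=> w; exact: powR_ge0.
Qed.

Let e_root (c : R) : 0 <= c -> e <= c `^ (2 * p) -> e `^ (2 * p)^-1 <= c.
Proof.
move=> c0 ec; have p20 : 0 < 2 * p by rewrite mulr_gt0.
apply: (@le_trans _ _ ((c `^ (2 * p)) `^ (2 * p)^-1)).
  by apply: ler_powR_base => //; rewrite invr_ge0 ltW.
by rewrite -powRrM divff ?gt_eqF// powRr1.
Qed.

Lemma bracket_ge0 (tau : R) : 0 < tau -> tau <= 1 -> 0 <= bracket tau.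
Proof.
move=> t0 t1; rewrite addr_ge0// -mulrA mulr_ge0 ?powR_ge0// mulr_ge0 ?(ltW hk)//.
by rewrite /bracket_dev !addr_ge0 ?mulr_ge0 ?powR_ge0 ?sqrtr_ge0 ?(ltW t0)// subr_ge0.
Qed.

(** The infimum over tau sits inside the power, so it is taken after extracting the 2p-th root of
    each bound. *)
Lemma Omega_core_lb : e `^ (2 * p)^-1 <= Omega_core.
Proof.
rewrite le_min; apply/andP; split; first exact: e_root gradS_moment_crude.
apply: lb_le_inf.
  by eexists; exists 1 => //; rewrite /= in_itv/= ltr01 lexx.
move=> _ /= [tau ht <-]; move: ht; rewrite in_itv/= => /andP[t0 t1].
by apply: e_root; [exact: bracket_ge0|exact: gradS_moment_bracket].
Qed.

Lemma Omega_core_ge0 : 0 <= Omega_core.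
Proof. by apply: le_trans Omega_core_lb; exact: powR_ge0. Qed.

Lemma gradS_moment : e <= Omega_core `^ (2 * p).
Proof.
have p20 : 0 < 2 * p by rewrite mulr_gt0.
have := ler_powR_base (ltW p20) (powR_ge0 _ _) Omega_core_lb.
by rewrite -powRrM mulVf ?gt_eqF// powRr1.
Qed.

Lemma Omega_SigmaE (eta1 eta2 : R) : Omega_Sigma N Sigma G eta1 eta2 p kappa rho =
  eta1 * Num.sqrt p * Omega_core + 2 * eta2 * p * rho.
Proof. by []. Qed.

Lemma moment_bound_measurable (eta1 eta2 : R) : coord_measurable (fun g =>
  rfact p * (eta1 * normM Sigma (F g)) `^ (2 * p)
  + rfact (2 * p) * (eta2 * dual_norm N (F g)) `^ (2 * p)).
Proof.
pose h u := rfact p * (eta1 * normM Sigma u) `^ (2 * p)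
  + rfact (2 * p) * (eta2 * dual_norm N u) `^ (2 * p).
apply: (coord_measurable_gradS (h := h)).
have mdual : coord_measurable (dual_norm N).
  by have [C C0 HC] := dual_norm_lipschitz hN; exact: delta_measurable (ltW C0) HC.
have mpow (k : 'cV[R]_d -> R) c c' q : coord_measurable k ->
    coord_measurable (fun v => c * (c' * k v) `^ q).
  move=> mk; apply: coord_measurableM; first exact: coord_measurable_cst.
  apply: (@coord_measurable_comp _ _ _ (fun z => z `^ q)); first exact: measurable_powR.
  by apply: coord_measurableM => //; exact: coord_measurable_cst.
by apply: coord_measurableD; apply: mpow => //; exact: coord_measurable_normM.
Qed.

(* The integrand is the right-hand side of the moment hypothesis at
   [u = F (rvec G w)]. *)
Lemma Omega_moment (eta1 eta2 : R) : 0 <= eta1 -> 0 <= eta2 ->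
  (\int[P]_w (rfact p * (eta1 * normM Sigma (F (rvec G w))) `^ (2 * p)
     + rfact (2 * p) * (eta2 * dual_norm N (F (rvec G w))) `^ (2 * p))%:E <=
   (Omega_Sigma N Sigma G eta1 eta2 p kappa rho `^ (2 * p))%:E)%E.
Proof.
move=> e10 e20; have p20 : 0 < 2 * p by rewrite mulr_gt0.
have p21 : 1 <= 2 * p by have := p1; lra.
set c1 := (eta1 * Num.sqrt p) `^ (2 * p); set c2 := (2 * eta2 * p * rho) `^ (2 * p).
have c10 : 0 <= c1 by exact: powR_ge0.
have bY : bounded_rv Y by exact: bounded_gradS_powR (ltW p20).
(* p! <= p^p is absorbed as the 2p-th power of sqrt p; in the same way (2p)! <= (2p)^(2p) yields 2 p
   in [pq]. *)
have pp u : rfact p * (eta1 * normM Sigma u) `^ (2 * p) <= c1 * normM Sigma u `^ (2 * p).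
  rewrite powRM ?normM_ge0// mulrA ler_wpM2r ?powR_ge0// /c1 powRM ?sqrtr_ge0//
    sqrtr_powR ?(ltW p0)//.
  by rewrite mulrC ler_wpM2l ?powR_ge0//; exact: rfact_le.
have pq g : rfact (2 * p) * (eta2 * dual_norm N (F g)) `^ (2 * p) <= c2.
  apply: (@le_trans _ _ ((2 * p) `^ (2 * p) * (eta2 * rho) `^ (2 * p))).
    apply: ler_pM; rewrite ?powR_ge0//; [exact: rfact_ge0|exact: rfact_le|].
    apply: ler_powR_base; [exact: ltW|by rewrite mulr_ge0 ?dual_norm_ge0|].
    by rewrite ler_wpM2l//; exact: dual_grad_le.
  rewrite -powRM ?(ltW p20) ?mulr_ge0// /c2 le_eqVlt; apply/orP; left; apply/eqP.
  by congr (_ `^ _); ring.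
apply: (@le_trans _ _ (\int[P]_w (c1 * Y w + c2)%:E)%E).
  apply: ge0_le_integral => [//|w _|||w _].
  - by rewrite lee_fin addr_ge0// mulr_ge0 ?rfact_ge0 ?powR_ge0.
  - apply/measurable_EFinP.
    exact: (measurable_rvec G (moment_bound_measurable eta1 eta2)).
  - by apply/measurable_EFinP; apply: measurable_funD => //; exact: (bounded_rvZ c1 bY).1.
  - by rewrite lee_fin; apply: lerD; [exact: pp|exact: pq].
have bcY := bounded_rvZ c1 bY.
rewrite bounded_rv_EFin; last by apply: bounded_rvD => //; exact: bounded_rv_cst.
rewrite lee_fin ERD//; last exact: bounded_rv_cst.
rewrite ERZ// ERcst Omega_SigmaE.
apply: (@le_trans _ _ ((eta1 * Num.sqrt p * Omega_core) `^ (2 * p) + c2)).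
  rewrite lerD2r (powRM _ _ Omega_core_ge0) ?mulr_ge0 ?sqrtr_ge0// ler_wpM2l//.
  exact: gradS_moment.
apply: powR_superadditive => //; first by rewrite !mulr_ge0 ?sqrtr_ge0 ?Omega_core_ge0.
by rewrite !mulr_ge0// ltW.
Qed.


End UpperBound.

(** * Tail bound *)

Section Tail.
Context {R : realType} {d : nat} (hd : (0 < d)%N)
  (N : 'cV[R]_d -> R) (hN : is_norm N)
  (dispX : measure_display) (TX : measurableType dispX)
  (P : probability TX R) (X : 'I_d -> {RV P >-> R})
  (Sigma : 'M[R]_d) (hSigma : pdmx Sigma)
  (eta1 eta2 : R) (heta1 : 0 <= eta1) (heta2 : 0 <= eta2)
  (hmom : forall (p : R) (u : 'cV[R]_d), 1 <= p ->
    ('E_P[fun w => (`|dotv u (rvec X w)| `^ (2 * p))%R] <=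
      (rfact p * (eta1 * normM Sigma u) `^ (2 * p)
       + rfact (2 * p) * (eta2 * dual_norm N u) `^ (2 * p))%:E)%E)
  (dispG : measure_display) (TG : measurableType dispG)
  (PG : probability TG R) (G : 'I_d -> {RV PG >-> R}) (hG : std_gaussian G).

Lemma is_norm_coord_measurable : coord_measurable N.
Proof.
have [C C0 HC] := is_norm_le_norm2 hN.
apply: (@lipschitz_coord_measurable _ _ _ C) => // x y.
exact: le_trans (is_norm_dist hN x y) (HC _).
Qed.

Lemma measurable_norm_ge b : measurable [set w | b <= N (rvec X w)].
Proof.
have mN := measurable_rvec X is_norm_coord_measurable.
have := mN measurableT `[b, +oo[%classic (measurable_itv _); rewrite setTI.
by congr measurable; apply/seteqP; split=> w; rewrite /= in_itv/= andbT.
Qed.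

Section FixedParameters.
Context (p rho kappa : R) (p1 : 1 <= p) (hr : 0 <= rho) (hk : 0 < kappa).
Let F := gradS N Sigma kappa rho.
Let p20 : 0 < 2 * p. Proof. by rewrite mulr_gt0// (lt_le_trans ltr01). Qed.

Let phi (z : TX * TG) : \bar R :=
  (`|dotv (F (rvec G z.2)) (rvec X z.1)| `^ (2 * p))%:E.

Let phi_measurable : measurable_fun [set: TX * TG] phi.
Proof.
have md : measurable_fun [set: TX * TG] (fun z => dotv (F (rvec G z.2)) (rvec X z.1)).
  have -> : (fun z : TX * TG => dotv (F (rvec G z.2)) (rvec X z.1)) =
      (fun z => \sum_i F (rvec G z.2) i 0 * X i z.1).
    apply/funext => z; rewrite dotvE; apply: eq_bigr => i _; congr (_ * _).
    by rewrite /rvec mxE.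
  apply: measurable_sum => i; apply: measurable_funM.
    have mF := measurable_rvec G (gradS_coord_measurable hd hN hSigma hk hr i).
    exact: (measurableT_comp mF measurable_snd).
  exact: (measurableT_comp (measurable_RV X i) measurable_fst).
have mn := measurableT_comp (@normr_measurable R setT) md.
by apply/measurable_EFinP; exact: (measurableT_comp (measurable_powR (2 * p)) mn).
Qed.

Let phi_ge0 z : (0 <= phi z)%E.
Proof. by rewrite lee_fin powR_ge0. Qed.

(** The [Z] of the overview. [X] and [G] live on different spaces, and the product of these provides
    their independence. *)
Definition proj_moment (w : TX) : \bar R := (\int[PG]_z phi (w, z))%E.

Lemma proj_moment_ge0 w : (0 <= proj_moment w)%E.
Proof. by apply: integral_ge0. Qed.

Lemma proj_moment_measurable : measurable_fun [set: TX] proj_moment.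
Proof. exact: measurable_fun_fubini_tonelli_F. Qed.

Lemma proj_moment_integral :
  (\int[P]_w proj_moment w <=
   (Omega_Sigma N Sigma G eta1 eta2 p kappa rho `^ (2 * p))%:E)%E.
Proof.
rewrite /proj_moment (fubini_tonelli phi)//.
apply: le_trans (Omega_moment hd hN hSigma hk hr hG p1 heta1 heta2).
apply: ge0_le_integral => [//|z _|||z _].
- exact: integral_ge0.
- exact: measurable_fun_fubini_tonelli_G.
- apply/measurable_EFinP.
  exact: (measurable_rvec G (moment_bound_measurable hd hN hSigma hk hr p eta1 eta2)).
- by have := hmom (F (rvec G z)) p1; rewrite unlock.
Qed.

(** By homogeneity, |<F, X>| >= N X on the large set of the normalised vector X / N X, whose
    probability is bounded below through [nu]. *)
Lemma norm_le_proj_moment (nu : R) w : 0 <= nu ->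
  (forall x, N x = 1 -> 1 <= nu * fine (PG (large_set N Sigma kappa rho G x))) ->
  ((N (rvec X w) `^ (2 * p))%:E <= nu%:E * proj_moment w)%E.
Proof.
move=> nu0 Hnu; have [E|xn0] := eqVneq (rvec X w) 0.
  by rewrite E (is_norm0 hN) powR0 ?gt_eqF// mule_ge0 ?proj_moment_ge0.
have N0 := is_norm_gt0 hN xn0; set n := N (rvec X w) in N0 *.
pose x := n^-1 *: rvec X w.
have x1 : N x = 1 by rewrite is_normZ// ger0_norm ?invr_ge0 ?(ltW N0)// mulVf ?gt_eqF.
have mL := measurable_large_set hd hN hSigma hk hr G x.
have H : ((n `^ (2 * p))%:E * PG (large_set N Sigma kappa rho G x) <= proj_moment w)%E.
  rewrite -[X in (_ * PG X)%E]setIT -integral_indic// -ge0_integralZl//; last 2 first.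
  - by apply/measurable_EFinP; exact: measurable_indic.
  - by rewrite lee_fin powR_ge0.
  apply: ge0_le_integral => [//|z _|||z _].
  - by rewrite -EFinM lee_fin mulr_ge0 ?powR_ge0.
  - by apply/measurable_EFinP; apply: measurable_funM => //; exact: measurable_indic.
  - exact: measurableT_comp phi_measurable (measurable_pair1 w).
  - rewrite -EFinM lee_fin indicE; case: (boolP (z \in _)) => [|_];
    last by rewrite mulr0 powR_ge0.
    rewrite inE /large_set /= mulr1 /x dotvZr normrM ger0_norm ?invr_ge0
      ?(ltW N0)// => Hz.
    apply: ler_powR_base; [exact: ltW|exact: ltW|].
    by rewrite mulrC ler_pdivlMr// mul1r in Hz.
apply: le_trans (lee_wpmul2l _ H); last by rewrite lee_fin.
rewrite -[PG _]fineK ?fin_num_measure// -!EFinM lee_fin mulrCA ler_peMr ?powR_ge0//.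
exact: Hnu.
Qed.

Lemma markov_norm (nu b : R) : 0 <= nu -> 0 <= b ->
  (forall x, N x = 1 -> 1 <= nu * fine (PG (large_set N Sigma kappa rho G x))) ->
  ((b `^ (2 * p))%:E * P [set w | (b <= N (rvec X w))%R] <=
   (nu * Omega_Sigma N Sigma G eta1 eta2 p kappa rho `^ (2 * p))%:E)%E.
Proof.
move=> nu0 b0 Hnu; have mb := measurable_norm_ge b.
rewrite EFinM; apply: le_trans (lee_wpmul2l _ proj_moment_integral);
  last by rewrite lee_fin.
rewrite -ge0_integralZl//; last 2 first.
- exact: proj_moment_measurable.
- by move=> w _; exact: proj_moment_ge0.
rewrite -[X in (_ * P X)%E]setIT -integral_indic// -ge0_integralZl//; last 2 first.
- by apply/measurable_EFinP; exact: measurable_indic.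
- by rewrite lee_fin powR_ge0.
apply: ge0_le_integral => [//|w _|||w _].
- by rewrite -EFinM lee_fin mulr_ge0 ?powR_ge0.
- by apply/measurable_EFinP; apply: measurable_funM => //; exact: measurable_indic.
- by apply: measurable_funeM; exact: proj_moment_measurable.
apply: le_trans (norm_le_proj_moment w nu0 Hnu).
rewrite -EFinM lee_fin indicE; case: (boolP (w \in _)) => [|_];
  last by rewrite mulr0 powR_ge0.
by rewrite inE /= mulr1 => Hw; apply: ler_powR_base => //; exact: ltW.
Qed.

Lemma Omega_Sigma_ge0 : 0 <= Omega_Sigma N Sigma G eta1 eta2 p kappa rho.
Proof.
rewrite Omega_SigmaE addr_ge0 ?mulr_ge0 ?sqrtr_ge0 ?Omega_core_ge0//.
by rewrite (le_trans ler01).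
Qed.

(** The strict inequality makes [b] positive, so Markov's inequality can be divided by b^(2p). *)
Lemma tail_bound_prob (t b : R) :
  (tail_bound N Sigma G eta1 eta2 t p kappa rho < b%:E)%E ->
  (P [set w | (b <= N (rvec X w))%R] <= (expR (- t))%:E)%E.
Proof.
have O0 := Omega_Sigma_ge0; set Om := Omega_Sigma _ _ _ _ _ _ _ _ in O0 *.
have c0 : 0 <= expR (t / (2 * p)) * Om by rewrite mulr_ge0 ?expR_ge0.
have ip : 1 / (2 * p) != 0 by rewrite div1r invr_eq0 gt_eqF.
rewrite /tail_bound -/Om; have [l0|l0] := eqVneq (lambda_inf N Sigma G kappa rho) 0%E.
  (* When [lambda_inf] vanishes the bound is infinite, even for a zero [Omega_Sigma] thanks to the
     convention on 0 times infinity, and cannot lie below [b]. *)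
  rewrite (nu_bar_infty l0) poweRyr// /mul_infty eqxx andbT /=.
  case: ifP => [_|]; first by rewrite ltNge leey.
  rewrite /= eqe => /negbT/norP[cn0 _].
  by rewrite gt0_muley ?lte_fin ?lt_def ?cn0// ltNge leey.
have [nu -> [nu0 Hnu]] := nu_bar_finite hd hN hSigma hk hr hG l0.
rewrite poweR_EFin /mul_infty !andbF -EFinM lte_fin => Hb.
have r0 : 0 <= expR (t / (2 * p)) * Om * nu `^ (1 / (2 * p))
  by rewrite mulr_ge0 ?powR_ge0.
have b0 : 0 < b by exact: le_lt_trans Hb.
have := markov_norm nu0 (ltW b0) Hnu.
have mb := measurable_norm_ge b.
rewrite -[P _]fineK ?fin_num_measure// -EFinM !lee_fin; set q := fine _ => Hq.
have bp : 0 < b `^ (2 * p) by exact: powR_gt0.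
rewrite -(ler_pM2l bp); apply: le_trans Hq _.
have := ler_powR_base (ltW p20) r0 (ltW Hb).
rewrite (powRM _ c0 (powR_ge0 _ _)) (powRM _ (expR_ge0 _) O0).
have -> : expR (t / (2 * p)) `^ (2 * p) = expR t.
  by rewrite -expRM divfK// gt_eqF.
rewrite -powRrM mulrC div1r mulVf ?gt_eqF// powRr1// => H.
have : expR (- t) * (expR t * (nu * Om `^ (2 * p))) <= expR (- t) * b `^ (2 * p).
  by rewrite ler_pM2l ?expR_gt0//; apply: le_trans H; rewrite mulrCA mulrA.
by rewrite mulrA -expRD addNr expR0 mul1r [leRHS]mulrC.
Qed.

End FixedParameters.

Lemma tail_bound_ge0 (t p rho kappa : R) : 1 <= p -> 0 <= rho -> 0 < kappa ->
  (0 <= tail_bound N Sigma G eta1 eta2 t p kappa rho)%E.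
Proof.
move=> p1 hr hk; rewrite /tail_bound /mul_infty; case: ifP => // _.
by rewrite mule_ge0 ?poweR_ge0// lee_fin mulr_ge0 ?expR_ge0 ?Omega_Sigma_ge0.
Qed.

End Tail.

Theorem theorem2 (R : realType) (d : nat) (hd : (0 < d)%N)
  (N : 'cV[R]_d -> R) (hN : is_norm N)
  (dispX : measure_display) (TX : measurableType dispX)
  (P : probability TX R) (X : 'I_d -> {RV P >-> R})
  (Sigma : 'M[R]_d) (hSigma : pdmx Sigma)
  (hmean : forall i, ('E_P[X i] = 0)%E)
  (hcov : forall i j, covariance P (X i) (X j) = (Sigma i j)%:E)
  (eta1 eta2 : R) (heta1 : 0 <= eta1) (heta2 : 0 <= eta2)
  (hmom : forall (p : R) (u : 'cV[R]_d), 1 <= p ->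
    ('E_P[fun w => (`|dotv u (rvec X w)| `^ (2 * p))%R] <=
      (rfact p * (eta1 * normM Sigma u) `^ (2 * p)
       + rfact (2 * p) * (eta2 * dual_norm N u) `^ (2 * p))%:E)%E)
  (dispG : measure_display) (TG : measurableType dispG)
  (PG : probability TG R) (G : 'I_d -> {RV PG >-> R}) (hG : std_gaussian G)
  (t : R) (ht : 0 <= t) :
  ((1 - expR (- t))%:E <=
   P [set w | ((N (rvec X w))%:E <=
        ereal_inf [set b | exists p rho0 kappa0 : R,
          [/\ (1 <= p)%R, (0 <= rho0)%R, (0 < kappa0)%R
            & b = tail_bound N Sigma G eta1 eta2 t p kappa0 rho0]])%E])%E.
Proof.
set B := ereal_inf _.
have B0 : (0 <= B)%E.
  by apply: le_ereal_inf_tmp => _ [p [rho [kappa [p1 hr hk ->]]]]; exact: tail_bound_ge0.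
have Bprob (b : R) : (B < b%:E)%E ->
  (P [set w | (b <= N (rvec X w))%R] <= (expR (- t))%:E)%E.
  move=> /ereal_inf_lt[_ [p [rho [kappa [p1 hr hk ->]]]]] Hb.
  exact: tail_bound_prob Hb.
case: B B0 Bprob => [B| |]// B0 Bprob; last first.
  rewrite (_ : [set w | _] = setT); last by apply/seteqP; split=> // w _ /=; exact: leey.
  have -> : P setT = 1%E by exact: probability_setT.
  by rewrite lee_fin lerBlDr lerDl expR_ge0.
(* Each b n exceeds the infimum, hence the bound of some choice of parameters. The events [E n]
   increase to B < N X, so continuity of the measure carries e^(-t) to the limit. *)
pose b n : R := B + n.+1%:R^-1.
pose E n := [set w | b n <= N (rvec X w)].
have mE n : measurable (E n) by exact: measurable_norm_ge.
have EU : \bigcup_n E n = [set w | B < N (rvec X w)].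
  apply/seteqP; split=> [w [n _]|w]; rewrite /E /b /=.
    by apply: lt_le_trans; rewrite ltrDl invr_gt0.
  rewrite -subr_gt0 => H; have [n Hn] := ltr_add_invr H.
  by exists n => //=; rewrite -lerBrDl ltW// -[ltLHS]add0r.
have mU : measurable (\bigcup_n E n) by exact: bigcup_measurable.
have PU : (P (\bigcup_n E n) <= (expR (- t))%:E)%E.
  have homoE : {homo E : n m / (n <= m)%N >-> (n <= m)%O}.
    apply/nondecreasing_seqP => n; apply/subsetPset => w; rewrite /E /= => H.
    by apply: le_trans H; rewrite /b lerD2l lef_pV2 ?posrE// ler_nat.
  have cv := nondecreasing_cvg_mu (mu := P) mE mU homoE.
  rewrite -(cvg_lim _ cv)//; apply: lime_le; first by apply/cvg_ex; eexists; exact: cv.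
  by apply: nearW => n; apply: Bprob; rewrite lte_fin ltrDl invr_gt0.
rewrite (_ : [set w | _] = ~` (\bigcup_n E n)); last first.
  by rewrite EU; apply/seteqP; split=> w /=; rewrite lee_fin leNgt => /negP.
rewrite probability_setC// EFinB; exact: leeB.
Qed.
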